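(* Let $I\subset\mathbb{R}$ be an open interval, let $(\boldsymbol{\gamma},\boldsymbol{\nu}_1,\boldsymbol{\nu}_2):I\to\mathbb{R}^3\times\Delta$ be a framed curve with unit tangent vector $\boldsymbol{\mu}=\boldsymbol{\nu}_1\times\boldsymbol{\nu}_2$, let $\{\boldsymbol{v},\boldsymbol{w},\boldsymbol{\mu}\}$ be a rotated frame along $\boldsymbol{\gamma}$, and let $(\overline{\ell},\overline{m},\overline{n},\alpha)$ be the curvature of the framed curve $(\boldsymbol{\gamma},\boldsymbol{v},\boldsymbol{w})$. Let $NS_{\boldsymbol{\gamma}}[\boldsymbol{v}]:I\times\mathbb{R}\to\mathbb{R}^3$, $NS_{\boldsymbol{\gamma}}[\boldsymbol{v}](t,\lambda)=\boldsymbol{\gamma}(t)+\lambda\boldsymbol{v}(t)$. Suppose that $(t_0,\lambda_0)\in I\times\mathbb{R}$ is a singular point of $NS_{\boldsymbol{\gamma}}[\boldsymbol{v}]$, namely $\lambda_0\overline{\ell}(t_0)=0$ and $\alpha(t_0)+\lambda_0\overline{m}(t_0)=0$. Then the singular point $(t_0,\lambda_0)$ of $NS_{\boldsymbol{\gamma}}[\boldsymbol{v}]$ is a cross cap if and only if $$\alpha(t_0)\dot{\overline{\ell}}(t_0)+\dot{\alpha}(t_0)\overline{\ell}(t_0)\neq 0.$$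
   Context: All maps are of class $C^\infty$. $S^2$ is the unit sphere in Euclidean space $\mathbb{R}^3$ and $\Delta=\{(\boldsymbol{x},\boldsymbol{y})\in S^2\times S^2\mid \boldsymbol{x}\cdot\boldsymbol{y}=0\}$. Framed curve: a smooth map $(\boldsymbol{\gamma},\boldsymbol{\nu}_1,\boldsymbol{\nu}_2):I\to\mathbb{R}^3\times\Delta$ with $\dot{\boldsymbol{\gamma}}(t)\cdot\boldsymbol{\nu}_1(t)=\dot{\boldsymbol{\gamma}}(t)\cdot\boldsymbol{\nu}_2(t)=0$ for all $t\in I$. Its unit tangent vector is $\boldsymbol{\mu}=\boldsymbol{\nu}_1\times\boldsymbol{\nu}_2$, and its curvature is $(\ell,m,n,\alpha)$ with $\ell=\dot{\boldsymbol{\nu}}_1\cdot\boldsymbol{\nu}_2$, $m=\dot{\boldsymbol{\nu}}_1\cdot\boldsymbol{\mu}$, $n=\dot{\boldsymbol{\nu}}_2\cdot\boldsymbol{\mu}$, $\alpha=\dot{\boldsymbol{\gamma}}\cdot\boldsymbol{\mu}$ (so $\dot{\boldsymbol{\gamma}}=\alpha\boldsymbol{\mu}$). Rotated frame: for a smooth function $\theta:I\to\mathbb{R}$ put $\boldsymbol{v}=\cos\theta\,\boldsymbol{\nu}_1-\sin\theta\,\boldsymbol{\nu}_2$ and $\boldsymbol{w}=\sin\theta\,\boldsymbol{\nu}_1+\cos\theta\,\boldsymbol{\nu}_2$; then $(\boldsymbol{\gamma},\boldsymbol{v},\boldsymbol{w})$ is a framed curve with unit tangent vector $\boldsymbol{v}\times\boldsymbol{w}=\boldsymbol{\mu}$,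 and $\{\boldsymbol{v},\boldsymbol{w},\boldsymbol{\mu}\}$ is called a rotated frame. Its curvature is $(\overline{\ell},\overline{m},\overline{n},\alpha)$ with $\overline{\ell}=\dot{\boldsymbol{v}}\cdot\boldsymbol{w}=\ell-\dot\theta$, $\overline{m}=\dot{\boldsymbol{v}}\cdot\boldsymbol{\mu}=m\cos\theta-n\sin\theta$, $\overline{n}=\dot{\boldsymbol{w}}\cdot\boldsymbol{\mu}=m\sin\theta+n\cos\theta$. A singular point of a map $f$ from a surface to $\mathbb{R}^3$ is a point where $\operatorname{rank} df<2$. A singular point $p$ of $f$ is a cross cap if the map-germ of $f$ at $p$ is $\mathcal{A}$-equivalent (i.e. equal up to germs of diffeomorphisms of source and target) to the germ of $(u,v)\mapsto(u,uv,v^2)$ at $0$. *)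

(* Defs.v *)
From mathcomp Require Import all_boot all_order all_algebra.
From mathcomp Require Import all_classical all_reals all_analysis.

Set Implicit Arguments.
Unset Strict Implicit.
Unset Printing Implicit Defensive.

Import Order.TTheory GRing.Theory Num.Theory.
Import numFieldNormedType.Exports.

Local Open Scope classical_set_scope.
Local Open Scope ring_scope.

(** Euclidean 3-space is ['rV[R]_3] with the scalar product [dot]; the norm
    [`|x|] that MathComp puts on row vectors is the sup norm, so it is used for
    the topology only, never for Euclidean lengths. *)

Section Vectors.
Context {R : realType}.

Definition row2 (a b : R) : 'rV[R]_2 := \row_i [:: a; b]`_i.

Definition row3 (a b c : R) : 'rV[R]_3 := \row_i [:: a; b; c]`_i.

Definition dot (x y : 'rV[R]_3) : R := \sum_i x 0 i * y 0 i.

Definition cross (x y : 'rV[R]_3) : 'rV[R]_3 :=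
  row3 (x 0 1 * y 0 2 - x 0 2 * y 0 1)
       (x 0 2 * y 0 0 - x 0 0 * y 0 2)
       (x 0 0 * y 0 1 - x 0 1 * y 0 0).

Definition S2 : set 'rV[R]_3 := [set x | dot x x = 1].

Definition Delta : set ('rV[R]_3 * 'rV[R]_3) :=
  [set xy | [/\ S2 xy.1, S2 xy.2 & dot xy.1 xy.2 = 0]].

End Vectors.

Section Smooth.
Context {R : realType} {V W : normedModType R}.

(** To be used with [U] open, and [V], [W] finite-dimensional. *)
Fixpoint Ck (k : nat) (U : set V) (f : V -> W) : Prop :=
  match k with
  | 0 => forall x, U x -> {for x, continuous f}
  | k'.+1 => (forall x, U x -> differentiable f x) /\
             (forall h, Ck k' U (fun x => 'D_h f x))
  end.

Definition smooth (U : set V) (f : V -> W) : Prop := forall k, Ck k U f.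

End Smooth.

Section Germs.
Context {R : realType}.

(** The germ of [phi] at [p] is a diffeomorphism germ
    [(R^n, p) -> (R^n, phi p)]. *)
Definition diffeo_germ n (phi : 'rV[R]_n -> 'rV[R]_n) (p : 'rV[R]_n) : Prop :=
  exists (U U' : set 'rV[R]_n) (psi : 'rV[R]_n -> 'rV[R]_n),
    [/\ [/\ open U, open U' & U p],
        [/\ smooth U phi, smooth U' psi, phi @` U `<=` U' & psi @` U' `<=` U],
        forall x, U x -> psi (phi x) = x
      & forall y, U' y -> phi (psi y) = y].

(** A-equivalence of the germ of [f] at [p] with the germ of [g] at [q]. *)
Definition A_equivalent m n (f : 'rV[R]_m -> 'rV[R]_n) (p : 'rV[R]_m)
    (g : 'rV[R]_m -> 'rV[R]_n) (q : 'rV[R]_m) : Prop :=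
  exists (phi : 'rV[R]_m -> 'rV[R]_m) (Phi : 'rV[R]_n -> 'rV[R]_n),
    [/\ diffeo_germ phi p /\ phi p = q,
        diffeo_germ Phi (f p) /\ Phi (f p) = g q
      & \forall x \near p, Phi (f x) = g (phi x)].

Definition singular_point (f : 'rV[R]_2 -> 'rV[R]_3) (p : 'rV[R]_2) : Prop :=
  (\rank (jacobian f p) < 2)%N.

Definition whitney_umbrella (x : 'rV[R]_2) : 'rV[R]_3 :=
  row3 (x 0 0) (x 0 0 * x 0 1) (x 0 1 ^+ 2).

Definition cross_cap (f : 'rV[R]_2 -> 'rV[R]_3) (p : 'rV[R]_2) : Prop :=
  singular_point f p /\ A_equivalent f p whitney_umbrella 0.

End Germs.

(** A map on an interval [I] is represented by a total function on [R] of which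
    only the restriction to [I] matters; since [I] is open, its derivatives
    at points of [I] depend on that restriction only. *)

Section FramedCurves.
Context {R : realType}.

Definition open_interval (I : set R) : Prop := open I /\ is_interval I.

Definition framed_curve (I : set R) (gamma nu1 nu2 : R -> 'rV[R]_3) : Prop :=
  [/\ [/\ smooth I gamma, smooth I nu1 & smooth I nu2],
      forall t, I t -> Delta (nu1 t, nu2 t)
    & forall t, I t ->
        dot (derive1 gamma t) (nu1 t) = 0 /\ dot (derive1 gamma t) (nu2 t) = 0].

Definition unit_tangent (nu1 nu2 : R -> 'rV[R]_3) (t : R) : 'rV[R]_3 :=
  cross (nu1 t) (nu2 t).

(** The curvature [(l, m, n, alpha)] of the framed curve [(gamma, nu1, nu2)]. *)
Definition curv_l (nu1 nu2 : R -> 'rV[R]_3) (t : R) : R :=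
  dot (derive1 nu1 t) (nu2 t).

Definition curv_m (nu1 nu2 : R -> 'rV[R]_3) (t : R) : R :=
  dot (derive1 nu1 t) (unit_tangent nu1 nu2 t).

Definition curv_n (nu1 nu2 : R -> 'rV[R]_3) (t : R) : R :=
  dot (derive1 nu2 t) (unit_tangent nu1 nu2 t).

Definition curv_alpha (gamma nu1 nu2 : R -> 'rV[R]_3) (t : R) : R :=
  dot (derive1 gamma t) (unit_tangent nu1 nu2 t).

(** [unit_tangent] takes the same value on the rotated pair [(rot_v, rot_w)] as
    on [(nu1, nu2)]. *)
Definition rot_v (theta : R -> R) (nu1 nu2 : R -> 'rV[R]_3) (t : R) : 'rV[R]_3 :=
  cos (theta t) *: nu1 t - sin (theta t) *: nu2 t.

Definition rot_w (theta : R -> R) (nu1 nu2 : R -> 'rV[R]_3) (t : R) : 'rV[R]_3 :=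
  sin (theta t) *: nu1 t + cos (theta t) *: nu2 t.

(** [R x R] is ['rV[R]_2], the point [(t, lambda)] being [row2 t lambda]. *)
Definition NS (gamma v : R -> 'rV[R]_3) (x : 'rV[R]_2) : 'rV[R]_3 :=
  gamma (x 0 0) + x 0 1 *: v (x 0 0).

End FramedCurves.

(* Main.v *)
Require Import Defs.
From HB Require Import structures.
From mathcomp Require Import all_boot all_order all_algebra.
From mathcomp Require Import all_classical all_reals all_analysis.
From mathcomp Require Import ring lra.
Import Order.TTheory GRing.Theory Num.Theory.
Import numFieldNormedType.Exports.
Local Open Scope classical_set_scope.
Local Open Scope ring_scope.

Set Implicit Arguments.
Unset Strict Implicit.
Unset Printing Implicit Defensive.

(** Let F (t, lambda) = gamma (t) + lambda v (t) be the normal surface. Its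
    derivative F_lambda = v is a unit vector, and the derivative
      F_t = lambda l w + (alpha + lambda m) mu
    is orthogonal to it. The rank of dF therefore drops exactly where F_t = 0,
    which gives the equations of a singular point.

    At a point where F_t = 0, Whitney's criterion ([whitney_criterion]) holds:
    the germ is a cross cap if and only if the vectors F_lambda, F_{t lambda}
    and F_tt are linearly independent. For the normal surface the determinant
    is computed in the orthonormal frame (v, w, mu). There F_lambda = v,
    F_{t lambda} = v' has components (0, l, m), and the last two components of
    F_tt are lambda l' and alpha' + lambda m', the other terms cancelling
    because gamma' + lambda v' = 0. The determinant is thus
      l (alpha' + lambda m') - m lambda l' = l alpha' + alpha l',
    since lambda l = 0 and lambda m = - alpha.

    Necessity in Whitney's criterion. Because the first derivative along the
    kernel vanishes, the triple (F_lambda, F_{t lambda}, F_tt) is multiplied by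
    the differential of a diffeomorphism of the target, and by an invertible
    triangular matrix under a diffeomorphism of the source. Hence its
    independence is invariant, and it holds for (u, u v, v^2).

    Sufficiency. A linear change of the target makes the triple the standard
    basis. The first component of F is then a coordinate x of the source. The
    third one has a nondegenerate critical point in the remaining variable, so
    the Morse lemma with a parameter ([parametric_morse]) gives a second
    coordinate y for which it is h (x) + y^2. By Whitney's theorem
    ([whitney_decomposition]) the second component is A (x, y^2) + y B (x, y^2),
    with B_x nonzero by the condition on the 2-jet. In the source
    coordinates (B (x, y^2), y) and the target coordinates
      (B (X, Z - h (X)), Y - A (X, Z - h (X)), Z - h (X))
    the germ is the umbrella.

    Whitney's theorem says that a smooth f (x, y), even in y, is a smooth
    function of x and z = y^2. The function f (x, sqrt z) on z >= 0 is continued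
    to z < 0 by Seeley's series of reflections, whose weights annihilate the
    jumps of all derivatives. The z-derivative of f (x, sqrt z) is the same
    construction applied to f_y / (2 y), which is again smooth and even by
    Hadamard's lemma. So the continued functions form a family closed under
    partial derivatives; its members are locally bounded, and these two
    properties together force smoothness ([smooth_coinduction]). *)

(** * Functions of class C^k *)

Section CkClosure.
Context {R : realType}.
Implicit Types (V W : normedModType R).

Lemma Ck_continuous V W k (U : set V) (f : V -> W) :
  Ck k U f -> forall x, U x -> {for x, continuous f}.
Proof.
case: k => [//|k] [df _] x Ux; exact: differentiable_continuous (df x Ux).
Qed.

Lemma CkS V W k (U : set V) (f : V -> W) : Ck k.+1 U f -> Ck k U f.
Proof.
elim: k f => [|k IH] f Uf; first exact: Ck_continuous Uf.
by case: Uf => df Df; split=> // h; apply: IH; exact: Df.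
Qed.

Lemma Ck_sub V W k (U U' : set V) (f : V -> W) :
  U' `<=` U -> Ck k U f -> Ck k U' f.
Proof.
move=> UU'; elim: k f => [|k IH] f /=; first by move=> cf x /UU'/cf.
by move=> [df Df]; split=> [x /UU'/df//|h]; apply: IH.
Qed.

Lemma Ck_local V W k (U : set V) (f : V -> W) :
  (forall x, U x -> exists2 U', U' x & Ck k U' f) -> Ck k U f.
Proof.
elim: k f => [|k IH] f /=.
  by move=> H x /H[U' U'x]; apply.
move=> H; split=> [x /H[U' U'x []]|h]; first by move=> + _; apply.
by apply: IH => x /H[U' U'x [_ Df]]; exists U'.
Qed.

(** The remainders met below are bounded pointwise, by the mean value
    theorem, and differentiability is read off from such bounds. *)
Lemma diff_eps V W (f : V -> W) x (L : {linear V -> W}) :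
  continuous L ->
  (forall e, 0 < e -> \forall y \near x, `|f y - f x - L (y - x)| <= e * `|y - x|) ->
  differentiable f x /\ 'd f x = L :> (V -> W).
Proof.
move=> cL H.
have fd : f \o shift x = cst (f x) + L +o_ (0 : V) id.
  apply/eqaddoP => e e0; move: (H e e0).
  rewrite (near_shift 0) /=; apply: filterS => y /=.
  rewrite subr0 !fctE /= addrK.
  by rewrite opprD addrA.
have dL := diff_unique cL fd.
by split=> //; apply/diff_locallyP; rewrite dL.
Qed.

Lemma differentiable_near V W (f : V -> W) x : differentiable f x ->
  forall e, 0 < e ->
  \forall y \near x, `|f y - f x - 'd f x (y - x)| <= e * `|y - x|.
Proof.
move=> /diff_locallyP[cd fd] e e0; rewrite (near_shift 0) /=.
move/eqaddoP : fd => /(_ e e0); apply: filterS => y /=.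
by rewrite subr0 !fctE /= addrK opprD addrA.
Qed.

Lemma near_eq_differentiable V W (f g : V -> W) x :
  (\forall y \near x, f y = g y) -> differentiable f x -> differentiable g x.
Proof.
move=> fg df; have cd := diff_continuous df.
apply: (@diff_eps _ _ g x ('d f x) cd _).1.
move=> e e0; have fgx := nbhs_singleton fg.
have := differentiable_near df e0.
by apply: filterS2 fg => y <-; rewrite fgx.
Qed.

Lemma Ck_eq V W k (U : set V) (f g : V -> W) :
  open U -> (forall x, U x -> f x = g x) -> Ck k U f -> Ck k U g.
Proof.
move=> oU; have near_U f' g' x : (forall x, U x -> f' x = g' x :> W) -> U x ->
    \forall y \near x, f' y = g' y.
  by move=> fg Ux; apply: filterS (open_nbhs_nbhs (conj oU Ux)) => y /fg.
elim: k f g => [|k IH] f g fg /=.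
  move=> cf x Ux; rewrite /prop_for/continuous_at -(fg _ Ux).
  apply: cvg_trans (cf x Ux); apply: near_eq_cvg.
  by apply: filterS (near_U _ _ _ fg Ux) => y ->.
move=> [df Df]; split=> [x Ux|h].
  exact: near_eq_differentiable (near_U _ _ _ fg Ux) (df x Ux).
apply: IH (Df h) => x Ux.
by apply: near_eq_derive; exact: near_U.
Qed.

Lemma CkD V W k (U : set V) (f g : V -> W) : open U ->
  Ck k U f -> Ck k U g -> Ck k U (fun x => f x + g x).
Proof.
move=> oU; elim: k f g => [|k IH] f g /=.
  by move=> cf cg x Ux; apply: continuousD; [exact: cf|exact: cg].
move=> [df Df] [dg Dg]; split=> [x Ux|h].
  by apply: differentiableD; [exact: df|exact: dg].
apply: Ck_eq (IH _ _ (Df h) (Dg h)) => // x Ux.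
by rewrite -deriveD//; apply: diff_derivable; [exact: df|exact: dg].
Qed.

Lemma Ck_cst V W k (U : set V) (w : W) : open U -> Ck k U (fun=> w).
Proof.
move=> oU; elim: k w => [|k IH] w /=; first by move=> x _; exact: cvg_cst.
split=> [x _|h]; first exact: differentiable_cst.
by apply: Ck_eq (IH 0) => // x Ux; rewrite derive_cst.
Qed.

Lemma Ck_linear_comp V W W' k (U : set V) (f : V -> W) (L : {linear W -> W'}) :
  open U -> continuous L -> Ck k U f -> Ck k U (fun x => L (f x)).
Proof.
move=> oU cL; elim: k f => [|k IH] f /=.
  by move=> cf x Ux; apply: continuous_comp (cL _); exact: cf.
have dL x : differentiable L x by apply: linear_differentiable.
move=> [df Df]; split=> [x Ux|h].
  by apply: differentiable_comp => //; exact: df.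
apply: Ck_eq (IH _ (Df h)) => // x Ux.
rewrite [RHS]deriveE; last by apply: differentiable_comp => //; exact: df.
by rewrite (diff_comp (df _ Ux) (dL _))/= diff_lin// deriveE//; exact: df.
Qed.

Lemma Ck_linear V W k (U : set V) (L : {linear V -> W}) :
  open U -> continuous L -> Ck k U L.
Proof.
move=> oU cL; elim: k => [|k IH] /=; first by move=> x _; exact: cL.
split=> [x _|h]; first exact: linear_differentiable.
apply: Ck_eq (Ck_cst _ (L h) oU) => // x _.
by rewrite deriveE ?diff_lin//; exact: linear_differentiable.
Qed.

Lemma CkM V k (U : set V) (f g : V -> R) : open U ->
  Ck k U f -> Ck k U g -> Ck k U (fun x => f x * g x).
Proof.
move=> oU; elim: k f g => [|k IH] f g.
  by move=> cf cg x Ux; apply: continuousM; [exact: cf|exact: cg].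
move=> Cf Cg; have [df Df] := Cf; have [dg Dg] := Cg; split=> [x Ux|h].
  by apply: differentiableM; [exact: df|exact: dg].
apply: Ck_eq (CkD oU (IH _ _ (CkS Cf) (Dg h)) (IH _ _ (CkS Cg) (Df h))) => // x Ux.
by rewrite deriveM//; apply: diff_derivable; [exact: df|exact: dg].
Qed.

End CkClosure.

(** Coordinates and scalar multiples are bundled as linear maps, so that
    [Ck_linear_comp] applies to them. *)

Section LinearMaps.
Context {R : realType}.

Definition coordL n (i : 'I_n) (x : 'rV[R]_n) : R := x 0 i.

Lemma coordL_linear n (i : 'I_n) : linear (@coordL n i).
Proof. by move=> a x y; rewrite /coordL !mxE. Qed.

HB.instance Definition _ n i := GRing.isLinear.Build R 'rV[R]_n R *:%R
  (@coordL n i) (@coordL_linear n i).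

Definition scaleL (W : normedModType R) (w : W) (a : R) : W := a *: w.

Lemma scaleL_linear (W : normedModType R) (w : W) : linear (scaleL w).
Proof. by move=> a x y; rewrite /scaleL scalerDl scalerA. Qed.

HB.instance Definition _ (W : normedModType R) (w : W) :=
  GRing.isLinear.Build R R W *:%R (scaleL w) (@scaleL_linear W w).

End LinearMaps.

Section CkComp.
Context {R : realType}.
Implicit Types (V W : normedModType R).

Lemma Ck_coord V k n (U : set V) (f : V -> 'rV[R]_n) i :
  open U -> Ck k U f -> Ck k U (fun x => f x 0 i).
Proof.
by move=> oU; apply: (@Ck_linear_comp _ _ _ _ k U f (coordL i)) => // x; exact: coord_continuous.
Qed.

Lemma Ck_scalel V W k (U : set V) (f : V -> R) (w : W) :
  open U -> Ck k U f -> Ck k U (fun x => f x *: w).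
Proof.
by move=> oU; apply: (@Ck_linear_comp _ _ _ _ k U f (scaleL w)) => //; exact: scalel_continuous.
Qed.

Lemma Ck_sum V W k (I : eqType) (r : seq I) (U : set V) (f : I -> V -> W) : open U ->
  (forall i, i \in r -> Ck k U (f i)) -> Ck k U (fun x => \sum_(i <- r) f i x).
Proof.
move=> oU; elim: r => [|i r IH] Cf.
  by apply: Ck_eq (Ck_cst k (0 : W) oU) => // x _; rewrite big_nil.
apply: Ck_eq (CkD oU (Cf i _) (IH _)) => [//|x _||j jr].
- by rewrite big_cons.
- by rewrite mem_head.
- by apply: Cf; rewrite in_cons jr orbT.
Qed.

Lemma Ck_rV V k n (U : set V) (f : V -> 'rV[R]_n) :
  open U -> (forall i, Ck k U (fun x => f x 0 i)) -> Ck k U f.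
Proof.
move=> oU Cf.
apply: Ck_eq (Ck_sum oU (fun i _ => Ck_scalel (delta_mx 0 i) oU (Cf i))) => // x _.
by rewrite [RHS]row_sum_delta.
Qed.

Lemma Ck_comp V k n (U : set V) (U' : set 'rV[R]_n) (f : V -> 'rV[R]_n) (g : 'rV[R]_n -> R) :
  open U -> open U' -> (forall x, U x -> U' (f x)) ->
  Ck k U f -> Ck k U' g -> Ck k U (fun x => g (f x)).
Proof.
move=> oU oU' fU; elim: k f g fU => [|k IH] f g fU.
  by move=> cf cg x Ux; apply: continuous_comp; [exact: cf|apply: cg; exact: fU].
move=> Cf Cg; have [df Df] := Cf; have [dg Dg] := Cg; split=> [x Ux|h].
  by apply: differentiable_comp; [exact: df|apply: dg; exact: fU].
have CD (i : 'I_n) : Ck k U (fun x => 'D_h f x 0 i * 'D_(delta_mx 0 i) g (f x)).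
  apply: CkM => //; first exact: (Ck_coord i oU (Df h)).
  exact: (IH f ('D_(delta_mx 0 i) g) fU (CkS Cf) (Dg _)).
apply: Ck_eq (Ck_sum oU (fun i _ => CD i)) => // x Ux.
rewrite [RHS]deriveE; last by apply: differentiable_comp; [exact: df|apply: dg; exact: fU].
rewrite (diff_comp (df _ Ux) (dg _ (fU _ Ux)))/=.
rewrite -(deriveE _ (df _ Ux)).
rewrite [in RHS](row_sum_delta ('D_h f x)) linear_sum; apply: eq_bigr => i _.
by rewrite linearZ /= -(deriveE _ (dg _ (fU _ Ux))).
Qed.

Lemma Ck_comp1 V k (U : set V) (U' : set R) (f : V -> R) (g : R -> R) :
  open U -> open U' -> (forall x, U x -> U' (f x)) ->
  Ck k U f -> Ck k U' g -> Ck k U (fun x => g (f x)).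
Proof.
move=> oU oU' fU; elim: k f g fU => [|k IH] f g fU.
  by move=> cf cg x Ux; apply: continuous_comp; [exact: cf|apply: cg; exact: fU].
move=> Cf Cg; have [df Df] := Cf; have [dg Dg] := Cg; split=> [x Ux|h].
  by apply: differentiable_comp; [exact: df|apply: dg; exact: fU].
have CD : Ck k U (fun x => 'D_h f x * 'D_1 g (f x)).
  apply: CkM => //; first exact: Df.
  exact: (IH f ('D_1 g) fU (CkS Cf) (Dg _)).
apply: Ck_eq CD => // x Ux.
rewrite [RHS]deriveE; last by apply: differentiable_comp; [exact: df|apply: dg; exact: fU].
rewrite (diff_comp (df _ Ux) (dg _ (fU _ Ux)))/=.
rewrite -(deriveE _ (df _ Ux)).
rewrite -[X in 'd _ _ X]mulr1 -[X in 'd _ _ X]/('D_h f x *: 1) linearZ /= -(deriveE _ (dg _ (fU _ Ux))).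
by [].
Qed.

(** In one variable all directional derivatives are multiples of the
    derivative, so that smoothness reduces to an equation for that function. *)
Lemma Ck_derive1 k (U : set R) (f f' : R -> R) : open U ->
  (forall x, U x -> is_derive x 1 f (f' x)) -> Ck k U f' -> Ck k.+1 U f.
Proof.
move=> oU df Cf'.
have dff x : U x -> differentiable f x.
  by move=> /df d; apply/derivable1_diffP.
split=> [//|h].
apply: Ck_eq (Ck_linear_comp (L := scaleL h) oU (@scalel_continuous _ _ _) Cf') => // x Ux.
rewrite deriveE ?diff1E ?derive1E//; try exact: dff.
have fx := df x Ux.
by rewrite derive_val /scaleL [LHS]mulrC.
Qed.

Lemma smooth_inv : smooth [set x : R | x != 0] GRing.inv.
Proof.
have o0 : open [set x : R | x != 0] by exact: open_neq.
elim=> [|k IH]; first by move=> x x0; exact: inv_continuous.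
apply: (@Ck_derive1 k _ _ (fun x => (-1) * (x^-1 * x^-1))) => // [x /= x0|].
  apply: DeriveDef; first by apply: derivableV => //.
  by rewrite deriveV// derive_id /= mulN1r -invfM expr2 [LHS]mulr1.
by apply: CkM => //; [exact: Ck_cst|exact: CkM].
Qed.

Lemma smooth_sqrt : smooth [set x : R | 0 < x] (@Num.sqrt R).
Proof.
have o0 : open [set x : R | 0 < x] by exact: open_gt.
elim=> [|k IH]; first by move=> x x0; exact: sqrt_continuous.
apply: (@Ck_derive1 k _ _ (fun x => (2 * Num.sqrt x)^-1)) => //.
have o1 : open [set x : R | x != 0] by exact: open_neq.
apply: (Ck_comp1 (f := fun x => 2 * Num.sqrt x) o0 o1 _ _ (@smooth_inv k)).
- by move=> x /= x0; rewrite mulf_neq0// gt_eqF// sqrtr_gt0.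
- by apply: CkM => //; exact: Ck_cst.
Qed.

Lemma smooth_sin_cos : smooth setT (@sin R) /\ smooth setT (@cos R).
Proof.
suff H k : Ck k setT (@sin R) /\ Ck k setT (@cos R).
  by split=> k; case: (H k).
elim: k => [|k [IHs IHc]].
  by split=> x _; [exact: continuous_sin|exact: continuous_cos].
split; first by apply: (Ck_derive1 openT) IHc => x _; exact: is_derive_sin.
apply: (@Ck_derive1 _ _ _ (fun x => (-1) * sin x) openT) => [x _|].
  by rewrite mulN1r; exact: is_derive_cos.
by apply: CkM => //; [exact: openT|apply: Ck_cst; exact: openT].
Qed.

End CkComp.

(** * Smoothness at a point *)

Section SmoothAt.
Context {R : realType}.
Implicit Types (V W : normedModType R).

Definition smooth_at V W (x : V) (f : V -> W) : Prop :=
  exists U, [/\ open U, U x & smooth U f].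

Lemma smooth_smooth_at V W (U : set V) (f : V -> W) x :
  open U -> U x -> smooth U f -> smooth_at x f.
Proof. by move=> oU Ux sf; exists U. Qed.

Lemma smooth_at_smooth V W (U : set V) (f : V -> W) :
  (forall x, U x -> smooth_at x f) -> smooth U f.
Proof.
move=> sf k; apply: Ck_local => x /sf[U' [_ U'x sU']].
by exists U' => //; exact: sU'.
Qed.

Lemma smooth_at_near V W (x : V) (f : V -> W) :
  smooth_at x f -> \forall y \near x, smooth_at y f.
Proof.
move=> [U [oU Ux sf]].
by apply: filterS (open_nbhs_nbhs (conj oU Ux)) => y Uy; exists U.
Qed.

Lemma smooth_at_differentiable V W (x : V) (f : V -> W) :
  smooth_at x f -> differentiable f x.
Proof. by move=> [U [_ Ux sf]]; have [df _] := sf 1; exact: df. Qed.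

Lemma smooth_at_continuous V W (x : V) (f : V -> W) :
  smooth_at x f -> {for x, continuous f}.
Proof. by move=> /smooth_at_differentiable/differentiable_continuous. Qed.

Lemma smooth_at_derivable V W (x : V) (f : V -> W) h :
  smooth_at x f -> derivable f x h.
Proof. by move=> /smooth_at_differentiable/diff_derivable. Qed.

Lemma smooth_at_derive V W (x : V) (f : V -> W) h :
  smooth_at x f -> smooth_at x ('D_h f).
Proof.
by move=> [U [oU Ux sf]]; exists U; split=> // k; have [_ Df] := sf k.+1; exact: Df.
Qed.

Lemma smooth_at_eq V W (x : V) (f g : V -> W) :
  (\forall y \near x, f y = g y) -> smooth_at x f -> smooth_at x g.
Proof.
move=> fg0; have : nbhs x (fun y => f y = g y) by exact: fg0.
rewrite nbhsE => -[B [oB Bx] fg] [U [oU Ux sf]].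
exists (U `&` B); split=> [|//|k]; first exact: openI.
apply: (@Ck_eq _ _ _ k _ f) => [|y [_ /fg]//|]; first exact: openI.
by apply: Ck_sub (sf k) => y [].
Qed.

Lemma smooth_at_cst V W (x : V) (w : W) : smooth_at x (fun=> w).
Proof.
by exists setT; split=> [||k]; [exact: openT|by []|apply: Ck_cst; exact: openT].
Qed.

Lemma smooth_at_linear V W (x : V) (L : {linear V -> W}) :
  continuous L -> smooth_at x L.
Proof.
by move=> cL; exists setT; split=> [||k]; [exact: openT| |apply: Ck_linear => //; exact: openT].
Qed.

Lemma smooth_at_id V (x : V) : smooth_at x (fun y => y).
Proof. by apply: (@smooth_at_linear _ _ x idfun) => y. Qed.

Lemma smooth_at_coord n (x : 'rV[R]_n) i : smooth_at x (fun y => y 0 i).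
Proof. by apply: (@smooth_at_linear _ _ x (coordL i)) => y; exact: coord_continuous. Qed.

Lemma smooth_at_coordf V n (x : V) (f : V -> 'rV[R]_n) i :
  smooth_at x f -> smooth_at x (fun y => f y 0 i).
Proof. by move=> [U [oU Ux sf]]; exists U; split=> // k; exact: Ck_coord. Qed.

Let smooth_at2 V (W W' W'' : normedModType R) (x : V) (op : (V -> W) -> (V -> W') -> (V -> W'')) f g :
  (forall k (U : set V), open U -> Ck k U f -> Ck k U g -> Ck k U (op f g)) ->
  smooth_at x f -> smooth_at x g -> smooth_at x (op f g).
Proof.
move=> H [U [oU Ux sf]] [U' [oU' U'x sg]]; exists (U `&` U').
split=> [|//|k]; first exact: openI.
by apply: H; [exact: openI|apply: Ck_sub (sf k) => y []|apply: Ck_sub (sg k) => y []].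
Qed.

Lemma smooth_atD V W (x : V) (f g : V -> W) :
  smooth_at x f -> smooth_at x g -> smooth_at x (fun y => f y + g y).
Proof. by apply: (smooth_at2 (op := fun f g y => f y + g y)) => k U; exact: CkD. Qed.

Lemma smooth_atM V (x : V) (f g : V -> R) :
  smooth_at x f -> smooth_at x g -> smooth_at x (fun y => f y * g y).
Proof.
by apply: (@smooth_at2 V R R R x (fun f g y => f y * g y)) => k U oU; exact: CkM.
Qed.

Lemma smooth_at_rV V n (x : V) (f : V -> 'rV[R]_n) :
  (forall i, smooth_at x (fun y => f y 0 i)) -> smooth_at x f.
Proof.
move=> sf; pose g y := \sum_(i <- enum 'I_n) f y 0 i *: delta_mx 0 i : 'rV[R]_n.
suff : smooth_at x g.
  apply: smooth_at_eq; apply: nearW => y.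
  by rewrite [RHS]row_sum_delta /g big_enum.
rewrite /g; elim: (enum _) => [|i r IH].
  by apply: smooth_at_eq (smooth_at_cst x 0); apply: nearW => y; rewrite big_nil.
have [U [oU Ux sfi]] := sf i.
have sfi' : smooth_at x (fun y => f y 0 i *: (delta_mx 0 i : 'rV[R]_n)).
  by exists U; split=> // k; exact: Ck_scalel.
apply: smooth_at_eq (smooth_atD sfi' IH); apply: nearW => y.
by rewrite big_cons.
Qed.

Lemma smooth_atN V (x : V) (f : V -> R) :
  smooth_at x f -> smooth_at x (fun y => - f y).
Proof.
move=> sf; apply: smooth_at_eq (smooth_atM (smooth_at_cst x (-1 : R)) sf).
by apply: nearW => y; rewrite mulN1r.
Qed.

Lemma smooth_atB V (x : V) (f g : V -> R) :
  smooth_at x f -> smooth_at x g -> smooth_at x (fun y => f y - g y).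
Proof. by move=> sf sg; apply: smooth_atD => //; exact: smooth_atN. Qed.

Lemma smooth_atX V (x : V) (f : V -> R) n :
  smooth_at x f -> smooth_at x (fun y => f y ^+ n).
Proof.
move=> sf; elim: n => [|n IH]; first exact: smooth_at_cst.
apply: smooth_at_eq (smooth_atM sf IH).
by apply: nearW => y; rewrite exprS.
Qed.

Lemma open_preimageI V W (U : set V) (U' : set W) (f : V -> W) : open U -> open U' ->
  (forall x, U x -> {for x, continuous f}) -> open (U `&` f @^-1` U').
Proof.
move=> oU oU' cf; rewrite openE => x [Ux U'fx] /=; apply: filterI.
  exact: open_nbhs_nbhs.
by apply: (cf x Ux); exact: open_nbhs_nbhs.
Qed.

Lemma smooth_at_comp V n (x : V) (f : V -> 'rV[R]_n) (g : 'rV[R]_n -> R) :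
  smooth_at x f -> smooth_at (f x) g -> smooth_at x (fun y => g (f y)).
Proof.
move=> [U [oU Ux sf]] [U' [oU' U'x sg]]; exists (U `&` f @^-1` U').
have o := open_preimageI oU oU' (sf 0).
split=> // k; apply: (Ck_comp o oU') => [y []//||]; last exact: sg.
by apply: Ck_sub (sf k) => y [].
Qed.

Lemma smooth_at_comp1 V (x : V) (f : V -> R) (g : R -> R) :
  smooth_at x f -> smooth_at (f x) g -> smooth_at x (fun y => g (f y)).
Proof.
move=> [U [oU Ux sf]] [U' [oU' U'x sg]]; exists (U `&` f @^-1` U').
have o := open_preimageI oU oU' (sf 0).
split=> // k; apply: (Ck_comp1 o oU') => [y []//||]; last exact: sg.
by apply: Ck_sub (sf k) => y [].
Qed.

Lemma smooth_at_comprV V n m (x : V) (f : V -> 'rV[R]_n) (g : 'rV[R]_n -> 'rV[R]_m) :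
  smooth_at x f -> smooth_at (f x) g -> smooth_at x (fun y => g (f y)).
Proof.
move=> sf sg; apply: smooth_at_rV => i.
by apply: (smooth_at_comp (g := fun z => g z 0 i)) => //; exact: smooth_at_coordf.
Qed.

Lemma smooth_at_comp1rV V m (x : V) (f : V -> R) (g : R -> 'rV[R]_m) :
  smooth_at x f -> smooth_at (f x) g -> smooth_at x (fun y => g (f y)).
Proof.
move=> sf sg; apply: smooth_at_rV => i.
by apply: (smooth_at_comp1 (g := fun z => g z 0 i)) => //; exact: smooth_at_coordf.
Qed.

Lemma smooth_atV V (x : V) (f : V -> R) : f x != 0 ->
  smooth_at x f -> smooth_at x (fun y => (f y)^-1).
Proof.
move=> fx0 sf; apply: (smooth_at_comp1 sf).
by apply: (smooth_smooth_at _ _ smooth_inv) => //; exact: open_neq.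
Qed.

Lemma smooth_at_sqrt V (x : V) (f : V -> R) : 0 < f x ->
  smooth_at x f -> smooth_at x (fun y => Num.sqrt (f y)).
Proof.
move=> fx0 sf; apply: (smooth_at_comp1 sf).
by apply: (smooth_smooth_at _ _ smooth_sqrt) => //; exact: open_gt.
Qed.

Lemma smooth_at_row2 V (x : V) (f g : V -> R) :
  smooth_at x f -> smooth_at x g -> smooth_at x (fun y => row2 (f y) (g y)).
Proof.
move=> sf sg; apply: smooth_at_rV => i.
case: (unliftP 0 i) => [j ->|->].
  by apply: smooth_at_eq sg; apply: nearW => y; rewrite !mxE ord1.
by apply: smooth_at_eq sf; apply: nearW => y; rewrite !mxE.
Qed.

Lemma smooth_at_row3 V (x : V) (f g h : V -> R) :
  smooth_at x f -> smooth_at x g -> smooth_at x h ->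
  smooth_at x (fun y => row3 (f y) (g y) (h y)).
Proof.
move=> sf sg sh; apply: smooth_at_rV => -[[|[|[|//]]] Hi].
- by apply: smooth_at_eq sf; apply: nearW => y; rewrite !mxE.
- by apply: smooth_at_eq sg; apply: nearW => y; rewrite !mxE.
- by apply: smooth_at_eq sh; apply: nearW => y; rewrite !mxE.
Qed.

End SmoothAt.

(** * Partial derivatives on the plane *)

Section PartialDerivatives.
Context {R : realType}.
Implicit Types (V W : normedModType R).

Lemma is_derive_line V W (f : V -> W) (a v : V) (d : W) (g : R -> W) t :
  (forall s, g (s + t) = f (s *: v + a)) ->
  is_derive a v f d -> is_derive t 1 g d.
Proof.
move=> gf [df <-].
have E : (fun h : R => h^-1 *: ((g \o shift t) (h *: 1) - g t)) =
         (fun h : R => h^-1 *: ((f \o shift a) (h *: v) - f a)).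
  apply/funext => h /=; rewrite -[h *: 1]/(h * 1) mulr1 gf.
  by have := gf 0; rewrite add0r scale0r add0r => ->.
by split; rewrite /derivable /derive E.
Qed.

Lemma line_is_derive V W (f : V -> W) (a v : V) (d : W) (g : R -> W) t :
  (forall s, g (s + t) = f (s *: v + a)) ->
  is_derive t 1 g d -> is_derive a v f d.
Proof.
move=> gf [df <-].
have E : (fun h : R => h^-1 *: ((g \o shift t) (h *: 1) - g t)) =
         (fun h : R => h^-1 *: ((f \o shift a) (h *: v) - f a)).
  apply/funext => h /=; rewrite -[h *: 1]/(h * 1) mulr1 gf.
  by have := gf 0; rewrite add0r scale0r add0r => ->.
by split; rewrite /derivable /derive -E.
Qed.

Definition e_ n (i : 'I_n) : 'rV[R]_n := delta_mx 0 i.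

Lemma row2K (x : 'rV[R]_2) : row2 (x 0 0) (x 0 1) = x.
Proof.
apply/rowP => i; rewrite mxE; case: (unliftP 0 i) => [j ->|->] //=.
by rewrite ord1 /=; congr (x _ _); apply/val_inj.
Qed.

Lemma row2_0 (a b : R) : row2 a b 0 0 = a. Proof. by rewrite mxE. Qed.
Lemma row2_1 (a b : R) : row2 a b 0 1 = b. Proof. by rewrite mxE. Qed.

Lemma row3_0 (a b c : R) : row3 a b c 0 0 = a. Proof. by rewrite mxE. Qed.
Lemma row3_1 (a b c : R) : row3 a b c 0 1 = b. Proof. by rewrite mxE. Qed.
Lemma row3_2 (a b c : R) : row3 a b c 0 2 = c. Proof. by rewrite mxE. Qed.

Lemma eq_row2 (x y : 'rV[R]_2) : x 0 0 = y 0 0 -> x 0 1 = y 0 1 -> x = y.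
Proof. by move=> h0 h1; rewrite -(row2K x) -(row2K y) h0 h1. Qed.

Lemma e0E a b (s : R) : s *: e_ 0 + row2 a b = row2 (s + a) b.
Proof. by apply: eq_row2; rewrite !mxE /= ?mulr1 ?mulr0 ?add0r. Qed.

Lemma e1E a b (s : R) : s *: e_ 1 + row2 a b = row2 a (s + b).
Proof. by apply: eq_row2; rewrite !mxE /= ?mulr1 ?mulr0 ?add0r. Qed.

Lemma is_derive_row0 W (f : 'rV[R]_2 -> W) a b d :
  is_derive (row2 a b) (e_ 0) f d <-> is_derive a 1 (fun t => f (row2 t b)) d.
Proof.
by split; [apply: is_derive_line|apply: line_is_derive] => s; rewrite e0E.
Qed.

Lemma is_derive_row1 W (f : 'rV[R]_2 -> W) a b d :
  is_derive (row2 a b) (e_ 1) f d <-> is_derive b 1 (fun t => f (row2 a t)) d.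
Proof.
by split; [apply: is_derive_line|apply: line_is_derive] => s; rewrite e1E.
Qed.

Lemma norm_row2 (x : 'rV[R]_2) : `|x| = Num.max `|x 0 0| `|x 0 1|.
Proof.
rewrite [LHS]mx_normrE; apply/eqP; rewrite eq_le; apply/andP; split.
  apply: bigmax_le => [|[i j] _]; first by rewrite le_max normr_ge0.
  rewrite ord1 /= le_max; case: (unliftP 0 j) => [k ->|->]; last by rewrite lexx.
  by rewrite ord1; apply/orP; right; rewrite le_eqVlt; apply/orP; left; apply/eqP; congr `|x _ _|; exact/val_inj.
rewrite ge_max; apply/andP; split.
  exact: (le_bigmax _ (fun i : 'I_1 * 'I_2 => `|x i.1 i.2|) (0, 0)).
exact: (le_bigmax _ (fun i : 'I_1 * 'I_2 => `|x i.1 i.2|) (0, 1)).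
Qed.

End PartialDerivatives.

(** * Families closed under partial derivatives *)

Section PartialsToSmooth.
Context {R : realType}.

Lemma mean_value_within (g g' : R -> R) (a b : R) :
  {within `[Num.min a b, Num.max a b], continuous g} ->
  (forall t, Num.min a b < t < Num.max a b -> is_derive t 1 g (g' t)) ->
  exists2 t, Num.min a b <= t <= Num.max a b & g b - g a = g' t * (b - a).
Proof.
have [ab|/ltW ba] := leP a b => cg dg.
  have dg' t : t \in `]a, b[ -> is_derive t 1 g (g' t) by rewrite in_itv => /dg.
  have [t tab ->] := MVT_segment ab dg' cg.
  by exists t => //; move: tab; rewrite in_itv.
have dg' t : t \in `]b, a[ -> is_derive t 1 g (g' t) by rewrite in_itv => /dg.
have [t tab E] := MVT_segment ba dg' cg.
exists t; first by move: tab; rewrite in_itv.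
by rewrite -[LHS]opprB E -mulrN opprB.
Qed.

Lemma mean_value (g g' : R -> R) (a b : R) :
  (forall t, Num.min a b <= t <= Num.max a b -> is_derive t 1 g (g' t)) ->
  exists2 t, Num.min a b <= t <= Num.max a b & g b - g a = g' t * (b - a).
Proof.
move=> dg; apply: mean_value_within => [|t /andP[at_ tb]]; last by apply: dg; rewrite !ltW.
by apply: derivable_within_continuous => t; rewrite in_itv /= => /dg[].
Qed.

Definition gradL (u v : R) (h : 'rV[R]_2) : R := h 0 0 * u + h 0 1 * v.

Lemma gradL_linear u v : linear (gradL u v).
Proof. by move=> a x y; rewrite /gradL !mxE /GRing.scale /=; ring. Qed.

HB.instance Definition _ u v := GRing.isLinear.Build R 'rV[R]_2 R *:%R
  (gradL u v) (@gradL_linear u v).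

Lemma gradL_continuous u v : continuous (gradL u v).
Proof.
have c (x : 'rV[R]_2) i w : smooth_at x (fun h : 'rV[R]_2 => h 0 i * w).
  by apply: smooth_atM; [exact: smooth_at_coord|exact: smooth_at_cst].
by move=> x; exact: smooth_at_continuous (smooth_atD (c x 0 u) (c x 1 v)).
Qed.

Lemma le_norm_row2 (x : 'rV[R]_2) (e : R) :
  (`|x| <= e) = (`|x 0 0| <= e) && (`|x 0 1| <= e).
Proof. by rewrite norm_row2 ge_max. Qed.

Lemma between_norm (a b t : R) :
  Num.min a b <= t <= Num.max a b -> `|t - a| <= `|b - a|.
Proof.
have [ab|/ltW ba] := leP a b; first by move=> /andP[? ?]; rewrite !ger0_norm ?subr_ge0//; lra.
by move=> /andP[? ?]; rewrite !ler0_norm ?subr_le0//; lra.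
Qed.

(** The segment from x to y is replaced by a horizontal and a vertical one,
    since only the two partial derivatives are at hand. *)
Lemma mean_value2 (f f0 f1 : 'rV[R]_2 -> R) (x : 'rV[R]_2) (r : R) :
  (forall y, `|y - x| <= r -> is_derive y (e_ 0) f (f0 y) /\ is_derive y (e_ 1) f (f1 y)) ->
  forall y, `|y - x| <= r -> exists z0 z1,
    [/\ `|z0 - x| <= `|y - x|, `|z1 - x| <= `|y - x| &
      f y - f x = f0 z0 * (y 0 0 - x 0 0) + f1 z1 * (y 0 1 - x 0 1)].
Proof.
move=> df y yr.
have inb a b : Num.min (x 0 0) (y 0 0) <= a <= Num.max (x 0 0) (y 0 0) ->
    Num.min (x 0 1) (y 0 1) <= b <= Num.max (x 0 1) (y 0 1) ->
    `|row2 a b - x| <= `|y - x|.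
  move=> /between_norm ha /between_norm hb.
  by rewrite [leRHS]norm_row2 le_norm_row2 !mxE /= !le_max ha hb orbT.
have mm (a b : R) : Num.min a b <= a <= Num.max a b.
  by rewrite ge_min le_max lexx.
have mM (a b : R) : Num.min a b <= b <= Num.max a b.
  by rewrite ge_min le_max lexx !orbT.
have [s sab E0] := @mean_value (fun t => f (row2 t (x 0 1))) (fun t => f0 (row2 t (x 0 1))) (x 0 0) (y 0 0)
  (fun t tab => (is_derive_row0 _ _ _ _).1 (df _ (le_trans (inb _ _ tab (mm _ _)) yr)).1).
have [t tab E1] := @mean_value (fun t => f (row2 (y 0 0) t)) (fun t => f1 (row2 (y 0 0) t)) (x 0 1) (y 0 1)
  (fun t tab => (is_derive_row1 _ _ _ _).1 (df _ (le_trans (inb _ _ (mM _ _) tab) yr)).2).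
exists (row2 s (x 0 1)), (row2 (y 0 0) t); split; [exact: inb|exact: inb|].
rewrite -E0 -E1 !row2K; ring.
Qed.

Lemma near_closed_ball (V : normedModType R) (x : V) (P : V -> Prop) :
  (\forall y \near x, P y) -> exists2 r, 0 < r & forall y, `|y - x| <= r -> P y.
Proof.
move=> /nbhs_ballP[r r0 rP]; exists (r / 2); first exact: divr_gt0.
move=> y yr; apply: rP; rewrite -ball_normE /ball_/= distrC.
by rewrite (le_lt_trans yr)// gtr_pMr// invf_lt1// ltr1n.
Qed.

Lemma near_norm (V : normedModType R) (x : V) (r : R) : 0 < r ->
  \forall y \near x, `|y - x| <= r.
Proof.
move=> r0; apply/nbhs_ballP; exists r => // y.
by rewrite -ball_normE /ball_/= distrC => /ltW.
Qed.

Lemma continuous_at_near (V W : normedModType R) (f : V -> W) x e :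
  {for x, continuous f} -> 0 < e -> \forall y \near x, `|f x - f y| <= e.
Proof. by move=> cf e0; exact: (cvgrPdist_le _ _).1 cf _ e0. Qed.

Lemma lipschitz_continuous_at (V W : normedModType R) (f : V -> W) x (M r : R) : 0 < r ->
  (forall y, `|y - x| <= r -> `|f y - f x| <= M * `|y - x|) -> {for x, continuous f}.
Proof.
move=> r0 H; apply/cvgrPdist_le => e e0.
have d0 : 0 < e / (`|M| + 1) by rewrite divr_gt0// ltr_wpDl.
apply: filterS2 (near_norm x r0) (near_norm x d0) => y yr.
rewrite ler_pdivlMr ?ltr_wpDl// => ye.
rewrite distrC (le_trans (H _ yr))// (le_trans _ ye)// mulrC.
by rewrite ler_wpM2l// (le_trans (ler_norm _))// lerDl.
Qed.

(** Bounded partial derivatives make the function Lipschitz at the point. *)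
Lemma bounded_partials_continuous (f f0 f1 : 'rV[R]_2 -> R) (x : 'rV[R]_2) (M : R) :
  (\forall y \near x, is_derive y (e_ 0) f (f0 y) /\ is_derive y (e_ 1) f (f1 y)) ->
  (\forall y \near x, `|f0 y| <= M /\ `|f1 y| <= M) ->
  {for x, continuous f}.
Proof.
move=> df fM; have [r r0 rP] := near_closed_ball (filterI df fM).
have H y : `|y - x| <= r -> `|f y - f x| <= (M * 2) * `|y - x|.
  move=> yr; have [|z0 [z1 [z0r z1r ->]]] := @mean_value2 f f0 f1 x r _ y yr.
    by move=> z /rP[].
  have [_ [M0 _]] := rP _ (le_trans z0r yr).
  have [_ [_ M1]] := rP _ (le_trans z1r yr).
  rewrite (le_trans (ler_normD _ _))// !normrM mulrAC mulrDr mulr1 lerD//.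
    by rewrite ler_pM// norm_row2 !mxE le_max lexx.
  by rewrite ler_pM// norm_row2 !mxE le_max lexx orbT.
exact: lipschitz_continuous_at r0 H.
Qed.

Lemma continuous_partials_diff (f f0 f1 : 'rV[R]_2 -> R) (x : 'rV[R]_2) :
  (\forall y \near x, is_derive y (e_ 0) f (f0 y) /\ is_derive y (e_ 1) f (f1 y)) ->
  {for x, continuous f0} -> {for x, continuous f1} ->
  differentiable f x /\ 'd f x = gradL (f0 x) (f1 x) :> (_ -> _).
Proof.
move=> df c0 c1; apply: diff_eps; first exact: gradL_continuous.
move=> e e0; have e20 : 0 < e / 2 by rewrite divr_gt0.
have n0 := continuous_at_near c0 e20.
have n1 := continuous_at_near c1 e20.
have [r r0 rP] := near_closed_ball (filterI df (filterI n0 n1)).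
apply: filterS (near_norm x r0) => y yr.
have [|z0 [z1 [z0r z1r ->]]] := @mean_value2 f f0 f1 x r _ y yr.
  by move=> z /rP[].
have [_ [M0 _]] := rP _ (le_trans z0r yr).
have [_ [_ M1]] := rP _ (le_trans z1r yr).
have -> : f0 z0 * (y 0 0 - x 0 0) + f1 z1 * (y 0 1 - x 0 1) - gradL (f0 x) (f1 x) (y - x) = - ((f0 x - f0 z0) * (y 0 0 - x 0 0)) - (f1 x - f1 z1) * (y 0 1 - x 0 1).
  by rewrite /gradL !mxE; ring.
rewrite (le_trans (ler_normB _ _))// normrN !normrM [e in leRHS]splitr mulrDl lerD//.
  by rewrite ler_pM// norm_row2 !mxE le_max lexx.
by rewrite ler_pM// norm_row2 !mxE le_max lexx orbT.
Qed.

(** Local boundedness propagates to smoothness: bounded partial derivatives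
    give continuity of every member of the family, continuous ones give
    differentiability, and the derivatives are again members. Integrals and
    series depending on parameters are treated in this way, the derivative of
    each being one of the same shape. *)
Lemma smooth_coinduction (P : ('rV[R]_2 -> R) -> Prop) (U : set 'rV[R]_2) :
  open U ->
  (forall f, P f -> exists f0 f1, [/\ P f0, P f1 & forall x, U x ->
     is_derive x (e_ 0) f (f0 x) /\ is_derive x (e_ 1) f (f1 x)]) ->
  (forall f, P f -> forall x, U x -> exists M, \forall y \near x, `|f y| <= M) ->
  forall f, P f -> smooth U f.
Proof.
move=> oU Pd Pb.
have nU x : U x -> \forall y \near x, U y by move=> Ux; apply: open_nbhs_nbhs.
have Pc f : P f -> forall x, U x -> {for x, continuous f}.
  move=> Pf x Ux; have [f0 [f1 [Pf0 Pf1 df]]] := Pd f Pf.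
  have [M0 n0] := Pb f0 Pf0 x Ux; have [M1 n1] := Pb f1 Pf1 x Ux.
  apply: (@bounded_partials_continuous f f0 f1 x (Num.max M0 M1)).
    by apply: filterS (nU x Ux) => y /df.
  by apply: filterS2 n0 n1 => y y0 y1; rewrite !le_max y0 y1 orbT.
move=> f Pf k; elim: k f Pf => [|k IH] f Pf; first exact: Pc.
have [f0 [f1 [Pf0 Pf1 df]]] := Pd f Pf.
have D x : U x -> differentiable f x /\ 'd f x = gradL (f0 x) (f1 x) :> (_ -> _).
  move=> Ux; apply: continuous_partials_diff; [|exact: Pc|exact: Pc].
  by apply: filterS (nU x Ux) => y /df.
split=> [x /D[]//|h].
have := CkD oU (CkM oU (Ck_cst k (h 0 0) oU) (IH f0 Pf0)) (CkM oU (Ck_cst k (h 0 1) oU) (IH f1 Pf1)).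
by apply: Ck_eq => // x /D[dfx E]; rewrite deriveE// E.
Qed.

Lemma derive_grad (W : normedModType R) (f : 'rV[R]_2 -> W) x h : differentiable f x ->
  'D_h f x = h 0 0 *: 'D_(e_ 0) f x + h 0 1 *: 'D_(e_ 1) f x.
Proof.
move=> df; rewrite !deriveE// -!linearZ -linearD; congr ('d f x _).
by apply: eq_row2; rewrite !mxE /= ?mulr1 ?mulr0 ?addr0 ?add0r.
Qed.

End PartialsToSmooth.

(** * A flat function *)

Section FlatFunction.
Context {R : realType}.

(** The case n = 0 is used as a cutoff. The others occur in its derivatives,
    and the span of the family is closed under differentiation. *)
Definition flat (n : nat) (x : R) : R :=
  if 0 < x then x^-1 ^+ n * expR (- x^-1) else 0.

Lemma flat_gt0 n x : 0 < x -> 0 < flat n x.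
Proof. by move=> x0; rewrite /flat x0 mulr_gt0 ?expR_gt0// exprn_gt0// invr_gt0. Qed.

Lemma flat_le0 n x : x <= 0 -> flat n x = 0.
Proof. by rewrite /flat leNgt => /negbTE ->. Qed.

Lemma flat_ge0 n x : 0 <= flat n x.
Proof. by have [/flat_le0->//|/flat_gt0 /ltW] := leP x 0. Qed.

(** The source of the zero derivative at the origin. *)
Lemma flat_quadratic n x : flat n x <= (n.+2)`!%:R * x ^+ 2.
Proof.
have [x0|x0] := leP x 0; first by rewrite flat_le0// mulr_ge0// sqr_ge0.
rewrite /flat x0 expRN.
set u := x^-1; have u0 : 0 < u by rewrite invr_gt0.
have := @expR_ge1Dxn R u n.+1 (ltW u0) => H.
have F0 : 0 < (n.+2)`!%:R :> R by rewrite ltr0n fact_gt0.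
have {}H : u ^+ n.+2 / (n.+2)`!%:R <= expR u by rewrite (le_trans _ H)// lerDr.
rewrite ler_pdivrMr ?expR_gt0//.
have -> : u ^+ n = (n.+2)`!%:R * x ^+ 2 * (u ^+ n.+2 / (n.+2)`!%:R).
  have ux : u * x = 1 by rewrite mulVf// gt_eqF.
  rewrite [RHS](_ : _ = u ^+ n * (u * x) ^+ 2 * ((n.+2)`!%:R / (n.+2)`!%:R)).
    by rewrite ux expr1n mulr1 divff ?mulr1// gt_eqF.
  have -> : u ^+ n.+2 = u ^+ n * u ^+ 2 by rewrite -exprD addn2.
  by move: (_`!%:R) (u ^+ n) => F U; ring.
by rewrite ler_wpM2l// mulr_ge0// ?sqr_ge0 ?ltW.
Qed.

(** A quadratic bound on the remainder, unlike a limit of difference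
    quotients, passes from the terms of a dominated series to its sum. *)
Lemma is_derive_quadratic (V W : normedModType R) (f : V -> W) (a v : V) (d : W) (C : R) :
  (\forall h \near 0, `|f (h *: v + a) - f a - h *: d| <= C * h ^+ 2) ->
  is_derive a v f d.
Proof.
move=> H.
have H2 : (fun h => h^-1 *: ((f \o shift a) (h *: v) - f a)) @ 0^' --> d.
  apply/cvgrPdist_le => e e0.
  have d0 : 0 < e / (`|C| + 1) by rewrite divr_gt0// ltr_wpDl.
  have Hn := near_norm (0 : R) d0.
  have Hne : \forall h \near (0:R)^', h != 0 by exact: nbhs_dnbhs_neq.
  apply: filterS3 (nbhs_dnbhs H) (nbhs_dnbhs Hn) Hne => h /= Hh.
  rewrite subr0 ler_pdivlMr ?ltr_wpDl// => he h0.
  rewrite distrC -[d in leLHS](scalerK h0) -scalerBr normrZ normfV.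
  rewrite ler_pdivrMl ?normr_gt0// (le_trans Hh)//.
  rewrite -real_normK ?num_real// expr2 mulrCA ler_wpM2l// (le_trans _ he)// mulrC ler_wpM2l//.
  by rewrite (le_trans (ler_norm _))// lerDl.
split; first by apply/cvg_ex; exists d.
exact: (cvg_lim _ H2).
Qed.

Lemma is_derive_flat n (x : R) :
  is_derive x 1 (flat n) (flat n.+2 x - n%:R * flat n.+1 x).
Proof.
have [x0|x0|->] := ltgtP x 0.
- rewrite !flat_le0 ?mulr0 ?subr0; try exact: ltW.
  apply: near_eq_is_derive (is_derive_cst (0 : R) x 1).
  have : \forall y \near x, y < 0 by exact: (lt_nbhsl x0).
  by apply: filterS => y /ltW/flat_le0.
- have nx : \forall y \near x, y^-1 ^+ n * expR (- y^-1) = flat n y.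
    have : \forall y \near x, 0 < y by exact: (lt_nbhsr x0).
    by apply: filterS => y y0; rewrite /flat y0.
  apply: near_eq_is_derive nx _.
  have dV : is_derive x 1 (fun y : R => y^-1) (- x^-1 ^+ 2).
    apply: DeriveDef; first by apply: derivableV; rewrite ?gt_eqF.
    by rewrite deriveV ?gt_eqF// derive_id [LHS]mulr1 exprVn.
  have dE : is_derive x 1 (fun y : R => expR (- y^-1)) (x^-1 ^+ 2 * expR (- x^-1)).
    have := is_derive1_comp (is_derive_expR _) (is_deriveN dV).
    by rewrite opprK => H; apply: is_derive_eq H _; rewrite mulrC.
  have dX : is_derive x 1 (fun y : R => y^-1 ^+ n) (n%:R * x^-1 ^+ n.-1 * (- x^-1 ^+ 2)).
    have := is_deriveX n dV; rewrite exprfctE => H.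
    by apply: (is_derive_eq H).
  have := is_deriveM dX dE; rewrite -[X in is_derive _ _ X]/(fun y : R => y^-1 ^+ n * expR (- y^-1)) => H.
  apply: is_derive_eq H _; rewrite /flat x0 /GRing.scale /=.
  case: (n) => [|m] /=; rewrite ?expr0 ?mul0r ?exprS; ring.
- rewrite !flat_le0// mulr0 subr0.
  have H (h : R) : `|flat n (h *: 1 + 0) - flat n 0 - h *: (0 : R)| <= (n.+2)`!%:R * h ^+ 2.
    rewrite addr0 scaler0 (flat_le0 n (lexx 0)) !subr0.
    by rewrite [h *: 1]mulr1 ger0_norm ?flat_ge0// flat_quadratic.
  apply: (@is_derive_quadratic _ _ _ _ _ _ (n.+2)`!%:R).
  by apply/nbhs_ballP; exists 1 => //= h _; exact: H.
Qed.

Lemma smooth_flat n : smooth setT (flat n).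
Proof.
move=> k; elim: k n => [|k IH] n.
  move=> x _; apply: differentiable_continuous; apply/derivable1_diffP.
  by have [] := is_derive_flat n x.
apply: (Ck_derive1 openT (fun x _ => is_derive_flat n x)).
have C := Ck_cst k (- n%:R : R) (openT (T := R)).
apply: Ck_eq (CkD openT (IH n.+2) (CkM openT C (IH n.+1))) => [|x _]; first exact: openT.
by rewrite mulNr.
Qed.

End FlatFunction.

(** * Inverse functions depending on a parameter *)

Section ParametricInverse.
Context {R : realType}.

Lemma open_norm_ball (V : normedModType R) (x : V) (r : R) : open [set y | `|y - x| < r].
Proof.
have := ball_open x r; congr (open _).
by apply/seteqP; split=> y; rewrite -ball_normE /ball_ /= distrC.
Qed.

Lemma coord0_le_norm (x : 'rV[R]_2) : `|x 0 0| <= `|x|.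
Proof. by rewrite norm_row2 le_max lexx. Qed.

Lemma coord1_le_norm (x : 'rV[R]_2) : `|x 0 1| <= `|x|.
Proof. by rewrite norm_row2 le_max lexx orbT. Qed.

Lemma coord0_dist_le (x y : 'rV[R]_2) : `|x 0 0 - y 0 0| <= `|x - y|.
Proof. by have := coord0_le_norm (x - y); rewrite !mxE. Qed.

Lemma coord1_dist_le (x y : 'rV[R]_2) : `|x 0 1 - y 0 1| <= `|x - y|.
Proof. by have := coord1_le_norm (x - y); rewrite !mxE. Qed.

Lemma row2B (a b c d : R) : row2 a b - row2 c d = row2 (a - c) (b - d).
Proof. by apply: eq_row2; rewrite !mxE. Qed.

Lemma open_smooth_at (V W : normedModType R) (f : V -> W) : open [set x | smooth_at x f].
Proof. by rewrite openE => x /smooth_at_near. Qed.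

(** On a small box the function g is strictly increasing in the second
    variable, with slope at least m. The intermediate value theorem solves
    g (x0, s) = y1, the slope makes the solution k unique and Lipschitz,
    and the expansion of g at the solution makes k differentiable, with
    partial derivatives - g_0 / g_1 and 1 / g_1 taken at (x0, k). These
    formulas raise the order of differentiability of k step by step. *)
Lemma param_inverse_pos (g : 'rV[R]_2 -> R) (p : 'rV[R]_2) :
  smooth_at p g -> 0 < 'D_(e_ 1) g p ->
  exists k : 'rV[R]_2 -> R, [/\ smooth_at (row2 (p 0 0) (g p)) k,
    k (row2 (p 0 0) (g p)) = p 0 1,
    (\forall x \near p, k (row2 ((x : 'rV[R]_2) 0 0) (g x)) = x 0 1) &
    (\forall y \near row2 (p 0 0) (g p), g (row2 ((y : 'rV[R]_2) 0 0) (k y)) = y 0 1)].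
Proof.
move=> sg c0.
pose m := 'D_(e_ 1) g p / 2; have m0 : 0 < m by rewrite divr_gt0.
pose M := `|'D_(e_ 0) g p| + 1; have M0 : 0 < M by rewrite ltr_wpDl.
have n1 : \forall x \near p, `|'D_(e_ 1) g p - 'D_(e_ 1) g x| <= m.
  by apply: continuous_at_near => //; apply: smooth_at_continuous; exact: smooth_at_derive.
have n0 : \forall x \near p, `|'D_(e_ 0) g p - 'D_(e_ 0) g x| <= 1.
  by apply: continuous_at_near => //; apply: smooth_at_continuous; exact: smooth_at_derive.
have [r r0 rP] := near_closed_ball (filterI (smooth_at_near sg) (filterI n0 n1)).
set a := p 0 0; set b := p 0 1; have pE : p = row2 a b by rewrite row2K.
have Rab x0 s : `|x0 - a| <= r -> `|s - b| <= r -> `|row2 x0 s - p| <= r.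
  by move=> h0 h1; rewrite pE row2B le_norm_row2 row2_0 row2_1 h0 h1.
have bt (u v c t : R) : `|u - c| <= r -> `|v - c| <= r -> Num.min u v <= t <= Num.max u v -> `|t - c| <= r.
  rewrite !ler_distl => /andP[h1 h2] /andP[h3 h4].
  by have [_|_] := leP u v => /andP[h5 h6]; clear -h1 h2 h3 h4 h5 h6; apply/andP; split; lra.
have dg x h : `|x - p| <= r -> is_derive x h g ('D_h g x).
  by move=> /rP[sx _]; apply: DeriveDef => //; exact: smooth_at_derivable.
have incr x0 s s' : `|x0 - a| <= r -> `|s - b| <= r -> `|s' - b| <= r ->
    exists2 D, m <= D & g (row2 x0 s') - g (row2 x0 s) = D * (s' - s).
  move=> h0 h1 h2.
  have [t tss' E] := @mean_value _ (fun t => g (row2 x0 t)) (fun t => 'D_(e_ 1) g (row2 x0 t)) s s'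
    (fun t th => (is_derive_row1 _ _ _ _).1 (dg _ _ (Rab _ _ h0 (bt _ _ _ _ h1 h2 th)))).
  exists ('D_(e_ 1) g (row2 x0 t)) => //.
  have [_ [_]] := rP _ (Rab _ _ h0 (bt _ _ _ _ h1 h2 tss')).
  by rewrite ler_distlC => /andP[+ _]; rewrite /m; lra.
have lip x0 x0' s : `|x0 - a| <= r -> `|x0' - a| <= r -> `|s - b| <= r ->
    `|g (row2 x0' s) - g (row2 x0 s)| <= M * `|x0' - x0|.
  move=> h0 h1 h2.
  have [t tss' ->] := @mean_value _ (fun t => g (row2 t s)) (fun t => 'D_(e_ 0) g (row2 t s)) x0 x0'
    (fun t th => (is_derive_row0 _ _ _ _).1 (dg _ _ (Rab _ _ (bt _ _ _ _ h0 h1 th) h2))).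
  rewrite normrM ler_wpM2r//.
  have [_ [+ _]] := rP _ (Rab _ _ (bt _ _ _ _ h0 h1 tss') h2).
  rewrite distrC /M => H; rewrite addrC -lerBlDr.
  by rewrite (le_trans _ H)// lerB_dist.
pose q := row2 a (g p).
(* Moving the first variable by d changes g by at most M d, and the value
   is allowed to move by d; the slope m over the length r has to cover the sum. *)
pose d := Num.min r (m * r / (1 + M)).
have d0 : 0 < d by rewrite lt_min r0 divr_gt0 ?mulr_gt0// addr_gt0.
pose W := [set y : 'rV[R]_2 | `|y - q| < d].
have oW : open W by exact: open_norm_ball.
have WP y : W y -> [/\ `|y 0 0 - a| <= r, `|y 0 0 - a| < d & `|y 0 1 - g p| < d].
  rewrite /W /= => yd; have h0 : `|y 0 0 - a| < d.
    by apply: le_lt_trans yd; have := coord0_dist_le y q; rewrite row2_0.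
  split=> //; first by rewrite (le_trans (ltW h0))// /d ge_min lexx.
  by apply: le_lt_trans yd; have := coord1_dist_le y q; rewrite row2_1.
have nr s : `|s| = r -> `|b + s - b| <= r by rewrite addrAC subrr add0r => ->.
have nb : `|b - b| <= r by rewrite subrr normr0 ltW.
have na : `|a - a| <= r by rewrite subrr normr0 ltW.
have ex y : W y -> exists s, `|s - b| <= r /\ g (row2 (y 0 0) s) = y 0 1.
  move=> /WP[h0 h0' h1].
  have dm : d * (1 + M) <= m * r.
    have : d <= m * r / (1 + M) by rewrite /d ge_min lexx orbT.
    by rewrite ler_pdivlMr// addr_gt0.
  have hr : `|b + r - b| <= r by rewrite nr// gtr0_norm.
  have hr' : `|b - r - b| <= r by rewrite nr// normrN gtr0_norm.
  have [D Dm E] := incr a b (b + r) na nb hr.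
  have [D' Dm' E'] := incr a (b - r) b na hr' nb.
  rewrite -pE in E, E'.
  have L1 := lip a (y 0 0) (b + r) na h0 hr.
  have L2 := lip a (y 0 0) (b - r) na h0 hr'.
  have Mh : M * `|y 0 0 - a| <= M * d by rewrite ler_wpM2l// ltW.
  have Dr : m * r <= D * r by rewrite ler_wpM2r// ltW.
  have Dr' : m * r <= D' * r by rewrite ler_wpM2r// ltW.
  move: L1 L2 h1 E E'; rewrite !ler_distl ltr_distl => /andP[L1 L1'] /andP[L2 L2'] /andP[h1 h1'] E E'.
  have bb : b - r <= b + r by move: r0; clear; lra.
  have cg : {within `[b - r, b + r], continuous (fun s => g (row2 (y 0 0) s))}.
    apply: derivable_within_continuous => s; rewrite in_itv/= => sb.
    have sb' : `|s - b| <= r by rewrite ler_distl.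
    by have [] := (is_derive_row1 _ _ _ _).1 (dg _ (e_ 1) (Rab _ _ h0 sb')).
  have [|s sb sE] := IVT (v := y 0 1) bb cg.
    by apply/andP; split; rewrite ?ge_min ?le_max; apply/orP; [left|right];
      apply: ltW; clear -L1 L1' L2 L2' h1 h1' E E' dm Mh Dr Dr'; lra.
  by exists s; split=> //; rewrite ler_distl; move: sb; rewrite in_itv.
pose k (y : 'rV[R]_2) := xget b [set s | `|s - b| <= r /\ g (row2 (y 0 0) s) = y 0 1].
have kP y : W y -> `|k y - b| <= r /\ g (row2 (y 0 0) (k y)) = y 0 1.
  by move=> /ex[s sP]; rewrite /k; case: xgetP => [_ -> []|/(_ s)].
have uniq x0 s s' : `|x0 - a| <= r -> `|s - b| <= r -> `|s' - b| <= r ->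
    m * `|s' - s| <= `|g (row2 x0 s') - g (row2 x0 s)|.
  move=> h0 h1 h2; have [D Dm ->] := incr x0 s s' h0 h1 h2.
  by rewrite normrM ler_wpM2r// (le_trans Dm)// ler_norm.
pose K := 1 + (1 + M) / m.
have K1 : 1 <= K by rewrite lerDl divr_ge0// ltW// addr_gt0.
have klip y y' : W y -> W y' -> `|k y' - k y| <= (1 + M) / m * `|y' - y|.
  move=> Wy Wy'; have [ky gy] := kP y Wy; have [ky' gy'] := kP y' Wy'.
  have [h0 _ _] := WP y Wy; have [h0' _ _] := WP y' Wy'.
  rewrite mulrAC ler_pdivlMr// mulrC (le_trans (uniq _ _ _ h0 ky ky'))//.
  rewrite gy mulrDl mul1r.
  have -> : g (row2 (y 0 0) (k y')) - y 0 1 = (y' 0 1 - y 0 1) + (g (row2 (y 0 0) (k y')) - y' 0 1) by ring.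
  rewrite (le_trans (ler_normD _ _))// lerD//.
    exact: coord1_dist_le.
  rewrite -gy' distrC; apply: (le_trans (lip _ _ _ h0 h0' ky')); rewrite ler_wpM2l ?(ltW M0)//.
  exact: coord0_dist_le.
pose psi (y : 'rV[R]_2) := row2 (y 0 0) (k y).
have psilip y y' : W y -> W y' -> `|psi y' - psi y| <= K * `|y' - y|.
  move=> Wy Wy'; rewrite row2B le_norm_row2 row2_0 row2_1; apply/andP; split.
    rewrite (le_trans (_ : _ <= `|y' - y|)) ?ler_peMl//.
    exact: coord0_dist_le.
  by rewrite (le_trans (klip _ _ Wy Wy'))// ler_wpM2r// lerDr.
have psir y : W y -> `|psi y - p| <= r.
  by move=> Wy; apply: Rab; [case: (WP y Wy)|case: (kP y Wy)].
have g1m z : `|z - p| <= r -> m <= 'D_(e_ 1) g z.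
  by move=> /rP[_ [_]]; rewrite ler_distlC => /andP[+ _]; rewrite /m; lra.
have nW y : W y -> \forall y' \near y, W y' by move=> Wy; exact: open_nbhs_nbhs.
have dk y : W y -> differentiable k y /\
    'd k y = gradL (- 'D_(e_ 0) g (psi y) / 'D_(e_ 1) g (psi y)) ('D_(e_ 1) g (psi y))^-1 :> (_ -> _).
  move=> Wy; apply: diff_eps; first exact: gradL_continuous.
  move=> e e0; have pr := psir y Wy.
  have g1 := lt_le_trans m0 (g1m _ pr).
  have dgz := smooth_at_differentiable (rP _ pr).1.
  have K0 : 0 < K by exact: lt_le_trans K1.
  have e'0 : 0 < e * m / K by rewrite divr_gt0// mulr_gt0.
  have [s s0 sP] := near_closed_ball (differentiable_near dgz e'0).
  have sK : 0 < s / K by rewrite divr_gt0.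
  apply: filterS2 (nW y Wy) (near_norm y sK) => y' Wy'.
  rewrite ler_pdivlMr// mulrC => y's.
  have PL := psilip _ _ Wy Wy'; have := sP (psi y') (le_trans PL y's).
  set N := `|psi y' - psi y| in PL *.
  have [_ gy] := kP y Wy; have [_ gy'] := kP y' Wy'.
  rewrite -deriveE// derive_grad// /psi gy gy' row2B row2_0 row2_1 /GRing.scale /=.
  rewrite -/(psi y) => H.
  set g1y := 'D_(e_ 1) g (psi y) in g1 H *; set g0y := 'D_(e_ 0) g (psi y) in H *.
  have -> : k y' - k y - gradL (- g0y / g1y) g1y^-1 (y' - y) =
      - ((y' 0 1 - y 0 1 - ((y' 0 0 - y 0 0) * g0y + (k y' - k y) * g1y)) / g1y).
    by rewrite /gradL !mxE; field; rewrite gt_eqF.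
  rewrite normrN normrM normfV (gtr0_norm g1) ler_pdivrMr//.
  rewrite (le_trans H)//.
  rewrite (le_trans (ler_wpM2l (ltW e'0) PL))//.
  have -> : e * m / K * (K * `|y' - y|) = e * `|y' - y| * m by field; rewrite gt_eqF.
  by rewrite ler_wpM2l ?mulr_ge0 ?(ltW e0)// g1m.
have sk : smooth W k.
  elim=> [|n IH].
    move=> y Wy; apply: differentiable_continuous; exact: (dk y Wy).1.
  split=> [y /dk[]//|h].
  have Cpsi : Ck n W psi.
    apply: Ck_rV => // i; case: (unliftP 0 i) => [j ->|->].
      by apply: Ck_eq IH => // y _; rewrite mxE ord1.
    have C0 : Ck n W (fun y : 'rV[R]_2 => y 0 0).
      by apply: smooth_at_smooth => y _; exact: smooth_at_coord.
    by apply: Ck_eq C0 => // y _; rewrite mxE.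
  have CD i : Ck n W (fun y => 'D_(e_ i) g (psi y)).
    have CDg : Ck n [set x | smooth_at x g] ('D_(e_ i) g).
      by apply: smooth_at_smooth => x; exact: smooth_at_derive.
    apply: (Ck_comp oW (@open_smooth_at _ _ g) _ Cpsi CDg) => y Wy.
    exact: (rP _ (psir y Wy)).1.
  have CV : Ck n W (fun y => ('D_(e_ 1) g (psi y))^-1).
    apply: (Ck_comp1 oW _ _ (CD 1) (@smooth_inv R n)); first exact: open_neq.
    by move=> y Wy /=; rewrite gt_eqF// (lt_le_trans m0)// g1m// psir.
  have := CkM oW (CkD oW (Ck_cst n (h 0 1) oW) (CkM oW (Ck_cst n (- h 0 0) oW) (CD 0))) CV.
  apply: Ck_eq => // y Wy; have [dky E] := dk y Wy.
  rewrite (deriveE _ dky) E /gradL.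
  move: (_^-1) ('D_(e_ 0) g _) (h 0 0) (h 0 1) => u v s t; ring.
have Wq : W q by rewrite /W /= subrr normr0.
have sq : smooth_at q k by exact: smooth_smooth_at sk.
exists k; split=> //.
- have [h1 h2] := kP q Wq; apply/eqP; rewrite -subr_eq0 -normr_le0 -(pmulr_rle0 _ m0).
  apply: (le_trans (uniq a b (k q) na nb h1)).
  by move: h2; rewrite /q row2_0 row2_1 => ->; rewrite -pE subrr normr0.
- have cx : {for p, continuous (fun x : 'rV[R]_2 => row2 (x 0 0) (g x))}.
    by apply: smooth_at_continuous; apply: smooth_at_row2 => //; exact: smooth_at_coord.
  have nWx : \forall x \near p, W (row2 ((x : 'rV[R]_2) 0 0) (g x)) by apply: cx; exact: nW.
  apply: filterS2 nWx (near_norm p r0) => x Wx xr.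
  have [h1 h2] := kP _ Wx; have [h0 _ _] := WP _ Wx.
  rewrite row2_0 in h0 h2; rewrite row2_1 in h2.
  have h1' : `|x 0 1 - b| <= r.
    by apply: le_trans xr; exact: coord1_dist_le.
  apply/eqP; rewrite -subr_eq0 -normr_le0 -(pmulr_rle0 _ m0).
  apply: (le_trans (uniq _ _ _ h0 h1' h1)).
  by rewrite h2 row2K subrr normr0.
- by apply: filterS (nW q Wq) => y /kP[].
Qed.

Lemma param_inverse (g : 'rV[R]_2 -> R) (p : 'rV[R]_2) :
  smooth_at p g -> 'D_(e_ 1) g p != 0 ->
  exists k : 'rV[R]_2 -> R, [/\ smooth_at (row2 (p 0 0) (g p)) k,
    k (row2 (p 0 0) (g p)) = p 0 1,
    (\forall x \near p, k (row2 ((x : 'rV[R]_2) 0 0) (g x)) = x 0 1) &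
    (\forall y \near row2 (p 0 0) (g p), g (row2 ((y : 'rV[R]_2) 0 0) (k y)) = y 0 1)].
Proof.
move=> sg; rewrite neq_lt => /orP[g0|]; last exact: param_inverse_pos.
have [|k [sk kp kl kr]] := @param_inverse_pos (fun x => - g x) p (smooth_atN sg).
  by rewrite deriveN ?oppr_gt0//; exact: smooth_at_derivable.
pose s (y : 'rV[R]_2) := row2 (y 0 0) (- y 0 1).
have ss y : smooth_at y s.
  by apply: smooth_at_row2; [|apply: smooth_atN]; exact: smooth_at_coord.
have sE : s (row2 (p 0 0) (g p)) = row2 (p 0 0) (- g p) by rewrite /s row2_0 row2_1.
exists (fun y => k (s y)); split.
- by apply: smooth_at_comp => //; rewrite sE.
- by rewrite sE.
- by apply: filterS kl => x; rewrite /s row2_0 row2_1.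
- have cs := smooth_at_continuous (ss (row2 (p 0 0) (g p))).
  pose P (z : 'rV[R]_2) := - g (row2 (z 0 0) (k z)) = z 0 1.
  have nP : nbhs (s (row2 (p 0 0) (g p))) P by rewrite sE.
  have sP : s @^-1` P `<=` (fun y : 'rV[R]_2 => g (row2 (y 0 0) (k (s y))) = y 0 1).
    by move=> y; rewrite /P /preimage /= /s row2_0 row2_1 => /oppr_inj.
  exact: (filterS sP (cs P nP)).
Qed.

End ParametricInverse.

(** * Hadamard's lemma with a parameter *)

Section Hadamard.
Context {R : realType}.

Lemma near_comp (V W : normedModType R) (f : V -> W) (x : V) (P : W -> Prop) :
  {for x, continuous f} -> (\forall y \near f x, P y) -> \forall y \near x, P (f y).
Proof. by move=> cf /cf. Qed.

Definition box (r s : R) : set 'rV[R]_2 := [set x | `|x 0 0| < r /\ `|x 0 1| < s].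

Lemma open_coord_lt (i : 'I_2) (c : R) : open [set x : 'rV[R]_2 | `|x 0 i| < c].
Proof.
rewrite openE => x xc.
have cx : {for x, continuous (fun y : 'rV[R]_2 => `|y 0 i|)}.
  have ci := smooth_at_continuous (smooth_at_coord x i).
  exact: continuous_comp ci (@norm_continuous _ _ _).
exact: (near_comp (P := fun z : R => z < c) cx (lt_nbhsl xc)).
Qed.

Lemma open_box r s : open (box r s).
Proof. exact: openI (open_coord_lt (i := 0) (c := r)) (open_coord_lt (i := 1) (c := s)). Qed.

Lemma ord2_cases (i : 'I_2) : i = 0 \/ i = 1.
Proof. by case: i => -[|[|//]] Hi; [left|right]; exact/val_inj. Qed.

Lemma compact_box (r s : R) : compact [set x : 'rV[R]_2 | `|x 0 0| <= r /\ `|x 0 1| <= s].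
Proof.
pose A (i : 'I_2) : set R := if i == 0 then `[- r, r]%classic else `[- s, s]%classic.
have cA i : compact (A i) by rewrite /A; case: ifP => _; exact: segment_compact.
have := rV_compact cA; congr compact; apply/seteqP; split=> x /=.
  by move=> xA; have := xA 1; have := xA 0; rewrite /A /= !in_itv /= !ler_norml.
rewrite !ler_norml => -[x0 x1] i; rewrite /A.
by case: (ord2_cases i) => -> /=; rewrite in_itv.
Qed.

Lemma box_bounded (f : 'rV[R]_2 -> R) (r s r' s' : R) : r' < r -> s' < s ->
  (forall x, box r s x -> {for x, continuous f}) ->
  exists2 M, 0 <= M & forall x : 'rV[R]_2, `|x 0 0| <= r' -> `|x 0 1| <= s' -> `|f x| <= M.
Proof.
move=> rr' ss' cf.
have cw : {within [set x : 'rV[R]_2 | `|x 0 0| <= r' /\ `|x 0 1| <= s'], continuous f}.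
  apply: continuous_in_subspaceT => x /set_mem[x0 x1]; apply: cf.
  by split; [exact: le_lt_trans rr'|exact: le_lt_trans ss'].
have /ex_strict_bound_gt0[M M0 /= Mf] : bounded_set (f @` [set x : 'rV[R]_2 | `|x 0 0| <= r' /\ `|x 0 1| <= s']).
  exact/compact_bounded/(continuous_compact cw)/compact_box.
by exists M => [|x x0 x1]; [exact: ltW|rewrite ltW// Mf//; exists x].
Qed.

Let mu := @lebesgue_measure R.

(** The powers of t are produced by differentiation with respect to the
    second variable; they make the family closed. *)
Definition moment_integral (n : nat) (g : 'rV[R]_2 -> R) (x : 'rV[R]_2) : R :=
  \int[mu]_(t in `[0, 1]) (t ^+ n * g (row2 (x 0 0) (t * x 0 1))).

Lemma is_derive_radial (g : 'rV[R]_2 -> R) (a k s : R) : differentiable g (row2 a (s * k)) ->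
  is_derive s 1 (fun t => g (row2 a (t * k))) (k * 'D_(e_ 1) g (row2 a (s * k))).
Proof.
move=> dg; have H : is_derive (row2 a (s * k)) (k *: e_ 1) g (k * 'D_(e_ 1) g (row2 a (s * k))).
  apply: DeriveDef; first exact: diff_derivable.
  by rewrite deriveE// linearZ /= -deriveE.
apply: is_derive_line H => t; congr g.
by apply: eq_row2; rewrite !mxE /= ?mulr0 ?add0r// mulr1 mulrDl.
Qed.

Variables (r s : R).

Lemma radial_continuous (g : 'rV[R]_2 -> R) a b n :
  (forall x, box r s x -> smooth_at x g) -> `|a| < r -> `|b| < s ->
  {within `[(0:R), 1], continuous (fun t => t ^+ n * g (row2 a (t * b)))}.
Proof.
move=> sg ar bs; apply: derivable_within_continuous => t; rewrite in_itv/= => /andP[t0 t1].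
have bt : box r s (row2 a (t * b)).
  split; rewrite ?row2_0 ?row2_1// (le_lt_trans _ bs)// normrM (ger0_norm t0).
  by rewrite ler_piMl.
have := is_derive_radial (smooth_at_differentiable (sg _ bt)) => H.
have dX : derivable (fun t : R => t ^+ n) t 1 by exact: exprn_derivable.
by have [dH _] := H; exact: (derivableM dX dH).
Qed.

Lemma moment_integrable (g : 'rV[R]_2 -> R) a b n :
  (forall x, box r s x -> smooth_at x g) -> `|a| < r -> `|b| < s ->
  mu.-integrable `[0, 1] (EFin \o (fun t => t ^+ n * g (row2 a (t * b)))).
Proof.
move=> sg ar bs; apply: continuous_compact_integrable; first exact: segment_compact.
exact: radial_continuous.
Qed.

Let btw (a c : R) : `|a| < c -> exists2 d : R, `|a| < d & d < c.
Proof. by move=> /midf_lt[ad dc]; exists ((`|a| + c) / 2). Qed.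

Let in01 (b t : R) : `[0, 1]%classic t -> `|t * b| <= `|b|.
Proof.
rewrite /= in_itv/= => /andP[t0 t1].
by rewrite normrM (ger0_norm t0) ler_piMl.
Qed.

Let pow01 (t : R) n : `[0, 1]%classic t -> `|t ^+ n| <= 1.
Proof.
rewrite /= in_itv/= => /andP[t0 t1].
by rewrite ger0_norm ?exprn_ge0// exprn_ile1.
Qed.

Let integrable_cst (M : R) : mu.-integrable `[0, 1] (EFin \o (fun=> M)).
Proof.
apply: continuous_compact_integrable; first exact: segment_compact.
by apply: continuous_subspaceT => x; exact: cvg_cst.
Qed.

Let is_derive_integral (f f' : R -> R -> R) (a d M : R) : `|a| < d ->
  (forall x : R, `|x| < d -> mu.-integrable `[0, 1] (EFin \o f x)) ->
  (forall x t : R, `|x| < d -> `[0, 1]%classic t -> is_derive x 1 (f^~ t) (f' x t)) ->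
  0 <= M -> (forall x t : R, `|x| < d -> `[0, 1]%classic t -> `|f' x t| <= M) ->
  is_derive a 1 (fun x => \int[mu]_(t in `[0, 1]) f x t) (\int[mu]_(t in `[0, 1]) f' a t).
Proof.
move=> ad fi df M0 fM; have I (x : R) : `]- d, d[%classic x -> `|x| < d.
  by rewrite /= in_itv/= ltr_norml.
have Ia : `]- d, d[%classic a by rewrite /= in_itv/= -ltr_norml.
have m01 : measurable (`[0, 1]%classic : set R) by [].
have fi' x : `]- d, d[%classic x -> mu.-integrable `[0, 1] (EFin \o f x) by move=> /I/fi.
have df1 x t : `]- d, d[%classic x -> `[0, 1]%classic t -> derivable (f^~ t) x 1.
  by move=> /I xd t01; have [] := df x t xd t01.
have d1E x t : `]- d, d[%classic x -> `[0, 1]%classic t -> partial1of2 f x t = f' x t.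
  by move=> /I xd t01; rewrite partial1of2E; have [] := df x t xd t01.
have fM' x t : `]- d, d[%classic x -> `[0, 1]%classic t -> `|partial1of2 f x t| <= M.
  by move=> xd t01; rewrite d1E//; apply: fM => //; exact: I.
have D := @derivable_under_integral R _ (measurableTypeR R) mu f _ m01 a (- d) d Ia fi' df1 (fun=> M) (fun=> M0) (integrable_cst M) fM'.
have E := @differentiation_under_integral R _ (measurableTypeR R) mu f _ m01 a (- d) d Ia fi' df1 (fun=> M) (fun=> M0) (integrable_cst M) fM'.
split=> //; rewrite -derive1E E; apply: eq_Rintegral => t; rewrite inE => t01.
exact: d1E.
Qed.

Lemma moment_derive0 (g : 'rV[R]_2 -> R) n a b :
  (forall x, box r s x -> smooth_at x g) -> box r s (row2 a b) ->
  is_derive (row2 a b) (e_ 0) (moment_integral n g) (moment_integral n ('D_(e_ 0) g) (row2 a b)).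
Proof.
move=> sg []; rewrite row2_0 row2_1 => ar bs; apply/is_derive_row0.
have [d ad dr] := btw ar; have [c bc cs] := btw bs.
have sDg x : box r s x -> smooth_at x ('D_(e_ 0) g) by move=> /sg; exact: smooth_at_derive.
have [M M0 DM] := box_bounded dr bs (fun x bx => smooth_at_continuous (sDg x bx)).
have H := @is_derive_integral (fun x t => t ^+ n * g (row2 x (t * b)))
  (fun x t => t ^+ n * 'D_(e_ 0) g (row2 x (t * b))) a d M ad.
have -> : (fun t => moment_integral n g (row2 t b)) =
    (fun x => \int[mu]_(t in `[0, 1]) (t ^+ n * g (row2 x (t * b)))).
  by apply/funext => x; rewrite /moment_integral row2_0 row2_1.
rewrite /moment_integral row2_0 row2_1.
have bx x t : `|x| < d -> `[0, 1]%classic t -> box r s (row2 x (t * b)).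
  move=> xd t01; split; rewrite ?row2_0 ?row2_1; first exact: lt_trans dr.
  by rewrite (le_lt_trans (in01 b t01)).
apply: H => // [x xd|x t xd t01|x t xd t01].
- by apply: moment_integrable => //; exact: lt_trans dr.
- have /(is_derive_row0 _ _ _ _).1 dg : is_derive (row2 x (t * b)) (e_ 0) g ('D_(e_ 0) g (row2 x (t * b))).
    by apply: DeriveDef => //; apply: smooth_at_derivable; apply: sg; exact: bx.
  exact: (is_deriveZ (t ^+ n) dg).
- rewrite normrM -[M]mul1r ler_pM//; first exact: pow01.
  by apply: DM; rewrite ?row2_0 ?row2_1 ?in01// ltW.
Qed.

Lemma moment_derive1 (g : 'rV[R]_2 -> R) n a b :
  (forall x, box r s x -> smooth_at x g) -> box r s (row2 a b) ->
  is_derive (row2 a b) (e_ 1) (moment_integral n g) (moment_integral n.+1 ('D_(e_ 1) g) (row2 a b)).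
Proof.
move=> sg []; rewrite row2_0 row2_1 => ar bs; apply/is_derive_row1.
have [c bc cs] := btw bs.
have sDg x : box r s x -> smooth_at x ('D_(e_ 1) g) by move=> /sg; exact: smooth_at_derive.
have [M M0 DM] := box_bounded ar cs (fun x bx => smooth_at_continuous (sDg x bx)).
have H := @is_derive_integral (fun x t => t ^+ n * g (row2 a (t * x)))
  (fun x t => t ^+ n.+1 * 'D_(e_ 1) g (row2 a (t * x))) b c M bc.
have -> : (fun t => moment_integral n g (row2 a t)) =
    (fun x => \int[mu]_(t in `[0, 1]) (t ^+ n * g (row2 a (t * x)))).
  by apply/funext => x; rewrite /moment_integral row2_0 row2_1.
rewrite /moment_integral row2_0 row2_1.
have bx x t : `|x| < c -> `[0, 1]%classic t -> box r s (row2 a (t * x)).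
  move=> xd t01; split; rewrite ?row2_0 ?row2_1//.
  by rewrite (le_lt_trans (in01 x t01))// (lt_trans xd).
apply: H => // [x xd|x t xd t01|x t xd t01].
- by apply: moment_integrable => //; exact: lt_trans cs.
- have := bx x t xd t01; rewrite mulrC => /sg/smooth_at_differentiable/is_derive_radial dg.
  have -> : (fun x => t ^+ n * g (row2 a (t * x))) = (fun x => t ^+ n * g (row2 a (x * t))).
    by apply/funext => y; rewrite (mulrC t).
  by apply: (is_derive_eq (is_deriveZ (t ^+ n) dg)); rewrite /GRing.scale /= exprSr mulrA (mulrC x).
- rewrite normrM -[M]mul1r ler_pM//; first exact: pow01.
  by apply: DM; rewrite ?row2_0 ?row2_1 ?lexx// (le_trans (in01 x t01))// ltW.
Qed.

Lemma moment_bounded (g : 'rV[R]_2 -> R) n x :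
  (forall x, box r s x -> smooth_at x g) -> box r s x ->
  exists M, \forall y \near x, `|moment_integral n g y| <= M.
Proof.
move=> sg [xr xs]; have [d xd dr] := btw xr; have [c xc cs] := btw xs.
have [M M0 gM] := box_bounded dr cs (fun x bx => smooth_at_continuous (sg x bx)).
exists M; have : nbhs x (box d c).
  by apply: open_nbhs_nbhs; split; [exact: open_box|].
apply: filterS => y [yd yc]; rewrite /moment_integral.
have yi := moment_integrable n sg (lt_trans yd dr) (lt_trans yc cs).
have m01 : measurable (`[0, 1]%classic : set R) by [].
rewrite (le_trans (le_normr_Rintegral _ yi))//.
have -> : M = \int[mu]_(_ in `[0, 1]) M.
  have E1 : lebesgue_measure (`[0, 1]%classic : set R) = 1%E.
    by rewrite lebesgue_measure_itv /= lte_fin ltr01 -EFinB subr0.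
  rewrite Rintegral_cst// -[LHS]mulr1; congr (_ * _).
  by symmetry; exact: (congr1 fine E1).
apply: le_Rintegral => //; first exact: integrable_norm.
move=> t t01; rewrite normrM -[M]mul1r ler_pM//; first exact: pow01.
by apply: gM; rewrite ?row2_0 ?row2_1 ?(ltW yd)// (le_trans (in01 _ t01))// ltW.
Qed.

(** Differentiation under the integral sign gives moment integrals of the
    partial derivatives of g. *)
Lemma smooth_moment (g : 'rV[R]_2 -> R) n :
  (forall x, box r s x -> smooth_at x g) -> smooth (box r s) (moment_integral n g).
Proof.
move=> sg.
pose P f := exists m h, (forall x, box r s x -> smooth_at x h) /\ f = moment_integral m h.
apply: (@smooth_coinduction R P _ (open_box (r := r) (s := s))); last by exists n, g.
- move=> _ [m [h [sh ->]]].
  exists (moment_integral m ('D_(e_ 0) h)), (moment_integral m.+1 ('D_(e_ 1) h)); split.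
  + by exists m, ('D_(e_ 0) h); split=> // x /sh; exact: smooth_at_derive.
  + by exists m.+1, ('D_(e_ 1) h); split=> // x /sh; exact: smooth_at_derive.
  + move=> x; rewrite -(row2K x) => bx.
    by split; [exact: moment_derive0|exact: moment_derive1].
- by move=> _ [m [h [sh ->]]] x bx; exact: moment_bounded.
Qed.

(** The fundamental theorem of calculus on the vertical segment from (a, 0)
    to (a, b). *)
Lemma hadamard (g : 'rV[R]_2 -> R) a b :
  (forall x, box r s x -> smooth_at x g) -> box r s (row2 a b) ->
  g (row2 a b) = g (row2 a 0) + b * moment_integral 0 ('D_(e_ 1) g) (row2 a b).
Proof.
move=> sg []; rewrite row2_0 row2_1 => ar bs.
have sDg x : box r s x -> smooth_at x ('D_(e_ 1) g) by move=> /sg; exact: smooth_at_derive.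
have bt (t : R) : `[0, 1]%classic t -> box r s (row2 a (t * b)).
  by move=> t01; split; rewrite ?row2_0 ?row2_1// (le_lt_trans (in01 b t01)).
have dF (t : R) : `[0, 1]%classic t -> is_derive t 1 (fun t => g (row2 a (t * b))) (b * 'D_(e_ 1) g (row2 a (t * b))).
  by move=> /bt/sg/smooth_at_differentiable/is_derive_radial.
have cF (t : R) : `[0, 1]%classic t -> {for t, continuous (fun t : R => g (row2 a (t * b)))}.
  by move=> /dF[dFt _]; apply: differentiable_continuous; apply/derivable1_diffP.
have i0 : `[0, 1]%classic (0 : R) by rewrite /= in_itv/= lexx ler01.
have i1 : `[0, 1]%classic (1 : R) by rewrite /= in_itv/= lexx ler01.
have mi := moment_integrable 0 sDg ar bs.
have m01 : measurable (`[0, 1]%classic : set R) by [].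
have E0 : (fun t : R => t ^+ 0 * 'D_(e_ 1) g (row2 a (t * b))) = (fun t => 'D_(e_ 1) g (row2 a (t * b))).
  by apply/funext => t; rewrite expr0 mul1r.
have cD := @radial_continuous ('D_(e_ 1) g) a b 0%N sDg ar bs; rewrite E0 in cD mi.
have cbD : {within `[(0:R), 1], continuous (fun t => b * 'D_(e_ 1) g (row2 a (t * b)))}.
  have sbD x : box r s x -> smooth_at x (fun y => b * 'D_(e_ 1) g y).
    by move=> /sDg; apply: smooth_atM; exact: smooth_at_cst.
  have := @radial_continuous (fun y => b * 'D_(e_ 1) g y) a b 0%N sbD ar bs.
  have -> // : (fun t : R => t ^+ 0 * (b * 'D_(e_ 1) g (row2 a (t * b)))) =
      (fun t => b * 'D_(e_ 1) g (row2 a (t * b))).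
  by apply/funext => t; rewrite expr0 mul1r.
have FTC := @continuous_FTC2 R (fun t => b * 'D_(e_ 1) g (row2 a (t * b)))
  (fun t => g (row2 a (t * b))) 0 1 ltr01 cbD.
rewrite /moment_integral row2_0 row2_1 E0 -RintegralZl// /Rintegral FTC.
- by rewrite -EFinB /= mul1r mul0r; ring.
- split=> [t /subset_itv_oo_cc t01||].
  + by have [] := dF t t01.
  + exact: cvg_at_right_filter (cF 0 i0).
  + exact: cvg_at_left_filter (cF 1 i1).
- move=> t /subset_itv_oo_cc t01; rewrite derive1E; by have [] := dF t t01.
Qed.

End Hadamard.

(** * Seeley's reflection weights *)

Section DominatedSeries.
Context {R : realType}.
Implicit Types u v : nat -> R.

(** The weights below decay faster than every geometric sequence, so that
    comparison with one fixed ratio is enough. *)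
Definition dominated u (C : R) := forall k, `|u k| <= C / 2 ^+ k.

Definition tsum u : R := limn (series u).

Lemma dominated_cvg u C : dominated u C -> cvgn [normed series u].
Proof.
move=> uC; apply: (@series_le_cvg R _ (geometric C 2^-1)) => [k|k|k|].
- exact: normr_ge0.
- by rewrite /geometric /= exprVn (le_trans _ (uC k)).
- by rewrite /geometric /= exprVn; exact: uC.
- by apply: is_cvg_geometric_series; rewrite ger0_norm ?invr_ge0// invf_lt1 ?ltr1n.
Qed.

Lemma tsum_le u C : dominated u C -> `|tsum u| <= C * 2.
Proof.
move=> uC; have cu := dominated_cvg uC.
apply: (le_trans (lim_series_norm cu)).
have h : `|2^-1 : R| < 1 by rewrite ger0_norm ?invr_ge0// invf_lt1 ?ltr1n.
have cg := cvg_geometric_series (a := C) h.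
have E : limn (series (geometric C 2^-1)) = C * 2.
  rewrite (cvg_lim _ cg)//; congr (_ * _).
  by rewrite [X in X - _](splitr 1) mul1r addrK invrK.
rewrite -E; apply: lim_series_le => //; first exact: is_cvg_geometric_series.
by move=> k; rewrite /geometric /= exprVn.
Qed.

Lemma dominatedD u v C D : dominated u C -> dominated v D ->
  dominated (fun k => u k + v k) (C + D).
Proof.
by move=> uC vD k; rewrite mulrDl (le_trans (ler_normD _ _))// lerD.
Qed.

Lemma dominatedZ u C x : dominated u C -> dominated (fun k => x * u k) (`|x| * C).
Proof. by move=> uC k; rewrite normrM -mulrA ler_wpM2l. Qed.

Lemma tsumD u v C D : dominated u C -> dominated v D ->
  tsum (fun k => u k + v k) = tsum u + tsum v.
Proof.
move=> /dominated_cvg/normed_cvg cu /dominated_cvg/normed_cvg cv.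
by rewrite /tsum -lim_seriesD.
Qed.

Lemma tsumZ u C x : dominated u C -> tsum (fun k => x * u k) = x * tsum u.
Proof.
by move=> /dominated_cvg/normed_cvg cu; rewrite /tsum -[RHS]/(x *: _) -lim_seriesZ.
Qed.

Lemma tsum_recl u C : dominated u C -> tsum u = u 0%N + tsum (fun k => u k.+1).
Proof.
move=> uC.
have uC' : dominated (fun k => u k.+1) C.
  move=> k; have := uC k.+1; rewrite exprS invfM mulrCA => /le_trans; apply.
  have C0 : 0 <= C / 2 ^+ k by rewrite mulr_ge0 ?invr_ge0 ?exprn_ge0//; have := uC 0%N; rewrite expr0 divr1; apply: le_trans.
  by rewrite ler_piMl// invf_le1// ler1n.
have cu := normed_cvg (dominated_cvg uC).
have cu' := normed_cvg (dominated_cvg uC').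
have E : limn (fun n => series u n.+1) = limn (series u).
  apply: cvg_lim => //; move/cvg_ex : cu => [l ul].
  by rewrite (cvg_lim _ ul)//; move: ul; rewrite -(cvg_shiftS (series u)).
rewrite /tsum -E; have -> : (fun n => series u n.+1) = (fun n => u 0%N + series (fun k => u k.+1) n).
  by apply/funext => n; rewrite /series /= big_nat_recl.
by rewrite limD//; [rewrite lim_cst|exact: is_cvg_cst].
Qed.

End DominatedSeries.

Section ExtensionCoefficients.
Context {R : realType}.

(** Taylor coefficients of the entire function E (x) = prod_j (1 - x / 2^j),
    obtained from E (x) = (1 - x) E (x / 2). *)
Fixpoint euler_coef (k : nat) : R :=
  if k is k'.+1 then - (euler_coef k' / 2 ^+ k') / (1 - (2 ^+ k'.+1)^-1) else 1.

Lemma euler_coef_rec k :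
  euler_coef k.+1 * (1 - (2 ^+ k.+1)^-1) = - (euler_coef k / 2 ^+ k).
Proof.
rewrite /= divfK// subr_eq0 eq_sym lt_eqF// invf_lt1 ?exprn_gt0//.
by rewrite exprn_egt1// ltr1n.
Qed.

Lemma euler_coef_step k : `|euler_coef k.+1| <= 2 * (`|euler_coef k| / 2 ^+ k).
Proof.
have p0 : (0 : R) < 2 ^+ k.+1 by rewrite exprn_gt0.
have h : (2 : R)^-1 <= 1 - (2 ^+ k.+1)^-1.
  have : (2 ^+ k.+1 : R)^-1 <= 2^-1.
    by rewrite lef_pV2 ?posrE// exprS ler_peMr// exprn_ege1// ler1n.
  by clear; lra.
have h0 : 0 < 1 - (2 ^+ k.+1 : R)^-1 by apply: lt_le_trans h; rewrite invr_gt0.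
have k0 : (0 : R) < 2 ^+ k by rewrite exprn_gt0.
rewrite /= normrM normrN normrM !normfV (gtr0_norm h0) (gtr0_norm k0).
rewrite [leLHS]mulrC; apply: ler_wpM2r; first by rewrite mulr_ge0 ?invr_ge0 ?exprn_ge0.
by rewrite -[leRHS]invrK lef_pV2 ?posrE// invr_gt0.
Qed.

(** Consecutive coefficients have a ratio of order 2^-k. *)
Lemma euler_coef_decay m : exists2 C : R, 0 <= C & forall k, `|euler_coef k| * (2 ^+ m) ^+ k <= C.
Proof.
elim: m => [|m [C C0 IH]].
  exists 4 => // k; rewrite expr0 expr1n mulr1.
  have H j : `|euler_coef j.+1| <= 2.
    elim: j => [|j IH]; first by rewrite (le_trans (euler_coef_step 0))// expr0 divr1 normr1 mulr1.
    rewrite (le_trans (euler_coef_step _))// ler_piMr//.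
    rewrite ler_pdivrMr ?exprn_gt0// mul1r (le_trans IH)// exprS ler_peMr//.
    by rewrite exprn_ege1// ler1n.
  case: k => [|k]; first by rewrite normr1 ler1n.
  by rewrite (le_trans (H k))// ler_nat.
exists (Num.max 1 (2 ^+ m.+2 * C)) => [|[|k]]; first by rewrite le_max ler01.
  by rewrite expr0 mulr1 normr1 le_max lexx.
rewrite le_max; apply/orP; right.
have := ler_wpM2r (_ : 0 <= (2 ^+ m.+1) ^+ k.+1 :> R) (euler_coef_step k).
rewrite ?exprn_ge0// => /(_ isT) /le_trans; apply.
have -> : 2 * (`|euler_coef k| / 2 ^+ k) * (2 ^+ m.+1) ^+ k.+1 =
    2 ^+ m.+2 * (`|euler_coef k| * (2 ^+ m) ^+ k) :> R.
  rewrite exprS [2 ^+ m.+1]exprS exprMn_comm; last exact: mulrC.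
  have k0 : (2 : R) ^+ k != 0 by rewrite expf_neq0.
  by rewrite [2 ^+ m.+2]exprS [2 ^+ m.+1]exprS; move: (`|_|) (2 ^+ m) ((2 ^+ m) ^+ k) => u v w; field.
by rewrite ler_wpM2l// exprn_ge0.
Qed.

Lemma euler_dominated m u D : (forall k, `|u k| <= D * (2 ^+ m) ^+ k) ->
  exists C, dominated (fun k => euler_coef k * u k) C.
Proof.
move=> uD; have [C C0 cC] := euler_coef_decay m.+1; exists (D * C) => k.
have D0 : 0 <= D by have := uD 0%N; rewrite expr0 mulr1; apply: le_trans.
rewrite normrM ler_pdivlMr ?exprn_gt0//.
apply: (@le_trans _ _ (D * (`|euler_coef k| * (2 ^+ m.+1) ^+ k))); last first.
  by rewrite ler_wpM2l.
rewrite exprS exprMn_comm; last exact: mulrC.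
rewrite [leRHS](_ : _ = `|euler_coef k| * (D * (2 ^+ m) ^+ k) * 2 ^+ k); last by ring.
by rewrite ler_wpM2r ?exprn_ge0// ler_wpM2l.
Qed.

(** This is E (2^n) = 0: the equation E (x) = (1 - x) E (x / 2) gives
    E (1) = 0 and carries the zero from x / 2 to x. *)
Lemma euler_moment n : tsum (fun k => euler_coef k * (2 ^+ n) ^+ k) = 0 :> R.
Proof.
have domx (x : R) m : 0 <= x <= 2 ^+ m -> exists C, dominated (fun k => euler_coef k * x ^+ k) C.
  move=> /andP[x0 xm]; apply: (@euler_dominated m _ 1) => k.
  by rewrite mul1r ger0_norm ?exprn_ge0// lerXn2r// nnegrE ?exprn_ge0.
have rec (x : R) m : 0 <= x <= 2 ^+ m ->
    tsum (fun k => euler_coef k * x ^+ k) = (1 - x) * tsum (fun k => euler_coef k * (x / 2) ^+ k).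
  move=> /andP[x0 xm].
  have [C xC] := domx x m (introT andP (conj x0 xm)).
  have [|D xD] := domx (x / 2) m.
    by rewrite divr_ge0//= (le_trans _ xm)// ler_pdivrMr// ler_peMr// ler1n.
  have := dominatedD xC (dominatedZ (-1) xD).
  set w := fun k => _ => wC.
  have Ew : tsum w = tsum (fun k => euler_coef k * x ^+ k) - tsum (fun k => euler_coef k * (x / 2) ^+ k).
    by rewrite (tsumD xC (dominatedZ (-1) xD)) (tsumZ _ xD) mulN1r.
  have : tsum w = - x * tsum (fun k => euler_coef k * (x / 2) ^+ k).
    rewrite (tsum_recl wC) /w !expr0 mulN1r subrr add0r -(tsumZ _ xD); congr tsum.
    apply/funext => k; rewrite exprMn exprVn.
    have -> : euler_coef k.+1 * x ^+ k.+1 + -1 * (euler_coef k.+1 * (x ^+ k.+1 * (2 ^+ k.+1)^-1)) =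
      (euler_coef k.+1 * (1 - (2 ^+ k.+1)^-1)) * x ^+ k.+1 by ring.
    by rewrite euler_coef_rec exprS exprMn exprVn; ring.
  by rewrite Ew => /eqP; rewrite subr_eq => /eqP ->; ring.
elim: n => [|n IH].
  by rewrite (rec _ 0%N) ?expr0 ?lexx ?ler01// subrr mul0r.
rewrite (rec _ n.+1) ?lexx ?exprn_ge0//.
have -> : (2 : R) ^+ n.+1 / 2 = 2 ^+ n by rewrite exprS mulrC mulKf.
by rewrite IH mulr0.
Qed.

(** The affine function 2 x - 3 sends the zeros 1, 2, 4, ... of E to
    - 1, 1, 5, ...: the first becomes - 1 and the others become positive. *)
Definition node (k : nat) : R := 2 * 2 ^+ k - 3.

Lemma node_le k : `|node k| <= 4 * 2 ^+ k.
Proof.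
have : (1 : R) <= 2 ^+ k by rewrite exprn_ege1// ler1n.
by rewrite /node ler_norml; move: (2 ^+ k) => x x1; apply/andP; split; lra.
Qed.

Lemma node_leX n k : `|node k| ^+ n <= 4 ^+ n * (2 ^+ n) ^+ k.
Proof.
rewrite -exprM mulnC exprM -exprMn; apply: lerXn2r; last exact: node_le.
  by rewrite nnegrE.
by rewrite nnegrE mulr_ge0 ?exprn_ge0.
Qed.

(** Moments of an affine function of 2^k are combinations of the moments
    [euler_moment]; the powers of 2^k are carried along in the induction. *)
Lemma node_moment n : tsum (fun k => euler_coef k * node k ^+ n) = 0 :> R.
Proof.
suff H m : tsum (fun k => euler_coef k * (node k ^+ n * (2 ^+ m) ^+ k)) = 0.
  by rewrite -[RHS](H 0%N); congr tsum; apply/funext => k; rewrite expr0 expr1n mulr1.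
have dom i j : exists C, dominated (fun k => euler_coef k * (node k ^+ i * (2 ^+ j) ^+ k)) C.
  apply: (@euler_dominated (i + j) _ (4 ^+ i)) => k.
  rewrite normrM normrX [X in _ * X]ger0_norm ?exprn_ge0//.
  rewrite exprD exprMn mulrA ler_wpM2r ?exprn_ge0//.
  exact: node_leX.
elim: n m => [|n IH] m.
  by rewrite -[RHS](euler_moment m); congr tsum; apply/funext => k; rewrite expr0 mul1r.
have [C dC] := dom n m.+1; have [D dD] := dom n m.
transitivity (2 * tsum (fun k => euler_coef k * (node k ^+ n * (2 ^+ m.+1) ^+ k)) +
   (-3) * tsum (fun k => euler_coef k * (node k ^+ n * (2 ^+ m) ^+ k))); last first.
  by rewrite !IH !mulr0 addr0.
rewrite -(tsumZ _ dC) -(tsumZ _ dD) -(tsumD (dominatedZ _ dC) (dominatedZ _ dD)).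
congr tsum; apply/funext => k.
have -> : ((2 : R) ^+ m.+1) ^+ k = 2 ^+ k * (2 ^+ m) ^+ k by rewrite exprS exprMn.
by rewrite exprS /node; ring.
Qed.

(** With the weights - c_{k+1}, where c is [euler_coef], the values at the
    points [- ext_node k * z], z < 0, continue a function on the half-line
    z >= 0 to negative z. The n-th derivative multiplies the k-th weight by
    [(- ext_node k) ^+ n]. *)
Definition ext_node (k : nat) : R := node k.+1.
Definition ext_weight (n k : nat) : R := - euler_coef k.+1 * (- ext_node k) ^+ n.

Lemma ext_node_gt0 k : 0 < ext_node k.
Proof.
have : (1 : R) <= 2 ^+ k by rewrite exprn_ege1// ler1n.
by rewrite /ext_node /node exprS; move: (2 ^+ k) => x x1; lra.
Qed.

Lemma ext_weightS n k : ext_weight n.+1 k = ext_weight n k * - ext_node k.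
Proof. by rewrite /ext_weight exprSr mulrA. Qed.

(** The constant N serves all sequences u at once, so that estimates of the
    terms which are uniform in k bound the series. *)
Lemma ext_weight_dominated n : exists2 N, 0 <= N & forall u M, (forall k, `|u k| <= M) ->
  dominated (fun k => ext_weight n k * u k) (N * M).
Proof.
have [C C0 cC] := euler_coef_decay n.+1.
exists (4 ^+ n * C) => [|u M uM k]; first by rewrite mulr_ge0 ?exprn_ge0.
rewrite normrM mulrAC ler_pM//.
rewrite /ext_weight mulNr normrN normrM normrX normrN ler_pdivlMr ?exprn_gt0//.
apply: (@le_trans _ _ (4 ^+ n * (`|euler_coef k.+1| * (2 ^+ n.+1) ^+ k.+1))); last first.
  by rewrite ler_wpM2l ?exprn_ge0.
rewrite [2 ^+ n.+1]exprS exprMn mulrCA -mulrA ler_wpM2l//.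
have h1 : `|ext_node k| ^+ n <= 4 ^+ n * (2 ^+ n) ^+ k.+1 by exact: node_leX.
rewrite [leRHS](_ : _ = (4 ^+ n * (2 ^+ n) ^+ k.+1) * 2 ^+ k.+1); last by ring.
have h2 : (2 : R) ^+ k <= 2 ^+ k.+1 by rewrite ler_weXn2l ?ler1n.
by apply: ler_pM => //; rewrite exprn_ge0.
Qed.

(** The derivatives of all orders agree at 0. The relation is the n-th
    moment [node_moment] solved for its term of index 0, whose node is - 1. *)
Lemma ext_weight1 n : tsum (fun k => ext_weight n k) = 1 :> R.
Proof.
have [C dC] : exists C, dominated (fun k => euler_coef k * node k ^+ n) C.
  apply: (@euler_dominated n _ (4 ^+ n)) => k.
  by rewrite normrX node_leX.
have := node_moment n; rewrite (tsum_recl dC) mul1r => /eqP; rewrite addrC addr_eq0 => /eqP E.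
have dC' : dominated (fun k => euler_coef k.+1 * node k.+1 ^+ n) C.
  move=> k; have := dC k.+1; rewrite exprS invfM mulrCA => /le_trans; apply.
  have C0' : 0 <= C / 2 ^+ k by rewrite mulr_ge0 ?invr_ge0 ?exprn_ge0//; have := dC 0%N; rewrite expr0 divr1; apply: le_trans.
  by rewrite ler_piMl// invf_le1// ler1n.
transitivity (- (-1) ^+ n * tsum (fun k => euler_coef k.+1 * node k.+1 ^+ n)).
  rewrite -(tsumZ _ dC'); congr tsum; apply/funext => k.
  by rewrite /ext_weight /ext_node (exprNn (node k.+1)); ring.
rewrite E /node expr0 mulrNN -exprMn.
by rewrite (_ : -1 * (2 * 1 - 3) = 1 :> R) ?expr1n//; ring.
Qed.

End ExtensionCoefficients.

(** * Continuation of even functions across the axis *)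

Section QuadraticTaylor.
Context {R : realType}.

(** The derivatives are only required inside the interval, since f (x, sqrt z)
    is to be differentiated for z > 0 only. *)
Lemma taylor_quadratic (g g' g'' : R -> R) (a b M : R) :
  {within `[Num.min a b, Num.max a b], continuous g} ->
  {within `[Num.min a b, Num.max a b], continuous g'} ->
  (forall t, Num.min a b < t < Num.max a b -> is_derive t 1 g (g' t)) ->
  (forall t, Num.min a b < t < Num.max a b -> is_derive t 1 g' (g'' t)) ->
  (forall t, Num.min a b <= t <= Num.max a b -> `|g'' t| <= M) ->
  `|g b - g a - (b - a) * g' a| <= M * (b - a) ^+ 2.
Proof.
move=> cg cg' dg dg' gM.
have [t tab ->] := mean_value_within cg dg.
have sub : `[Num.min a t, Num.max a t] `<=` `[Num.min a b, Num.max a b].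
  move=> s /=; rewrite !in_itv /= => /andP[h1 h2]; move: tab => /andP[h3 h4].
  have h5 : Num.min a b <= a <= Num.max a b by rewrite ge_min le_max lexx.
  move: h5 => /andP[h5 h6]; apply/andP; split.
    by apply: le_trans h1; rewrite le_min h5.
  by rewrite (le_trans h2)// ge_max h6.
have d2 s : Num.min a t < s < Num.max a t -> is_derive s 1 g' (g'' s).
  move=> /andP[h1 h2]; apply: dg'; move: tab => /andP[h3 h4].
  have h5 : Num.min a b <= a <= Num.max a b by rewrite ge_min le_max lexx.
  move: h5 => /andP[h5 h6]; apply/andP; split.
    by apply: le_lt_trans h1; rewrite le_min h5.
  by rewrite (lt_le_trans h2)// ge_max h6.
have [s sat E] := mean_value_within (continuous_subspaceW sub cg') d2.
have -> : g' t * (b - a) - (b - a) * g' a = (g' t - g' a) * (b - a) by ring.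
have -> : M * (b - a) ^+ 2 = M * `|b - a| * `|b - a|.
  by rewrite -mulrA -normrM -expr2 ger0_norm ?sqr_ge0.
rewrite E !normrM; apply: ler_wpM2r => //; apply: ler_pM => //; last exact: between_norm.
by apply: gM; have := sub s; rewrite /= !in_itv /=; apply.
Qed.

End QuadraticTaylor.

Lemma smooth_is_derive {R : realType} (V W : normedModType R) (f : V -> W) x (h : V) :
  smooth_at x f -> is_derive x h f ('D_h f x).
Proof. by move=> sf; apply: DeriveDef => //; exact: smooth_at_derivable. Qed.

Lemma near_norm_lt {R : realType} (a c : R) : `|a| < c -> \forall t \near a, `|t| < c.
Proof.
move=> ac; have ca : {for a, continuous (fun t : R => `|t|)} by exact: norm_continuous.
exact: (near_comp (P := fun z : R => z < c) ca (lt_nbhsl ac)).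
Qed.

Section EvenExtension.
Context {R : realType}.
Variables (r rho : R).
Hypotheses (rho0 : 0 <= rho).

(** The support condition keeps f and its derivatives bounded on
    substrips, however large the nodes of a reflection are. *)
Definition even_class (f : 'rV[R]_2 -> R) : Prop :=
  [/\ forall x : 'rV[R]_2, `|x 0 0| < r -> smooth_at x f,
      forall a b, `|a| < r -> f (row2 a (- b)) = f (row2 a b) &
      forall a b, `|a| < r -> rho < `|b| -> f (row2 a b) = 0].

(** The derivative of f (x, sqrt z) in z is f_y / (2 y). It is written as an
    integral of f_yy to be smooth across y = 0. *)
Definition half_derive (f : 'rV[R]_2 -> R) (x : 'rV[R]_2) : R :=
  2^-1 * moment_integral 0 ('D_(e_ 1) ('D_(e_ 1) f)) x.

Lemma derive_parity (f : 'rV[R]_2 -> R) (c a b : R) :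
  smooth_at (row2 a (- b)) f ->
  (\forall t \near b, f (row2 a (- t)) = c * f (row2 a t)) ->
  smooth_at (row2 a b) f ->
  - 'D_(e_ 1) f (row2 a (- b)) = c * 'D_(e_ 1) f (row2 a b).
Proof.
move=> sf nf sf'.
have d1 := (is_derive_row1 _ _ _ _).1 (smooth_is_derive (e_ 1) sf).
have d2 := (is_derive_row1 _ _ _ _).1 (smooth_is_derive (e_ 1) sf').
have dN : is_derive b 1 (fun t : R => - t) (-1) by exact: is_deriveNid.
have d3 := is_derive1_comp d1 dN.
have d4 := is_deriveZ c d2.
have d5 := near_eq_is_derive nf d3.
rewrite mulrN1 in d5.
by rewrite -(derive_val (is_derive := d5)) (derive_val (is_derive := d4)).
Qed.

Lemma even_class_derive0 f : even_class f -> even_class ('D_(e_ 0) f).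
Proof.
move=> [sf ef pf]; split.
- by move=> x /sf; exact: smooth_at_derive.
- move=> a b ar.
  have na : \forall t \near a, f (row2 t (- b)) = f (row2 t b).
    by apply: filterS (near_norm_lt ar) => t; exact: ef.
  have s1 : smooth_at (row2 a b) f by apply: sf; rewrite row2_0.
  have s2 : smooth_at (row2 a (- b)) f by apply: sf; rewrite row2_0.
  have d1 := (is_derive_row0 _ _ _ _).1 (smooth_is_derive (e_ 0) s1).
  have d2 := (is_derive_row0 _ _ _ _).1 (smooth_is_derive (e_ 0) s2).
  have d3 := near_eq_is_derive na d2.
  by rewrite -(derive_val (is_derive := d3)) (derive_val (is_derive := d1)).
- move=> a b ar br.
  have na : \forall t \near a, 0 = f (row2 t b).
    by apply: filterS (near_norm_lt ar) => t tr; rewrite pf.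
  have s1 : smooth_at (row2 a b) f by apply: sf; rewrite row2_0.
  have d1 := (is_derive_row0 _ _ _ _).1 (smooth_is_derive (e_ 0) s1).
  have d3 := near_eq_is_derive na (is_derive_cst (0 : R) a 1).
  by rewrite -(derive_val (is_derive := d1)) (derive_val (is_derive := d3)).
Qed.

Lemma even_class_odd_derive f a b : even_class f -> `|a| < r ->
  'D_(e_ 1) f (row2 a (- b)) = - 'D_(e_ 1) f (row2 a b).
Proof.
move=> [sf ef _] ar; have s1 : smooth_at (row2 a b) f by apply: sf; rewrite row2_0.
have s2 : smooth_at (row2 a (- b)) f by apply: sf; rewrite row2_0.
apply: oppr_inj; rewrite opprK -[RHS]mul1r; apply: derive_parity => //.
by apply/nbhs_ballP; exists 1 => //= t _; rewrite mul1r ef.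
Qed.

Lemma half_deriveE f a b : even_class f -> `|a| < r ->
  'D_(e_ 1) f (row2 a b) = 2 * b * half_derive f (row2 a b).
Proof.
move=> cf ar; have [sf _ _] := cf.
have sD x : box r (`|b| + 1) x -> smooth_at x ('D_(e_ 1) f).
  by move=> [xr _]; apply: smooth_at_derive; exact: sf.
rewrite (hadamard sD); last by split; rewrite ?row2_0 ?row2_1// ltrDl.
have -> : 'D_(e_ 1) f (row2 a 0) = 0.
  have := even_class_odd_derive 0 cf ar; rewrite oppr0 => /eqP.
  by rewrite -addr_eq0 -mulr2n mulrn_eq0 /= => /eqP.
by rewrite add0r /half_derive; field.
Qed.

(** The integral formula gives smoothness and evenness, the quotient
    f_y / (2 y) the support. *)
Lemma even_class_half f : even_class f -> even_class (half_derive f).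
Proof.
move=> cf; have [sf ef pf] := cf; split.
- move=> x xr; apply: smooth_atM; first exact: smooth_at_cst.
  have sD y : box r (`|x 0 1| + 1) y -> smooth_at y ('D_(e_ 1) ('D_(e_ 1) f)).
    by move=> [yr _]; do 2!apply: smooth_at_derive; exact: sf.
  apply: (smooth_smooth_at _ _ (smooth_moment 0 sD)); first exact: open_box.
  by split=> //; rewrite ltrDl.
- move=> a b ar; set h := 'D_(e_ 1) ('D_(e_ 1) f).
  have eh c : h (row2 a (- c)) = h (row2 a c).
    have s1 : smooth_at (row2 a c) ('D_(e_ 1) f) by apply: smooth_at_derive; apply: sf; rewrite row2_0.
    have s2 : smooth_at (row2 a (- c)) ('D_(e_ 1) f) by apply: smooth_at_derive; apply: sf; rewrite row2_0.
    apply: oppr_inj; rewrite -[RHS]mulN1r; apply: derive_parity => //.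
    by apply/nbhs_ballP; exists 1 => //= u _; rewrite mulN1r even_class_odd_derive.
  have E : moment_integral 0 h (row2 a (- b)) = moment_integral 0 h (row2 a b).
    rewrite /moment_integral (row2_0 a b) (row2_0 a (- b)) (row2_1 a b) (row2_1 a (- b)).
    by apply: eq_Rintegral => t _; rewrite mulrN eh.
  by rewrite /half_derive -/h E.
- move=> a b ar br; have s1 : smooth_at (row2 a b) f by apply: sf; rewrite row2_0.
  have b0 : b != 0 by rewrite -normr_gt0 (le_lt_trans _ br).
  have nb : \forall t \near b, 0 = f (row2 a t).
    have cb : {for b, continuous (fun t : R => `|t|)} by exact: norm_continuous.
    have := near_comp (P := fun z : R => rho < z) cb (lt_nbhsr br).
    by apply: filterS => t tr; rewrite pf.
  have d1 := (is_derive_row1 _ _ _ _).1 (smooth_is_derive (e_ 1) s1).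
  have d3 := near_eq_is_derive nb (is_derive_cst (0 : R) b 1).
  have := half_deriveE b cf ar.
  rewrite -(derive_val (is_derive := d1)) (derive_val (is_derive := d3)) => /esym/eqP.
  have b2 : 2 * b != 0 by rewrite mulf_neq0.
  by rewrite mulf_eq0 (negbTE b2) => /eqP.
Qed.

Lemma even_class_bounded f d : even_class f -> d < r ->
  exists2 M, 0 <= M & forall a b, `|a| <= d -> `|f (row2 a b)| <= M.
Proof.
move=> [sf _ pf] dr.
have cf (x : 'rV[R]_2) : box r (rho + 1) x -> {for x, continuous f}.
  by move=> [xr _]; apply: smooth_at_continuous; exact: sf.
have rr : rho < rho + 1 by rewrite ltrDl.
have [M M0 fM] := box_bounded dr rr cf.
exists M => // a b ad; have [br|br] := leP `|b| rho.
  by apply: fM; rewrite ?row2_0 ?row2_1.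
by rewrite pf ?normr0// (le_lt_trans ad).
Qed.

(** The function f (x, sqrt z) of x and z, continued to z < 0 by reflection;
    n is the number of z-derivatives already taken. *)
Definition even_extension (n : nat) (f : 'rV[R]_2 -> R) (x : 'rV[R]_2) : R :=
  if 0 <= x 0 1 then f (row2 (x 0 0) (Num.sqrt (x 0 1)))
  else tsum (fun k => ext_weight n k * f (row2 (x 0 0) (Num.sqrt (- ext_node k * x 0 1)))).

Lemma even_extension_ge0 n f a z : 0 <= z ->
  even_extension n f (row2 a z) = f (row2 a (Num.sqrt z)).
Proof. by move=> z0; rewrite /even_extension row2_0 row2_1 z0. Qed.

(** The two clauses agree at z = 0 because the weights sum up to 1. *)
Lemma even_extension_le0 n f a z : z <= 0 -> even_extension n f (row2 a z) =
  tsum (fun k => ext_weight n k * f (row2 a (Num.sqrt (- ext_node k * z)))).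
Proof.
rewrite le_eqVlt => /predU1P[->|z0].
  rewrite even_extension_ge0// sqrtr0.
  have [N _ dN] := @ext_weight_dominated R n.
  have d1 : dominated (fun k => ext_weight n k * 1) (N * 1) by apply: dN => k; rewrite normr1.
  have -> : (fun k => ext_weight n k * f (row2 a (Num.sqrt (- ext_node k * 0)))) =
     (fun k => f (row2 a 0) * (ext_weight n k * 1)).
    by apply/funext => k; rewrite mulr0 sqrtr0 mulr1 mulrC.
  rewrite (tsumZ _ d1); have -> : (fun k => ext_weight n k * 1 : R) = ext_weight n.
    by apply/funext => k; rewrite mulr1.
  by rewrite ext_weight1 mulr1.
by rewrite /even_extension row2_0 row2_1 leNgt z0.
Qed.

(** The first-order remainder of a weighted series is summed from the
    remainders of its terms, which are of the form weight times q k. *)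
Lemma tsum_increment n m j : exists2 C : R, 0 <= C &
  forall (u u' v q : nat -> R) (B M d : R),
  (forall k, `|u k| <= B) -> (forall k, `|u' k| <= B) -> (forall k, `|v k| <= B) ->
  (forall k, `|q k| <= M) ->
  (forall k, ext_weight n k * u' k - ext_weight n k * u k - d * (ext_weight m k * v k) =
     ext_weight j k * q k) ->
  `|tsum (fun k => ext_weight n k * u' k) - tsum (fun k => ext_weight n k * u k) -
    d * tsum (fun k => ext_weight m k * v k)| <= C * M.
Proof.
have [N _ dN] := @ext_weight_dominated R n.
have [N' _ dN'] := @ext_weight_dominated R m.
have [C C0 dC] := @ext_weight_dominated R j.
exists (C * 2) => [|u u' v q B M d uB u'B vB qM E]; first by rewrite mulr_ge0.
have du := dN _ _ uB; have du' := dN _ _ u'B; have dv := dN' _ _ vB; have dq := dC _ _ qM.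
rewrite -mulN1r -(tsumZ _ du) -(tsumD du' (dominatedZ _ du)).
rewrite -mulNr -(tsumZ _ dv) -(tsumD (dominatedD du' (dominatedZ _ du)) (dominatedZ _ dv)).
have -> : (fun k => ext_weight n k * u' k + -1 * (ext_weight n k * u k) + - d * (ext_weight m k * v k)) =
    (fun k => ext_weight j k * q k).
  by apply/funext => k; rewrite -E; ring.
by rewrite (le_trans (tsum_le dq))// mulrAC.
Qed.

Let in_strip f : even_class f -> forall a b, `|a| < r -> smooth_at (row2 a b) f.
Proof. by move=> [sf _ _] a b ar; apply: sf; rewrite row2_0. Qed.

Let continuous_sqrt_comp f a (z z' : R) : even_class f -> `|a| < r ->
  {within `[z, z'], continuous (fun t => f (row2 a (Num.sqrt t)))}.
Proof.
move=> cf ar; apply: continuous_subspaceT => t.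
have c1 : {for Num.sqrt t, continuous (fun u : R => f (row2 a u))}.
  apply: smooth_at_continuous; apply: smooth_at_comp; last exact: in_strip.
  by apply: smooth_at_row2; [exact: smooth_at_cst|exact: smooth_at_id].
exact: continuous_comp (@sqrt_continuous R t) c1.
Qed.

Let is_derive_sqrt_comp f a (z : R) : even_class f -> `|a| < r -> 0 < z ->
  is_derive z 1 (fun t => f (row2 a (Num.sqrt t))) (half_derive f (row2 a (Num.sqrt z))).
Proof.
move=> cf ar z0.
have d1 := (is_derive_row1 _ _ _ _).1 (smooth_is_derive (e_ 1) (in_strip cf (Num.sqrt z) ar)).
have d2 := is_derive1_comp d1 (is_derive1_sqrt z0).
apply: (is_derive_eq d2); rewrite half_deriveE// [LHS]mulrC; field.
by rewrite gt_eqF ?sqrtr_gt0.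
Qed.

Let taylor_z f d : even_class f -> d < r -> exists2 M, 0 <= M & forall a z z' : R,
  `|a| <= d -> 0 <= z -> 0 <= z' ->
  `|f (row2 a (Num.sqrt z')) - f (row2 a (Num.sqrt z)) -
    (z' - z) * half_derive f (row2 a (Num.sqrt z))| <= M * (z' - z) ^+ 2.
Proof.
move=> cf dr; have ch := even_class_half cf; have chh := even_class_half ch.
have [M M0 hM] := even_class_bounded chh dr; exists M => // a z z' ad z0 z'0.
have ar := le_lt_trans ad dr.
apply: (taylor_quadratic (g := fun t => f (row2 a (Num.sqrt t)))
  (g' := fun t => half_derive f (row2 a (Num.sqrt t)))
  (g'' := fun t => half_derive (half_derive f) (row2 a (Num.sqrt t)))).
- exact: continuous_sqrt_comp.
- exact: continuous_sqrt_comp.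
- by move=> t /andP[+ _] => /(le_lt_trans _) t0; apply: is_derive_sqrt_comp => //; apply: t0; rewrite le_min z0.
- by move=> t /andP[+ _] => /(le_lt_trans _) t0; apply: is_derive_sqrt_comp => //; apply: t0; rewrite le_min z0.
- by move=> t _; exact: hM.
Qed.

Let taylor_x f d : even_class f -> d < r -> exists2 M, 0 <= M & forall a a' b : R,
  `|a| <= d -> `|a'| <= d ->
  `|f (row2 a' b) - f (row2 a b) - (a' - a) * 'D_(e_ 0) f (row2 a b)| <= M * (a' - a) ^+ 2.
Proof.
move=> cf dr; have ch := even_class_derive0 cf; have chh := even_class_derive0 ch.
have [M M0 hM] := even_class_bounded chh dr; exists M => // a a' b ad a'd.
have bt t : Num.min a a' <= t <= Num.max a a' -> `|t| <= d.
  move: ad a'd; rewrite !ler_norml => /andP[h1 h2] /andP[h3 h4] /andP[h5 h6].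
  apply/andP; split; first by apply: le_trans h5; rewrite le_min h1.
  by rewrite (le_trans h6)// ge_max h2.
have d0 g (t : R) : even_class g -> `|t| <= d ->
    is_derive t 1 (fun t => g (row2 t b)) ('D_(e_ 0) g (row2 t b)).
  move=> cg td; apply/is_derive_row0; apply: smooth_is_derive; apply: in_strip => //.
  exact: le_lt_trans dr.
have cd g : even_class g -> {within `[Num.min a a', Num.max a a'], continuous (fun t => g (row2 t b))}.
  move=> cg; apply: derivable_within_continuous => t; rewrite in_itv/= => /bt td.
  by have [] := d0 g t cg td.
apply: (taylor_quadratic (g := fun t => f (row2 t b))
  (g' := fun t => 'D_(e_ 0) f (row2 t b)) (g'' := fun t => 'D_(e_ 0) ('D_(e_ 0) f) (row2 t b))).
- exact: (cd _ cf).
- exact: (cd _ ch).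
- by move=> t /andP[h1 h2]; apply: (d0 _ _ cf); apply: bt; rewrite !ltW.
- by move=> t /andP[h1 h2]; apply: (d0 _ _ ch); apply: bt; rewrite !ltW.
- by move=> t /bt; exact: hM.
Qed.

Lemma is_derive_quadratic_line (g : R -> R) (t d C e : R) : 0 < e ->
  (forall t', `|t' - t| <= e -> `|g t' - g t - (t' - t) * d| <= C * (t' - t) ^+ 2) ->
  is_derive t 1 g d.
Proof.
move=> e0 H; apply: (@is_derive_quadratic R R R g t 1 d C).
apply: filterS (near_norm (0 : R) e0) => h; rewrite subr0 => he.
have := H (h *: 1 + t); rewrite [h *: 1]mulr1 addrK; exact.
Qed.

Lemma even_extension_derive0 n f a z : even_class f -> `|a| < r ->
  is_derive (row2 a z) (e_ 0) (even_extension n f) (even_extension n ('D_(e_ 0) f) (row2 a z)).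
Proof.
move=> cf ar; apply/is_derive_row0.
have [d ad dr] : exists2 d, `|a| < d & d < r.
  by exists ((`|a| + r) / 2); have [] := midf_lt ar.
have [M M0 fM] := taylor_x cf dr.
have [B B0 fB] := even_class_bounded cf dr.
have [B' B'0 fB'] := even_class_bounded (even_class_derive0 cf) dr.
have e0 : 0 < d - `|a| by rewrite subr_gt0.
have near_a t : `|t - a| <= d - `|a| -> `|t| <= d.
  move=> ta; rewrite -(subrK a t) (le_trans (ler_normD _ _))//.
  by rewrite -lerBrDr.
have [z0|/ltW z0] := leP 0 z.
  apply: (@is_derive_quadratic_line _ _ _ M _ e0) => t /near_a td.
  by rewrite !even_extension_ge0//; apply: fM => //; exact: ltW.
have [C C0 CP] := tsum_increment n n n.
apply: (@is_derive_quadratic_line _ _ _ (C * M) _ e0) => t /near_a td.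
rewrite !even_extension_le0//.
rewrite -mulrA.
pose y k := Num.sqrt (- ext_node k * z).
apply: (CP (fun k => f (row2 a (y k))) (fun k => f (row2 t (y k)))
  (fun k => 'D_(e_ 0) f (row2 a (y k)))
  (fun k => f (row2 t (y k)) - f (row2 a (y k)) - (t - a) * 'D_(e_ 0) f (row2 a (y k)))
  (Num.max B B')) => k.
- by rewrite le_max fB// ltW.
- by rewrite le_max fB.
- by rewrite le_max fB' ?orbT// ltW.
- by apply: fM => //; exact: ltW.
- by ring.
Qed.

(** Both half-lines satisfy the same quadratic estimate with the same
    derivative at 0, so that the two sides need not be matched by limits. *)
Lemma even_extension_derive1 n f a z : even_class f -> `|a| < r ->
  is_derive (row2 a z) (e_ 1) (even_extension n f) (even_extension n.+1 (half_derive f) (row2 a z)).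
Proof.
move=> cf ar; apply/is_derive_row1.
have [d ad dr] : exists2 d, `|a| < d & d < r.
  by exists ((`|a| + r) / 2); have [] := midf_lt ar.
have [M M0 fM] := taylor_z cf dr.
have [B B0 fB] := even_class_bounded cf dr.
have [B' B'0 fB'] := even_class_bounded (even_class_half cf) dr.
have [C C0 CP] := tsum_increment n n.+1 n.+2.
have right_z t : 0 <= z -> 0 <= t ->
    `|even_extension n f (row2 a t) - even_extension n f (row2 a z) -
      (t - z) * even_extension n.+1 (half_derive f) (row2 a z)| <= (M + C * M) * (t - z) ^+ 2.
  move=> z0 t0; rewrite !even_extension_ge0// (le_trans (fM _ _ _ (ltW ad) z0 t0))//.
  by rewrite ler_wpM2r ?sqr_ge0// lerDl mulr_ge0.
have left_z t : z <= 0 -> t <= 0 ->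
    `|even_extension n f (row2 a t) - even_extension n f (row2 a z) -
      (t - z) * even_extension n.+1 (half_derive f) (row2 a z)| <= (M + C * M) * (t - z) ^+ 2.
  move=> z0 t0; rewrite !even_extension_le0// [(M + _) * _]mulrDl.
  apply: (@le_trans _ _ (C * M * (t - z) ^+ 2)); last by rewrite lerDr mulr_ge0 ?sqr_ge0.
  rewrite -mulrA.
  pose y (t : R) k := Num.sqrt (- ext_node k * t).
  have pos (u : R) k : u <= 0 -> 0 <= - ext_node k * u.
    by move=> u0; rewrite mulr_le0// oppr_le0 ltW// ext_node_gt0.
  have b0 k : ext_node k != 0 :> R by rewrite gt_eqF ?ext_node_gt0.
  (* The division by the square of the node turns weights of order n into
     weights of order n + 2, which are still summable. *)
  apply: (CP (fun k => f (row2 a (y z k))) (fun k => f (row2 a (y t k)))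
    (fun k => half_derive f (row2 a (y z k)))
    (fun k => (f (row2 a (y t k)) - f (row2 a (y z k)) -
       (- ext_node k * t - - ext_node k * z) * half_derive f (row2 a (y z k))) / ext_node k ^+ 2)
    (Num.max B B') (M * (t - z) ^+ 2) (t - z)) => k.
  - by rewrite le_max fB// ltW.
  - by rewrite le_max fB// ltW.
  - by rewrite le_max fB' ?orbT// ltW.
  - rewrite normrM normfV [X in _ / X]ger0_norm ?sqr_ge0//.
    rewrite ler_pdivrMr ?exprn_gt0 ?ext_node_gt0//.
    apply: (le_trans (fM _ _ _ (ltW ad) (pos z k z0) (pos t k t0))).
    by rewrite le_eqVlt; apply/orP; left; apply/eqP; ring.
  - rewrite !ext_weightS -/(y t k) -/(y z k).
    move: (f _) (f _) (half_derive _ _) (ext_weight n k) (b0 k) => F1 F2 H w; move: (ext_node k) => b b0'.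
    by field.
have [z0|z0|zE] := ltgtP z 0.
- have e0 : 0 < - z by rewrite oppr_gt0.
  apply: (@is_derive_quadratic_line _ _ _ (M + C * M) _ e0) => t.
  rewrite ler_norml opprK => /andP[_ tz]; apply: left_z; first exact: ltW.
  by move: tz; rewrite lerBlDr addNr.
- apply: (@is_derive_quadratic_line _ _ _ (M + C * M) _ z0) => t.
  rewrite ler_norml => /andP[tz _]; apply: right_z; first exact: ltW.
  by move: tz; rewrite lerBrDr addNr.
- apply: (@is_derive_quadratic_line _ _ _ (M + C * M) _ ltr01) => t _.
  have [t0|/ltW t0] := leP 0 t.
    by apply: right_z => //; rewrite zE.
  by apply: left_z => //; rewrite zE.
Qed.

Lemma smooth_even_extension f : even_class f ->
  smooth [set x : 'rV[R]_2 | `|x 0 0| < r] (even_extension 0 f).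
Proof.
move=> cf.
pose P F := exists n g, even_class g /\ F = even_extension n g.
apply: (@smooth_coinduction R P _ (open_coord_lt (i := 0) (c := r))); last by exists 0%N, f.
- move=> _ [n [g [cg ->]]].
  exists (even_extension n ('D_(e_ 0) g)), (even_extension n.+1 (half_derive g)); split.
  + by exists n, ('D_(e_ 0) g); exact: (conj (even_class_derive0 cg) erefl).
  + by exists n.+1, (half_derive g); exact: (conj (even_class_half cg) erefl).
  + move=> x /= xr; rewrite -(row2K x).
    by split; [exact: even_extension_derive0|exact: even_extension_derive1].
- move=> _ [n [g [cg ->]]] x /= xr.
  have [d xd dr] : exists2 d, `|x 0 0| < d & d < r.
    by exists ((`|x 0 0| + r) / 2); have [] := midf_lt xr.
  have [B B0 gB] := even_class_bounded cg dr.
  have [N N0 dN] := @ext_weight_dominated R n.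
  exists (B + N * B * 2).
  have : nbhs x (box d (`|x 0 1| + 1)).
    by apply: open_nbhs_nbhs; split; [exact: open_box|split=> //; rewrite ltrDl].
  apply: filterS => y [yd _]; rewrite -(row2K y).
  have [y0|/ltW y0] := leP 0 (y 0 1).
    by rewrite even_extension_ge0// (le_trans (gB _ _ (ltW yd)))// lerDl !mulr_ge0.
  rewrite even_extension_le0//; apply: (@le_trans _ _ (N * B * 2)); last by rewrite lerDr.
  by apply: tsum_le; apply: dN => k; apply: gB; exact: ltW.
Qed.

End EvenExtension.

(** * Whitney's theorem on even functions *)

Section WhitneyEven.
Context {R : realType}.

Lemma near_box (P : 'rV[R]_2 -> Prop) : (\forall x \near (0 : 'rV[R]_2), P x) ->
  exists2 r, 0 < r & forall x, box r r x -> P x.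
Proof.
move=> /near_closed_ball[r r0 rP]; exists r => // x [x0 x1]; apply: rP.
by rewrite subr0 le_norm_row2 !ltW.
Qed.

Lemma box_near r : 0 < r -> \forall x \near (0 : 'rV[R]_2), box r r x.
Proof.
move=> r0; apply: open_nbhs_nbhs; split; first exact: open_box.
by split; rewrite mxE normr0.
Qed.

(** The function f is multiplied by a cutoff in y^2, continued, and divided
    by the same cutoff, which is a positive function of z near 0. *)
Lemma whitney_even (f : 'rV[R]_2 -> R) : smooth_at 0 f ->
  (\forall x \near (0 : 'rV[R]_2), f (row2 ((x : 'rV[R]_2) 0 0) (- x 0 1)) = f x) ->
  exists A, smooth_at 0 A /\
    \forall x \near (0 : 'rV[R]_2), f x = A (row2 ((x : 'rV[R]_2) 0 0) (x 0 1 ^+ 2)).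
Proof.
move=> sf ef; have [r r0 rP] := near_box (filterI (smooth_at_near sf) ef).
(* The cutoff vanishes for |y| >= r / 2, well inside the box where f is known
   to be smooth and even. *)
pose chi (x : 'rV[R]_2) := flat 0 (r ^+ 2 / 4 - x 0 1 ^+ 2).
pose h x := f x * chi x.
have r20 : 0 < r / 2 by rewrite divr_gt0.
have r24 : (r / 2) ^+ 2 = r ^+ 2 / 4 by rewrite expr_div_n; congr (_ / _); ring.
have chi0 (x : 'rV[R]_2) : r / 2 <= `|x 0 1| -> chi x = 0.
  move=> h1; apply: flat_le0; rewrite subr_le0 -r24.
  by rewrite -(real_normK (num_real (x 0 1))) lerXn2r ?nnegrE ?(ltW r20).
have schi x : smooth_at x chi.
  apply: (smooth_at_comp1 (g := flat 0)).
    apply: smooth_atB; first exact: smooth_at_cst.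
    by apply: smooth_atX; exact: smooth_at_coord.
  by apply: (smooth_smooth_at openT) => //; exact: smooth_flat.
have ch : even_class r (r / 2) h.
  split.
  - move=> x xr; have [xs|xs] := ltP `|x 0 1| r.
      by apply: smooth_atM => //; have [] := rP x (conj xr xs).
    have cx : {for x, continuous (fun y : 'rV[R]_2 => `|y 0 1|)}.
      have ci := smooth_at_continuous (smooth_at_coord x 1).
      exact: continuous_comp ci (@norm_continuous _ _ _).
    have xs' : r / 2 < `|x 0 1|.
      by rewrite (lt_le_trans _ xs)// ltr_pdivrMr// ltr_pMr// ltr1n.
    have n0 := near_comp (P := fun z : R => r / 2 < z) cx (lt_nbhsr xs').
    apply: smooth_at_eq (smooth_at_cst x 0).
    by apply: filterS n0 => y yr; rewrite /h chi0 ?mulr0// ltW.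
  - move=> a b ar; have [br|br] := ltP `|b| r.
      have [_ E] := rP (row2 a b) (conj (etrans (congr1 (fun t => `|t| < r) (row2_0 a b)) ar)
        (etrans (congr1 (fun t => `|t| < r) (row2_1 a b)) br)).
      by move: E; rewrite /h /chi !row2_0 !row2_1 sqrrN => ->.
    have h2 : r / 2 <= `|b| by rewrite (le_trans _ br)// ler_pdivrMr// ler_pMr// ler1n.
    by rewrite /h !chi0 ?mulr0// row2_1 ?normrN.
  - by move=> a b ar br; rewrite /h chi0 ?mulr0// row2_1 ltW.
pose A x := even_extension 0 h x * (flat 0 (r ^+ 2 / 4 - (x : 'rV[R]_2) 0 1))^-1.
exists A; split.
  apply: smooth_atM.
    apply: (smooth_smooth_at (open_coord_lt (i := 0) (c := r)) _ (smooth_even_extension (ltW r20) ch)).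
    by rewrite /= mxE normr0.
  apply: smooth_atV.
    by rewrite mxE subr0 gt_eqF// flat_gt0// divr_gt0// exprn_gt0.
  apply: (smooth_at_comp1 (g := flat 0)).
    by apply: smooth_atB; [exact: smooth_at_cst|exact: smooth_at_coord].
  by apply: (smooth_smooth_at openT) => //; exact: smooth_flat.
apply: filterS (box_near r20) => x [x0 x1].
have hr : r / 2 < r by rewrite ltr_pdivrMr// ltr_pMr// ltr1n.
have cx : 0 < chi x.
  apply: flat_gt0; rewrite subr_gt0 -r24 -(real_normK (num_real (x 0 1))).
  by rewrite ltr_pXn2r// nnegrE ltW.
rewrite /A even_extension_ge0 ?sqr_ge0// row2_1 -/(chi x) sqrtr_sqr.
have -> : h (row2 (x 0 0) `|x 0 1|) = h x.
  have [_ eh _] := ch; have [x10|x10] := leP 0 (x 0 1).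
    by rewrite ger0_norm// row2K.
  by rewrite ltr0_norm// eh ?row2K// (lt_trans x0).
by rewrite /h mulfK// gt_eqF.
Qed.

(** The even part is covered by [whitney_even]; the odd part is y times its
    Hadamard quotient, which is even. *)
Lemma whitney_decomposition (f : 'rV[R]_2 -> R) : smooth_at 0 f ->
  exists A B, [/\ smooth_at 0 A, smooth_at 0 B &
    \forall x \near (0 : 'rV[R]_2), f x = A (row2 ((x : 'rV[R]_2) 0 0) (x 0 1 ^+ 2)) +
       x 0 1 * B (row2 (x 0 0) (x 0 1 ^+ 2))].
Proof.
move=> sf; have [r r0 rP] := near_box (smooth_at_near sf).
pose s (x : 'rV[R]_2) := row2 (x 0 0) (- x 0 1).
have ss x : smooth_at x s.
  by apply: smooth_at_row2; [|apply: smooth_atN]; exact: smooth_at_coord.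
have sK x : s (s x) = x by apply: eq_row2; rewrite /s ?row2_0 ?row2_1 ?opprK.
have sbox x : box r r x -> box r r (s x).
  by move=> [x0 x1]; split; rewrite /s ?row2_0 ?row2_1 ?normrN.
have sfs x : box r r x -> smooth_at x (fun y => f (s y)).
  by move=> bx; apply: smooth_at_comp => //; apply: rP; exact: sbox.
pose fe x := 2^-1 * (f x + f (s x)).
pose fo x := 2^-1 * (f x - f (s x)).
have sfe x : box r r x -> smooth_at x fe.
  move=> bx; apply: smooth_atM; first exact: smooth_at_cst.
  by apply: smooth_atD; [exact: rP|exact: sfs].
have sfo x : box r r x -> smooth_at x fo.
  move=> bx; apply: smooth_atM; first exact: smooth_at_cst.
  by apply: smooth_atB; [exact: rP|exact: sfs].
have b0 : box r r 0 by split; rewrite mxE normr0.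
have [|A [sA EA]] := whitney_even (sfe 0 b0).
  apply: filterE => x; rewrite -/(s x) /fe sK addrC.
  by [].
have sD x : box r r x -> smooth_at x ('D_(e_ 1) fo) by move=> /sfo; exact: smooth_at_derive.
pose h := moment_integral 0 ('D_(e_ 1) fo).
have sh : smooth (box r r) h by apply: smooth_moment.
have sh0 : smooth_at 0 h by apply: (smooth_smooth_at _ b0 sh); exact: open_box.
have fos x : fo (s x) = - fo x by rewrite /fo sK -mulrN opprB.
have [|B [sB EB]] := whitney_even sh0.
  apply: filterS (box_near r0) => x bx.
  have bt (t : R) : `[0, 1]%classic t -> box r r (row2 (x 0 0) (t * x 0 1)).
    have [x0 x1] := bx; rewrite /= in_itv/= => /andP[t0 t1].
    split; rewrite ?row2_0 ?row2_1//.
    by rewrite normrM (ger0_norm t0) (le_lt_trans _ x1)// ler_piMl.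
  rewrite /h /moment_integral row2_0 row2_1; apply: eq_Rintegral => t.
  rewrite inE => t01; congr (_ * _); rewrite mulrN.
  have bxt := bt t t01; set a := x 0 0 in bxt *; set b := t * x 0 1 in bxt *.
  have sE c : row2 a (- c) = s (row2 a c) by rewrite /s row2_0 row2_1.
  have := @derive_parity _ fo (-1) a b; rewrite !mulN1r => H; apply: oppr_inj; apply: H.
  - by rewrite sE; apply: sfo; exact: sbox.
  - by apply/nbhs_ballP; exists 1 => //= c _; rewrite sE fos mulN1r.
  - exact: sfo.
exists A, B; split=> //.
apply: filterS3 EA EB (box_near r0) => x EA EB bx.
have Ef : f x = fe x + fo x by rewrite /fe /fo; field.
have fo0 : fo (row2 (x 0 0) 0) = 0.
  have : fo (s (row2 (x 0 0) 0)) = - fo (row2 (x 0 0) 0) := fos _.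
  rewrite /s row2_0 row2_1 oppr0 => /eqP.
  by rewrite -addr_eq0 -mulr2n mulrn_eq0 /= => /eqP.
rewrite Ef EA; congr (_ + _).
have := @hadamard _ r r fo (x 0 0) (x 0 1) sfo; rewrite row2K => /(_ bx) ->.
by rewrite fo0 add0r -/(h x) EB.
Qed.

End WhitneyEven.

(** * Germs of diffeomorphisms *)

Section DiffeoGerms.
Context {R : realType}.

Lemma near_open (V : normedModType R) (x : V) (P : V -> Prop) : (\forall y \near x, P y) ->
  exists B, [/\ open B, B x & forall y, B y -> P y].
Proof.
move=> nP; have : nbhs x P by exact: nP.
by rewrite nbhsE => -[B [oB Bx] BP]; exists B.
Qed.

(** Conditions at points near p, rather than on chosen domains: the domains
    of [diffeo_germ] are recovered by shrinking. *)
Definition inverse_germ n (phi psi : 'rV[R]_n -> 'rV[R]_n) (p : 'rV[R]_n) : Prop :=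
  [/\ smooth_at p phi, smooth_at (phi p) psi,
    \forall x \near p, psi (phi x) = x & \forall y \near phi p, phi (psi y) = y].

Lemma inverse_diffeo_germ n (phi psi : 'rV[R]_n -> 'rV[R]_n) p :
  inverse_germ phi psi p -> diffeo_germ phi p.
Proof.
move=> [sphi spsi nl nr].
have [U0 [oU0 U0p U0P]] := near_open (filterI (smooth_at_near sphi) nl).
have [V0 [oV0 V0p V0P]] := near_open (filterI (smooth_at_near spsi) nr).
have psip : psi (phi p) = p := (U0P p U0p).2.
pose U := U0 `&` phi @^-1` V0.
have oU : open U.
  by apply: open_preimageI => // x /U0P[/smooth_at_continuous].
have Up : U p by [].
pose U' := V0 `&` psi @^-1` U.
have oU' : open U'.
  by apply: open_preimageI => // x /V0P[/smooth_at_continuous].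
exists U, U', psi; split => //.
- split.
  + by apply: smooth_at_smooth => x [/U0P[]].
  + by apply: smooth_at_smooth => x [/V0P[]].
  + by move=> _ [x [U0x V0x] <-]; split=> //=; rewrite (U0P x U0x).2.
  + by move=> _ [y [V0y Uy] <-].
- by move=> x [/U0P[]].
- by move=> y [/V0P[]].
Qed.

Lemma diffeo_germ_inverse n (phi : 'rV[R]_n -> 'rV[R]_n) p :
  diffeo_germ phi p -> exists psi, inverse_germ phi psi p.
Proof.
move=> [U [U' [psi [[oU oU' Up] [sphi spsi phiU psiU'] l r]]]].
have U'p : U' (phi p) by apply: phiU; exists p.
exists psi; split.
- exact: smooth_smooth_at sphi.
- exact: smooth_smooth_at spsi.
- by apply: filterS (open_nbhs_nbhs (conj oU Up)) => x /l.
- by apply: filterS (open_nbhs_nbhs (conj oU' U'p)) => x /r.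
Qed.

Lemma inverse_germ_value n (phi psi : 'rV[R]_n -> 'rV[R]_n) p :
  inverse_germ phi psi p -> psi (phi p) = p.
Proof. by move=> [_ _ nl _]; exact: nbhs_singleton nl. Qed.

Lemma inverse_germ_comp n (phi psi phi' psi' : 'rV[R]_n -> 'rV[R]_n) p :
  inverse_germ phi psi p -> inverse_germ phi' psi' (phi p) ->
  inverse_germ (fun x => phi' (phi x)) (fun y => psi (psi' y)) p.
Proof.
move=> g1 g2; have p1 := inverse_germ_value g1; have p2 := inverse_germ_value g2.
have [s1 t1 l1 r1] := g1; have [s2 t2 l2 r2] := g2; split.
- exact: smooth_at_comprV.
- by apply: smooth_at_comprV => //; rewrite p2.
- have := near_comp (smooth_at_continuous s1) l2.
  by apply: filterS2 l1 => x l1x ->.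
- have r1' : \forall y \near psi' (phi' (phi p)), phi (psi y) = y by rewrite p2.
  have := near_comp (smooth_at_continuous t2) r1'.
  by apply: filterS2 r2 => x r2x ->.
Qed.

End DiffeoGerms.

(** * The second-order jet under coordinate changes *)

Section ChainRules.
Context {R : realType}.

Lemma chain_rule (V : normedModType R) n (f : V -> 'rV[R]_n) (g : 'rV[R]_n -> R) x h :
  differentiable f x -> differentiable g (f x) ->
  'D_h (fun y => g (f y)) x =
    \sum_i 'D_h (fun y => f y 0 i) x * 'D_(delta_mx 0 i) g (f x).
Proof.
move=> df dg; rewrite [LHS]deriveE; last exact: differentiable_comp.
rewrite (diff_comp df dg)/= -(deriveE _ df).
rewrite [in LHS](row_sum_delta ('D_h f x)) linear_sum; apply: eq_bigr => i _.
rewrite linearZ /= -(deriveE _ dg); congr (_ * _).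
have /derive_mx -> : derivable f x h by exact: diff_derivable.
by rewrite mxE.
Qed.

Lemma chain_rule2 (V : normedModType R) (X Y : V -> R) (g : 'rV[R]_2 -> R) x h :
  smooth_at x X -> smooth_at x Y -> smooth_at (row2 (X x) (Y x)) g ->
  'D_h (fun y => g (row2 (X y) (Y y))) x =
    'D_h X x * 'D_(e_ 0) g (row2 (X x) (Y x)) + 'D_h Y x * 'D_(e_ 1) g (row2 (X x) (Y x)).
Proof.
move=> sX sY sg.
rewrite (@chain_rule _ _ (fun y => row2 (X y) (Y y))); last 2 first.
- by apply: smooth_at_differentiable; exact: smooth_at_row2.
- exact: smooth_at_differentiable.
rewrite big_ord_recl big_ord1.
have E0 : (fun y => row2 (X y) (Y y) 0 ord0) = X by apply/funext => y; exact: row2_0.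
have E1 : (fun y => row2 (X y) (Y y) 0 (lift ord0 ord0)) = Y.
  by apply/funext => y; rewrite mxE.
rewrite E0 E1; have -> : lift ord0 (ord0 : 'I_1) = 1 by exact/val_inj.
by [].
Qed.

Lemma derive_addf (V : normedModType R) (f g : V -> R) x h :
  smooth_at x f -> smooth_at x g -> 'D_h (fun y => f y + g y) x = 'D_h f x + 'D_h g x.
Proof. by move=> sf sg; apply: deriveD; exact: smooth_at_derivable. Qed.

Lemma derive_mulf (V : normedModType R) (f g : V -> R) x h :
  smooth_at x f -> smooth_at x g ->
  'D_h (fun y => f y * g y) x = f x * 'D_h g x + g x * 'D_h f x.
Proof. by move=> sf sg; apply: deriveM; exact: smooth_at_derivable. Qed.

Lemma derive_sumf (V : normedModType R) n (f : 'I_n -> V -> R) x h :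
  (forall i, smooth_at x (f i)) -> 'D_h (fun y => \sum_i f i y) x = \sum_i 'D_h (f i) x.
Proof.
move=> sf; rewrite -derive_sum => [|i]; last exact: smooth_at_derivable.
by congr ('D_h _ x); apply/funext => y; rewrite fct_sumE.
Qed.

(** If the kernel direction [e_ 0] of the composite is sent to the kernel
    direction [e_ 1] of g, the second derivatives of Y and g_xx drop out. *)
Lemma second_order_chain (X Y g : 'rV[R]_2 -> R) (p : 'rV[R]_2) h :
  smooth_at p X -> smooth_at p Y -> smooth_at (row2 (X p) (Y p)) g ->
  'D_(e_ 0) X p = 0 -> 'D_(e_ 1) g (row2 (X p) (Y p)) = 0 ->
  'D_h ('D_(e_ 0) (fun y => g (row2 (X y) (Y y)))) p =
    ('D_h X p * 'D_(e_ 0) ('D_(e_ 1) g) (row2 (X p) (Y p)) +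
     'D_h Y p * 'D_(e_ 1) ('D_(e_ 1) g) (row2 (X p) (Y p))) * 'D_(e_ 0) Y p +
    'D_(e_ 0) g (row2 (X p) (Y p)) * 'D_h ('D_(e_ 0) X) p.
Proof.
move=> sX sY sg X0 g1; set q := row2 (X p) (Y p) in sg g1 *.
have sXY : smooth_at p (fun y => row2 (X y) (Y y)) by exact: smooth_at_row2.
have ng : \forall y \near p, smooth_at (row2 (X y) (Y y)) g.
  exact: (near_comp (smooth_at_continuous sXY) (smooth_at_near sg)).
have E : \forall y \near p, 'D_(e_ 0) (fun y => g (row2 (X y) (Y y))) y =
    'D_(e_ 0) X y * 'D_(e_ 0) g (row2 (X y) (Y y)) + 'D_(e_ 0) Y y * 'D_(e_ 1) g (row2 (X y) (Y y)).
  by apply: filterS3 (smooth_at_near sX) (smooth_at_near sY) ng => y; exact: chain_rule2.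
have sgi i : smooth_at p (fun y => 'D_(e_ i) g (row2 (X y) (Y y))).
  by apply: (smooth_at_comp (g := 'D_(e_ i) g) sXY); exact: smooth_at_derive.
have sX0 := smooth_at_derive (e_ 0) sX; have sY0 := smooth_at_derive (e_ 0) sY.
rewrite (near_eq_derive _ E) (derive_addf _ (smooth_atM sX0 (sgi 0)) (smooth_atM sY0 (sgi 1))).
rewrite (derive_mulf _ sX0 (sgi 0)) (derive_mulf _ sY0 (sgi 1)) X0 g1.
rewrite (chain_rule2 h sX sY (smooth_at_derive (e_ 1) sg)) -/q.
move: ('D_h (fun y => 'D_(e_ 0) g (row2 (X y) (Y y))) p) => z.
move: ('D_h X p) ('D_h Y p) ('D_(e_ 0) Y p) ('D_h ('D_(e_ 0) X) p) ('D_h ('D_(e_ 0) Y) p).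
move: ('D_(e_ 0) g q) ('D_(e_ 0) ('D_(e_ 1) g) q) ('D_(e_ 1) ('D_(e_ 1) g) q) => u v w a b c d e.
by ring.
Qed.

End ChainRules.

Section CrossCapMatrix.
Context {R : realType}.

Definition second_jet (f : 'rV[R]_2 -> R) (p : 'rV[R]_2) (i : 'I_3) : R :=
  [:: 'D_(e_ 1) f p; 'D_(e_ 1) ('D_(e_ 0) f) p; 'D_(e_ 0) ('D_(e_ 0) f) p]`_i.

(** For F (t, lambda) with F_t = 0 at p, the rows are F_lambda,
    F_{t lambda} and F_tt. *)
Definition cross_cap_mx (F : 'rV[R]_2 -> 'rV[R]_3) (p : 'rV[R]_2) : 'M[R]_3 :=
  \matrix_(i, j) second_jet (fun x => F x 0 j) p i.

Lemma near_eq_second_jet (f g : 'rV[R]_2 -> R) p i :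
  (\forall x \near p, f x = g x) -> second_jet f p i = second_jet g p i.
Proof.
move=> fg; have fg0 : \forall x \near p, 'D_(e_ 0) f x = 'D_(e_ 0) g x.
  have [B [oB Bp BP]] := near_open fg.
  apply: filterS (open_nbhs_nbhs (conj oB Bp)) => x Bx.
  apply: near_eq_derive; apply: filterS (open_nbhs_nbhs (conj oB Bx)) => y; exact: BP.
by rewrite /second_jet (near_eq_derive _ fg) !(near_eq_derive _ fg0).
Qed.

Lemma ord3_cases (i : 'I_3) : [\/ i = 0, i = 1 | i = 2].
Proof.
by case: i => -[|[|[|//]]] Hi; [constructor 1|constructor 2|constructor 3]; exact/val_inj.
Qed.

Section TargetChange.
Variables (F : 'rV[R]_2 -> 'rV[R]_3) (Phi : 'rV[R]_3 -> R) (p : 'rV[R]_2).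
Hypotheses (sF : smooth_at p F) (sPhi : smooth_at (F p) Phi).
Hypothesis F0 : forall j, 'D_(e_ 0) (fun x => F x 0 j) p = 0.

Lemma target_kernel : 'D_(e_ 0) (fun x => Phi (F x)) p = 0.
Proof.
rewrite chain_rule; try exact: smooth_at_differentiable.
by apply: big1 => j _; rewrite F0 mul0r.
Qed.

Let second_derive (h : 'rV[R]_2) : 'D_h ('D_(e_ 0) (fun x => Phi (F x))) p =
  \sum_j 'D_h ('D_(e_ 0) (fun x => F x 0 j)) p * 'D_(delta_mx 0 j) Phi (F p).
Proof.
have nP : \forall x \near p, smooth_at (F x) Phi.
  exact: (near_comp (smooth_at_continuous sF) (smooth_at_near sPhi)).
have E : \forall x \near p, 'D_(e_ 0) (fun x => Phi (F x)) x =
    \sum_j 'D_(e_ 0) (fun x => F x 0 j) x * 'D_(delta_mx 0 j) Phi (F x).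
  by apply: filterS2 (smooth_at_near sF) nP => x sFx sPx;
    apply: chain_rule; exact: smooth_at_differentiable.
have sFj j : smooth_at p (fun x => F x 0 j) by exact: smooth_at_coordf.
have sDF j : smooth_at p ('D_(e_ 0) (fun x => F x 0 j)) by exact: smooth_at_derive.
have sDP j : smooth_at p (fun x => 'D_(delta_mx 0 j) Phi (F x)).
  by apply: (smooth_at_comp (g := 'D_(delta_mx 0 j) Phi) sF); exact: smooth_at_derive.
rewrite (near_eq_derive _ E) derive_sumf => [|j]; last exact: smooth_atM.
apply: eq_bigr => j _; rewrite (derive_mulf _ (sDF j) (sDP j)) F0 mul0r add0r.
exact: mulrC.
Qed.

(** The second derivatives of Phi are multiplied by the first derivatives
    of F along [e_ 0], which vanish. *)
Lemma target_second_jet i : second_jet (fun x => Phi (F x)) p i =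
  \sum_j second_jet (fun x => F x 0 j) p i * 'D_(delta_mx 0 j) Phi (F p).
Proof.
case: (ord3_cases i) => ->; rewrite /second_jet /=; try exact: second_derive.
by apply: chain_rule; exact: smooth_at_differentiable.
Qed.

End TargetChange.

Lemma derive_coord n (x h : 'rV[R]_n) i : 'D_h (fun y : 'rV[R]_n => y 0 i) x = h 0 i.
Proof.
have cL : continuous (coordL i : 'rV[R]_n -> R) by move=> y; exact: coord_continuous.
rewrite -[fun y => _]/(coordL i : 'rV[R]_n -> R) deriveE; first by rewrite diff_lin.
exact: linear_differentiable.
Qed.

Lemma det3 (M : 'M[R]_3) : \det M =
  M 0 0 * (M 1 1 * M 2 2 - M 1 2 * M 2 1) - M 0 1 * (M 1 0 * M 2 2 - M 1 2 * M 2 0) +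
  M 0 2 * (M 1 0 * M 2 1 - M 1 1 * M 2 0).
Proof.
pose f a b := M (inord a) (inord b).
have Mf i j : M i j = f i j by rewrite /f !inord_val.
rewrite (expand_det_row _ 0) !big_ord_recl big_ord0 /cofactor.
rewrite !(expand_det_row _ 0) !big_ord_recl !big_ord0 /cofactor !det_mx11 !mxE !Mf.
rewrite /= /bump /= !add0n !expr0 !expr1; ring.
Qed.

Lemma inverse_germ_derive (phi psi : 'rV[R]_2 -> 'rV[R]_2) (p h : 'rV[R]_2) i : inverse_germ phi psi p ->
  h 0 i = 'D_h (fun x => phi x 0 0) p * 'D_(e_ 0) (fun y => psi y 0 i) (phi p) +
          'D_h (fun x => phi x 0 1) p * 'D_(e_ 1) (fun y => psi y 0 i) (phi p).
Proof.
move=> [sphi spsi l _].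
have sX := smooth_at_coordf 0 sphi; have sY := smooth_at_coordf 1 sphi.
have spsii := smooth_at_coordf i spsi.
have E : \forall x \near p, psi (row2 (phi x 0 0) (phi x 0 1)) 0 i = (x : 'rV[R]_2) 0 i.
  by apply: filterS l => x; rewrite row2K => ->.
rewrite -(derive_coord p h i) -(near_eq_derive h E).
by rewrite (@chain_rule2 _ _ _ _ (fun y => psi y 0 i))// row2K.
Qed.

(** Three of the relations between the Jacobian matrices of phi and psi; an
    entry equal to 0 would contradict one of them. *)
Lemma inverse_germ_nondegenerate (phi psi : 'rV[R]_2 -> 'rV[R]_2) p : inverse_germ phi psi p ->
  'D_(e_ 0) (fun x => phi x 0 0) p = 0 ->
  'D_(e_ 1) (fun x => phi x 0 0) p != 0 /\ 'D_(e_ 0) (fun x => phi x 0 1) p != 0.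
Proof.
move=> ig X0.
have e00 := inverse_germ_derive (e_ 0) 0 ig.
have e10 := inverse_germ_derive (e_ 1) 0 ig.
have e11 := inverse_germ_derive (e_ 1) 1 ig.
move: e00 e10 e11; rewrite X0 !mxE /= mul0r add0r.
move: ('D_(e_ 1) (fun x => phi x 0 0) p) ('D_(e_ 0) (fun x => phi x 0 1) p) => X1 Y0.
move: ('D_(e_ 1) (fun x => phi x 0 1) p) ('D_(e_ 0) (fun y => psi y 0 0) (phi p)) => Y1 a.
move: ('D_(e_ 1) (fun y => psi y 0 0) (phi p)) ('D_(e_ 0) (fun y => psi y 0 1) (phi p)) => b c.
move: ('D_(e_ 1) (fun y => psi y 0 1) (phi p)) => d h1 h2 h3; split; apply/eqP => E.
  move: h2 h3; rewrite E !mul0r !add0r => h2 h3.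
  have : Y0 * b * (Y1 * d) = (Y1 * b) * (Y0 * d) by ring.
  by rewrite -h1 -h2 -h3 mul0r mulr1 => /eqP; rewrite oner_eq0.
by move: h1; rewrite E mul0r => /eqP; rewrite oner_eq0.
Qed.

End CrossCapMatrix.

Section SourceChange.
Context {R : realType}.
Variables (X Y g : 'rV[R]_2 -> R) (p : 'rV[R]_2).
Hypotheses (sX : smooth_at p X) (sY : smooth_at p Y) (sg : smooth_at (row2 (X p) (Y p)) g).
Hypothesis X0 : 'D_(e_ 0) X p = 0.

Let q := row2 (X p) (Y p).

Lemma source_kernel : 'D_(e_ 0) (fun x => g (row2 (X x) (Y x))) p =
  'D_(e_ 0) Y p * 'D_(e_ 1) g q.
Proof. by rewrite (chain_rule2 _ sX sY sg) X0 mul0r add0r. Qed.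

Hypothesis g1 : 'D_(e_ 1) g q = 0.

(** The vector (g_x, g_xy, g_yy) at q is transformed by a triangular matrix
    with diagonal X_lambda, X_lambda Y_t, Y_t^2, the same for every g. *)
Lemma source_second_jet :
  [/\ second_jet (fun x => g (row2 (X x) (Y x))) p 0 = 'D_(e_ 1) X p * 'D_(e_ 0) g q,
      second_jet (fun x => g (row2 (X x) (Y x))) p 1 =
        ('D_(e_ 1) X p * 'D_(e_ 0) ('D_(e_ 1) g) q + 'D_(e_ 1) Y p * 'D_(e_ 1) ('D_(e_ 1) g) q) *
          'D_(e_ 0) Y p + 'D_(e_ 0) g q * second_jet X p 1 &
      second_jet (fun x => g (row2 (X x) (Y x))) p 2 =
        'D_(e_ 1) ('D_(e_ 1) g) q * 'D_(e_ 0) Y p ^+ 2 + 'D_(e_ 0) g q * second_jet X p 2].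
Proof.
rewrite /second_jet /=; split.
- by rewrite (chain_rule2 _ sX sY sg) -/q g1 mulr0 addr0.
- exact: second_order_chain.
- rewrite (second_order_chain _ sX sY sg X0 g1) -/q X0 mul0r add0r.
  by rewrite expr2 mulrA [X in X * 'D_(e_ 0) Y p + _]mulrC.
Qed.

End SourceChange.

(** * Nondegeneracy of the jet of a cross cap *)

Section UmbrellaInvariant.
Context {R : realType}.

Lemma derive_coord_mul (x h : 'rV[R]_2) :
  'D_h (fun z : 'rV[R]_2 => z 0 0 * z 0 1) x = x 0 0 * h 0 1 + x 0 1 * h 0 0.
Proof.
by rewrite (derive_mulf _ (smooth_at_coord x 0) (smooth_at_coord x 1)) !derive_coord.
Qed.

Lemma derive_coord_sqr (x h : 'rV[R]_2) :
  'D_h (fun z : 'rV[R]_2 => z 0 1 ^+ 2) x = 2 * x 0 1 * h 0 1.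
Proof.
rewrite (derive_mulf _ (smooth_at_coord x 1) (smooth_at_coord x 1)) !derive_coord.
by rewrite mulrDl mul1r mulrDl.
Qed.

Lemma derive_coord_mul1 : 'D_(e_ 1) (fun z : 'rV[R]_2 => z 0 0 * z 0 1) = (fun z => z 0 0).
Proof. by apply/funext => z; rewrite derive_coord_mul !mxE /= mulr1 mulr0 addr0. Qed.

Lemma derive_coord_sqr1 : 'D_(e_ 1) (fun z : 'rV[R]_2 => z 0 1 ^+ 2) = (fun z => 2 * z 0 1).
Proof. by apply/funext => z; rewrite derive_coord_sqr !mxE /= mulr1. Qed.

Lemma derive_coordZ (c : R) (x h : 'rV[R]_2) i : 'D_h (fun z : 'rV[R]_2 => c * z 0 i) x = c * h 0 i.
Proof.
rewrite (derive_mulf _ (smooth_at_cst x c) (smooth_at_coord x i)) derive_coord derive_cst.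
by rewrite mulr0 addr0.
Qed.

(** The product of the matrix of F and the Jacobian matrix of Phi is the
    matrix of the umbrella composed with phi = (X, Y). Its determinant is
    2 X_lambda^2 Y_t^3. *)
Lemma A_equivalent_umbrella_det (F : 'rV[R]_2 -> 'rV[R]_3) p : smooth_at p F ->
  (forall j, 'D_(e_ 0) (fun x => F x 0 j) p = 0) ->
  A_equivalent F p whitney_umbrella 0 -> \det (cross_cap_mx F p) != 0.
Proof.
move=> sF F0 [phi [Phi [[dphi phip] [dPhi Phip] E]]].
have [psi ig] := diffeo_germ_inverse dphi.
have [Psi [sPhi _ _ _]] := diffeo_germ_inverse dPhi.
have [sphi _ _ _] := ig.
pose X (x : 'rV[R]_2) := phi x 0 0; pose Y (x : 'rV[R]_2) := phi x 0 1.
have sX : smooth_at p X by exact: smooth_at_coordf.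
have sY : smooth_at p Y by exact: smooth_at_coordf.
have sPj j : smooth_at (F p) (fun z => Phi z 0 j) by exact: smooth_at_coordf.
have Xp : X p = 0 by rewrite /X phip mxE.
have Yp : Y p = 0 by rewrite /Y phip mxE.
have E0 : \forall x \near p, Phi (F x) 0 0 = X x.
  by apply: filterS E => x ->; rewrite /whitney_umbrella mxE.
have E1 : \forall x \near p, Phi (F x) 0 1 = X x * Y x.
  by apply: filterS E => x ->; rewrite /whitney_umbrella mxE.
have E2 : \forall x \near p, Phi (F x) 0 2 = Y x ^+ 2.
  by apply: filterS E => x ->; rewrite /whitney_umbrella mxE.
have X0 : 'D_(e_ 0) X p = 0.
  by rewrite -(near_eq_derive _ E0) (target_kernel (Phi := fun z => Phi z 0 0)).
have [X1 Y0] := inverse_germ_nondegenerate ig X0.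
rewrite -/X in X1; rewrite -/Y in Y0.
pose J : 'M[R]_3 := \matrix_(j, k) 'D_(delta_mx 0 j) (fun z => Phi z 0 k) (F p).
have MJ i k : (cross_cap_mx F p *m J) i k = second_jet (fun x => Phi (F x) 0 k) p i.
  rewrite mxE (target_second_jet (Phi := fun z => Phi z 0 k) sF (sPj k) F0).
  by apply: eq_bigr => j _; rewrite !mxE.
have q0 : row2 (X p) (Y p) = 0 by apply: eq_row2; rewrite ?row2_0 ?row2_1 ?Xp ?Yp mxE.
pose gm (z : 'rV[R]_2) := z 0 0 * z 0 1; pose gs (z : 'rV[R]_2) := z 0 1 ^+ 2.
have sgm : smooth_at (row2 (X p) (Y p)) gm by apply: smooth_atM; exact: smooth_at_coord.
have sgs : smooth_at (row2 (X p) (Y p)) gs by apply: smooth_atX; exact: smooth_at_coord.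
have gm1 : 'D_(e_ 1) gm (row2 (X p) (Y p)) = 0.
  by rewrite /gm derive_coord_mul row2_0 Xp !mxE mulr0 mul0r addr0.
have gs1 : 'D_(e_ 1) gs (row2 (X p) (Y p)) = 0.
  by rewrite /gs derive_coord_sqr row2_1 Yp mulr0 mul0r.
have [m0 m1 m2] := source_second_jet sX sY sgm X0 gm1.
have [s0 s1 s2] := source_second_jet sX sY sgs X0 gs1.
have Em : (fun x => gm (row2 (X x) (Y x))) = (fun x => X x * Y x).
  by apply/funext => x; rewrite /gm row2_0 row2_1.
have Es : (fun x => gs (row2 (X x) (Y x))) = (fun x => Y x ^+ 2).
  by apply/funext => x; rewrite /gs row2_1.
rewrite Em in m0 m1 m2; rewrite Es in s0 s1 s2.
have d0m : 'D_(e_ 0) gm (row2 (X p) (Y p)) = 0.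
  by rewrite /gm derive_coord_mul row2_0 row2_1 Xp Yp !mul0r addr0.
have d0s : 'D_(e_ 0) gs (row2 (X p) (Y p)) = 0.
  by rewrite /gs derive_coord_sqr row2_1 Yp mulr0 mul0r.
have d01m : 'D_(e_ 0) ('D_(e_ 1) gm) (row2 (X p) (Y p)) = 1.
  by rewrite /gm derive_coord_mul1 derive_coord !mxE.
have d11m : 'D_(e_ 1) ('D_(e_ 1) gm) (row2 (X p) (Y p)) = 0.
  by rewrite /gm derive_coord_mul1 derive_coord !mxE.
have d01s : 'D_(e_ 0) ('D_(e_ 1) gs) (row2 (X p) (Y p)) = 0.
  by rewrite /gs derive_coord_sqr1 derive_coordZ !mxE /= mulr0.
have d11s : 'D_(e_ 1) ('D_(e_ 1) gs) (row2 (X p) (Y p)) = 2.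
  by rewrite /gs derive_coord_sqr1 derive_coordZ !mxE /= mulr1.
rewrite d0m d01m d11m in m0 m1 m2; rewrite d0s d01s d11s in s0 s1 s2.
suff : \det (cross_cap_mx F p *m J) != 0.
  by rewrite det_mulmx mulf_eq0 negb_or => /andP[].
have c0 i := near_eq_second_jet i E0.
have c1 i := near_eq_second_jet i E1.
have c2 i := near_eq_second_jet i E2.
rewrite det3 !MJ !c0 !c1 !c2 m0 m1 m2 s0 s1 s2 [second_jet X p 0]/second_jet /=.
move: (second_jet X p 1) (second_jet X p 2) => a b.
move: ('D_(e_ 1) X p) ('D_(e_ 0) Y p) ('D_(e_ 1) Y p) X1 Y0 => x1 y0 y1 x10 y00.
set D := (X in X != 0); have -> : D = 2 * (x1 * x1 * (y0 * y0 * y0)) by rewrite /D; ring.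
by rewrite !mulf_neq0.
Qed.

End UmbrellaInvariant.

(** * The Morse lemma with a parameter *)

Section ParametricMorse.
Context {R : realType}.

Lemma derive_mul_coord1 (u : 'rV[R]_2 -> R) x : smooth_at x u ->
  'D_(e_ 1) (fun y : 'rV[R]_2 => y 0 1 * u y) x = x 0 1 * 'D_(e_ 1) u x + u x.
Proof.
move=> su; rewrite (derive_mulf _ (smooth_at_coord x 1) su) derive_coord !mxE /=.
by rewrite mulr1.
Qed.

Lemma derive_shift1 (f : 'rV[R]_2 -> R) (c : R -> R) (x : 'rV[R]_2) :
  smooth_at (row2 (x 0 0) (x 0 1 + c (x 0 0))) f ->
  'D_(e_ 1) (fun y : 'rV[R]_2 => f (row2 (y 0 0) (y 0 1 + c (y 0 0)))) x =
  'D_(e_ 1) f (row2 (x 0 0) (x 0 1 + c (x 0 0))).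
Proof.
move=> sf; have d := smooth_is_derive (e_ 1) sf.
suff H : is_derive (row2 (x 0 0) (x 0 1)) (e_ 1)
    (fun y : 'rV[R]_2 => f (row2 (y 0 0) (y 0 1 + c (y 0 0))))
    ('D_(e_ 1) f (row2 (x 0 0) (x 0 1 + c (x 0 0)))).
  by rewrite row2K in H; exact: (derive_val (is_derive := H)).
apply/is_derive_row1; apply: (is_derive_line _ d) => s.
by rewrite e1E row2_0 row2_1 addrA.
Qed.

Lemma derive_fst (h : R -> R) (x : 'rV[R]_2) :
  'D_(e_ 1) (fun y : 'rV[R]_2 => h (y 0 0)) x = 0.
Proof.
have H : is_derive (row2 (x 0 0) (x 0 1)) (e_ 1) (fun y : 'rV[R]_2 => h (y 0 0)) 0.
  apply/is_derive_row1; have := is_derive_cst (h (x 0 0)) (x 0 1) 1.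
  by apply: near_eq_is_derive; apply/nbhs_ballP; exists 1 => //= t _; rewrite row2_0.
by rewrite row2K in H; exact: (derive_val (is_derive := H)).
Qed.

Lemma smooth_fst (h : R -> R) (x : 'rV[R]_2) : smooth_at (x 0 0) h ->
  smooth_at x (fun y : 'rV[R]_2 => h (y 0 0)).
Proof. by move=> sh; apply: (smooth_at_comp1 (smooth_at_coord x 0)). Qed.

(** Hadamard's lemma applied twice: the first quotient vanishes on the axis
    because its value there is the derivative of g. *)
Lemma hadamard2 (g : 'rV[R]_2 -> R) : smooth_at 0 g ->
  (\forall x \near (0 : 'rV[R]_2), g (row2 ((x : 'rV[R]_2) 0 0) 0) = 0 /\
      'D_(e_ 1) g (row2 (x 0 0) 0) = 0) ->
  exists q, smooth_at 0 q /\ \forall x \near (0 : 'rV[R]_2), g x = (x : 'rV[R]_2) 0 1 * (x 0 1 * q x).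
Proof.
move=> sg g0; have [r r0 rP] := near_box (filterI (smooth_at_near sg) g0).
have sbg x : box r r x -> smooth_at x g by move=> /rP[].
have b0 : box r r 0 by split; rewrite mxE normr0.
have sD x : box r r x -> smooth_at x ('D_(e_ 1) g) by move=> /sbg; exact: smooth_at_derive.
pose m1 := moment_integral 0 ('D_(e_ 1) g).
have sm1 x : box r r x -> smooth_at x m1.
  move=> bx; apply: (smooth_smooth_at _ bx); first exact: open_box.
  exact: smooth_moment.
have sDm x : box r r x -> smooth_at x ('D_(e_ 1) m1) by move=> /sm1; exact: smooth_at_derive.
pose m2 := moment_integral 0 ('D_(e_ 1) m1).
exists m2; split.
  apply: (smooth_smooth_at _ b0); first exact: open_box.
  exact: smooth_moment.
apply: filterS (box_near r0) => x bx; have [_ [gx dgx]] := rP x bx.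
have := @hadamard _ r r g (x 0 0) (x 0 1) sbg; rewrite row2K gx add0r => /(_ bx) ->.
rewrite -/m1; have := @hadamard _ r r m1 (x 0 0) (x 0 1) sm1; rewrite row2K => /(_ bx) ->.
rewrite -/m2; have -> : m1 (row2 (x 0 0) 0) = 0.
  rewrite /m1 /moment_integral (row2_0 (x 0 0) 0) (row2_1 (x 0 0) 0).
  have -> : (fun t : R => t ^+ 0 * 'D_(e_ 1) g (row2 (x 0 0) (t * 0))) = (fun=> 0).
    by apply/funext => t; rewrite mulr0 dgx mulr0.
  by rewrite Rintegral_cst// mul0r.
by rewrite add0r.
Qed.

(** Let sigma (a) be the critical point of Z (a, .). After the shift by
    sigma and the subtraction of the critical value h, the function vanishes
    to second order along the axis. Hence it is y^2 q with q > 0, and the new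
    coordinate is y sqrt q. *)
Lemma parametric_morse (Z : 'rV[R]_2 -> R) : smooth_at 0 Z ->
  'D_(e_ 1) Z 0 = 0 -> 0 < 'D_(e_ 1) ('D_(e_ 1) Z) 0 ->
  exists (h : R -> R) (eta : 'rV[R]_2 -> R),
    [/\ smooth_at 0 h, smooth_at 0 eta, eta 0 = 0, 'D_(e_ 1) eta 0 != 0 &
      \forall x \near (0 : 'rV[R]_2), Z x = h ((x : 'rV[R]_2) 0 0) + eta x ^+ 2].
Proof.
move=> sZ Z1 Z11.
have sDZ := smooth_at_derive (e_ 1) sZ.
have Z11' : 'D_(e_ 1) ('D_(e_ 1) Z) 0 != 0 by rewrite gt_eqF.
have [k [sk k0 _ kr]] := param_inverse sDZ Z11'.
have c00 (i : 'I_2) : (0 : 'rV[R]_2) 0 i = 0 by rewrite mxE.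
have r00 : row2 0 0 = 0 :> 'rV[R]_2 by apply: eq_row2; rewrite ?row2_0 ?row2_1 mxE.
rewrite Z1 !c00 r00 in sk k0 kr.
pose sigma (a : R) := k (row2 a 0).
have srow : smooth_at (0 : R) (fun a : R => row2 a 0).
  by apply: smooth_at_row2; [exact: smooth_at_id|exact: smooth_at_cst].
have ss : smooth_at 0 sigma by apply: (smooth_at_comp srow); rewrite r00.
have s0 : sigma 0 = 0 by rewrite /sigma r00.
have crit : \forall a \near (0 : R), 'D_(e_ 1) Z (row2 a (sigma a)) = 0.
  have kr' : \forall y \near row2 0 0, 'D_(e_ 1) Z (row2 ((y : 'rV[R]_2) 0 0) (k y)) = y 0 1 by rewrite r00.
  apply: filterS (near_comp (smooth_at_continuous srow) kr') => a.
  by rewrite row2_0 row2_1.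
pose h (a : R) := Z (row2 a (sigma a)).
have srs : smooth_at (0 : R) (fun a : R => row2 a (sigma a)).
  by apply: smooth_at_row2 => //; exact: smooth_at_id.
have sh : smooth_at 0 h by apply: (smooth_at_comp srs); rewrite s0 r00.
pose tau (x : 'rV[R]_2) := row2 (x 0 0) (x 0 1 + sigma (x 0 0)).
have sc0 (f : R -> R) : smooth_at 0 f -> smooth_at (0 : 'rV[R]_2) (fun x : 'rV[R]_2 => f (x 0 0)).
  by move=> sf; apply: (smooth_at_comp1 (smooth_at_coord 0 0)); rewrite mxE.
have stau : smooth_at 0 tau.
  apply: smooth_at_row2; first exact: smooth_at_coord.
  by apply: smooth_atD; [exact: smooth_at_coord|exact: sc0].
have tau0 : tau 0 = 0 by rewrite /tau !c00 s0 addr0.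
pose g x := Z (tau x) - h ((x : 'rV[R]_2) 0 0).
have sZt : smooth_at 0 (fun x => Z (tau x)) by apply: (smooth_at_comp stau); rewrite tau0.
have sg : smooth_at 0 g by apply: smooth_atB => //; exact: sc0.
have nZt : \forall x \near (0 : 'rV[R]_2), smooth_at (tau x) Z.
  apply: (near_comp (P := fun z => smooth_at z Z) (smooth_at_continuous stau)).
  by rewrite tau0; exact: smooth_at_near.
have nhs : \forall x \near (0 : 'rV[R]_2), smooth_at x (fun x : 'rV[R]_2 => h (x 0 0)).
  exact: smooth_at_near (sc0 _ sh).
have Dg : \forall x \near (0 : 'rV[R]_2), 'D_(e_ 1) g x = 'D_(e_ 1) Z (tau x).
  apply: filterS3 nZt nhs (smooth_at_near sZt) => x sx hx sZx.
  rewrite /g (derive_addf _ sZx (smooth_atN hx)).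
  have -> : 'D_(e_ 1) (fun y => Z (tau y)) x = 'D_(e_ 1) Z (tau x) := derive_shift1 (c := sigma) sx.
  have -> : 'D_(e_ 1) (fun y : 'rV[R]_2 => - h (y 0 0)) x = 0 := derive_fst (fun a => - h a) x.
  by rewrite addr0.
have D2g : 'D_(e_ 1) ('D_(e_ 1) g) 0 = 'D_(e_ 1) ('D_(e_ 1) Z) 0.
  have sDZt : smooth_at (tau 0) ('D_(e_ 1) Z) by rewrite tau0.
  by rewrite (near_eq_derive _ Dg) (derive_shift1 (c := sigma) sDZt : _ = 'D_(e_ 1) _ (tau 0)) tau0.
have proj_near (P : R -> Prop) : (\forall a \near (0 : R), P a) ->
    \forall x \near (0 : 'rV[R]_2), P ((x : 'rV[R]_2) 0 0).
  move=> nP; apply: (near_comp (P := P) (smooth_at_continuous (smooth_at_coord 0 0))).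
  by rewrite mxE.
have [|q [sq qE]] := hadamard2 sg.
  have nD0 : \forall x \near (0 : 'rV[R]_2), 'D_(e_ 1) g (row2 ((x : 'rV[R]_2) 0 0) 0) = 'D_(e_ 1) Z (tau (row2 (x 0 0) 0)).
    have sr : smooth_at (0 : 'rV[R]_2) (fun x : 'rV[R]_2 => row2 (x 0 0) 0).
      by apply: smooth_at_row2; [exact: smooth_at_coord|exact: smooth_at_cst].
    apply: (near_comp (P := fun z => 'D_(e_ 1) g z = 'D_(e_ 1) Z (tau z)) (smooth_at_continuous sr)).
    by rewrite mxE r00.
  apply: filterS2 nD0 (proj_near _ crit) => x -> cx.
  rewrite /g /tau !row2_0 row2_1 add0r; split; last exact: cx.
  by rewrite subrr.
have q0 : 0 < q 0.
  have sxq : smooth_at 0 (fun y : 'rV[R]_2 => y 0 1 * q y).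
    exact: (smooth_atM (smooth_at_coord 0 1) sq).
  have E1 : \forall x \near (0 : 'rV[R]_2), 'D_(e_ 1) g x =
      x 0 1 * 'D_(e_ 1) (fun y : 'rV[R]_2 => y 0 1 * q y) x + x 0 1 * q x.
    have [B [oB B0 BP]] := near_open (filterI qE (smooth_at_near sxq)).
    apply: filterS (open_nbhs_nbhs (conj oB B0)) => x Bx.
    have nx : \forall y \near x, g y = (y : 'rV[R]_2) 0 1 * (y 0 1 * q y).
      by apply: filterS (open_nbhs_nbhs (conj oB Bx)) => y /BP[].
    by rewrite (near_eq_derive _ nx); exact: derive_mul_coord1 (BP x Bx).2.
  have sDxq := smooth_at_derive (e_ 1) sxq.
  have E2 : 'D_(e_ 1) ('D_(e_ 1) g) 0 = 2 * q 0.
    rewrite (near_eq_derive _ E1) (derive_addf _ (smooth_atM (smooth_at_coord 0 1) sDxq) sxq).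
    rewrite (derive_mul_coord1 sDxq) (derive_mul_coord1 sq) c00.
    by move: ('D_(e_ 1) ('D_(e_ 1) _) 0) ('D_(e_ 1) q 0) (q 0) => u v w; ring.
  by move: Z11; rewrite -D2g E2 pmulr_rgt0.
pose eta0 (x : 'rV[R]_2) := x 0 1 * Num.sqrt (q x).
pose eta (x : 'rV[R]_2) := eta0 (row2 (x 0 0) (x 0 1 + - sigma (x 0 0))).
have seta0 : smooth_at 0 eta0.
  by apply: smooth_atM; [exact: smooth_at_coord|exact: smooth_at_sqrt].
pose tau' (x : 'rV[R]_2) := row2 (x 0 0) (x 0 1 + - sigma (x 0 0)).
have stau' : smooth_at 0 tau'.
  apply: smooth_at_row2; first exact: smooth_at_coord.
  by apply: smooth_atD; [exact: smooth_at_coord|apply: smooth_atN; exact: sc0].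
have tau'0 : tau' 0 = 0 by rewrite /tau' !c00 s0 oppr0 addr0.
exists h, eta; split.
- exact: sh.
- by apply: (smooth_at_comp stau'); rewrite tau'0.
- by rewrite /eta -/(tau' 0) tau'0 /eta0 c00 mul0r.
- have se : smooth_at (tau' 0) eta0 by rewrite tau'0.
  have -> : 'D_(e_ 1) eta 0 = 'D_(e_ 1) eta0 (tau' 0) := derive_shift1 (c := fun a => - sigma a) se.
  rewrite tau'0 (derive_mul_coord1 (smooth_at_sqrt q0 sq)).
  have sq0 : Num.sqrt (q 0) != 0 by apply: lt0r_neq0; rewrite sqrtr_gt0.
  by rewrite c00; move: ('D_(e_ 1) _ 0) => u; rewrite mul0r add0r.
- have nq : \forall x \near (0 : 'rV[R]_2), 0 < q x.
    exact: (near_comp (P := fun z : R => 0 < z) (smooth_at_continuous sq) (lt_nbhsr q0)).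
  have nt : \forall x \near (0 : 'rV[R]_2), 0 < q (tau' x) /\
      g (tau' x) = tau' x 0 1 * (tau' x 0 1 * q (tau' x)).
    apply: (near_comp (P := fun z : 'rV[R]_2 => 0 < q z /\ g z = z 0 1 * (z 0 1 * q z)) (smooth_at_continuous stau')).
    by rewrite tau'0; exact: filterI.
  apply: filterS nt => x [qx]; rewrite /eta -/(tau' x) /eta0 exprMn (sqr_sqrtr (ltW qx)).
  have -> : g (tau' x) = Z x - h (x 0 0).
    rewrite /g /tau /tau' !row2_0 !row2_1 subrK row2K.
    by [].
  by move=> /eqP; rewrite subr_eq => /eqP ->; rewrite expr2 -mulrA addrC.
Qed.

End ParametricMorse.

(** * Reduction to the umbrella *)

Section NormalForm.
Context {R : realType}.

Lemma param_inverse_germ (g : 'rV[R]_2 -> R) (p : 'rV[R]_2) :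
  smooth_at p g -> 'D_(e_ 1) g p != 0 ->
  exists k : 'rV[R]_2 -> R,
    inverse_germ (fun x => row2 (x 0 0) (g x)) (fun y => row2 (y 0 0) (k y)) p.
Proof.
move=> sg g1; have [k [sk _ kl kr]] := param_inverse sg g1.
exists k; split.
- by apply: smooth_at_row2; [exact: smooth_at_coord|exact: sg].
- by apply: smooth_at_row2; [exact: smooth_at_coord|exact: sk].
- by apply: filterS kl => x E; rewrite row2_0 E row2K.
- by apply: filterS kr => y E; rewrite row2_0 E row2K.
Qed.

Definition swap2 (x : 'rV[R]_2) : 'rV[R]_2 := row2 (x 0 1) (x 0 0).

Lemma swap2K : involutive swap2.
Proof. by move=> x; rewrite /swap2 row2_0 row2_1 row2K. Qed.

Lemma smooth_swap2 x : smooth_at x swap2.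
Proof. by apply: smooth_at_row2; exact: smooth_at_coord. Qed.

Lemma inverse_germ_swap2 p : inverse_germ swap2 swap2 p.
Proof.
split; try exact: smooth_swap2.
- by apply: filterE => x; exact: swap2K.
- by apply: filterE => x; exact: swap2K.
Qed.

(** In the source coordinates (t, lambda), agreement to second order with
    (lambda, t lambda, t^2 / 2), apart from the second derivatives in
    lambda alone. *)
Definition normalized_jet (F : 'rV[R]_2 -> 'rV[R]_3) (p : 'rV[R]_2) : Prop :=
  [/\ F p = 0, forall j, 'D_(e_ 0) (fun x => F x 0 j) p = 0 & cross_cap_mx F p = 1%:M].

Definition parabolic (h : R -> R) (x : 'rV[R]_2) : R := h (x 0 0) + x 0 1 ^+ 2.

(** The first component has a nonzero derivative along [e_ 1] and is a
    coordinate together with t. In these coordinates the third component has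
    a nondegenerate critical point in t, and the Morse lemma replaces t. *)
Lemma morse_coordinates (F : 'rV[R]_2 -> 'rV[R]_3) (p : 'rV[R]_2) :
  smooth_at p F -> normalized_jet F p ->
  exists (h : R -> R) (Y : 'rV[R]_2 -> R) (E : 'rV[R]_2 -> R) psi,
    [/\ inverse_germ (fun x => row2 (F x 0 0) (E x)) psi p,
        smooth_at p E, E p = 0, smooth_at 0 h & [/\ h 0 = 0, smooth_at 0 Y,
        (\forall x \near p, F x 0 2 = h (F x 0 0) + E x ^+ 2) &
        (\forall x \near p, F x 0 1 = Y (row2 (F x 0 0) (E x)))]].
Proof.
move=> sF [Fp F0 FM].
have jet i j : second_jet (fun x => F x 0 j) p i = (i == j)%:R.
  by have := congr1 (fun M : 'M[R]_3 => M i j) FM; rewrite !mxE.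
have sf j : smooth_at p (fun x => F x 0 j) by exact: smooth_at_coordf.
have f01 : 'D_(e_ 1) (fun x => F x 0 0) p != 0.
  by have := jet 0 0; rewrite /second_jet /= => ->; exact: oner_neq0.
have [k g1] := param_inverse_germ (sf 0) f01.
have g2 := inverse_germ_comp g1 (inverse_germ_swap2 _).
pose sh (t : R) (x : 'rV[R]_2) := row2 (x 0 0) (x 0 1 + t).
have ssh t x : smooth_at x (sh t).
  apply: smooth_at_row2; first exact: smooth_at_coord.
  by apply: smooth_atD; [exact: smooth_at_coord|exact: smooth_at_cst].
have shK t x : sh (- t) (sh t x) = x by rewrite /sh row2_0 row2_1 addrK row2K.
have shKV t x : sh t (sh (- t) x) = x by rewrite /sh row2_0 row2_1 subrK row2K.
have g3 q : inverse_germ (sh (- p 0 0)) (sh (p 0 0)) q.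
  split; [exact: ssh|exact: ssh| |].
    by apply: filterE => x; exact: shKV.
  by apply: filterE => x; exact: shK.
have := inverse_germ_comp g2 (g3 _).
set phi0 := (fun x => _); set psi0 := (fun y => row2 _ _) => g0.
have phi0E : phi0 = (fun x => row2 (F x 0 0) (x 0 0 - p 0 0)).
  by apply/funext => x; rewrite /phi0 /sh /swap2 !row2_0 !row2_1.
have phi0p : phi0 p = 0.
  by rewrite phi0E Fp; apply: eq_row2; rewrite ?row2_0 ?row2_1 ?subrr !mxE.
have [sphi0 spsi0 l0 r0] := g0; rewrite phi0p in spsi0 r0.
have psi00 : psi0 0 = p by rewrite -phi0p; exact: inverse_germ_value g0.
pose Z j (y : 'rV[R]_2) := F (psi0 y) 0 j.
have sZ j : smooth_at 0 (Z j).
  by apply: (smooth_at_comp (g := fun z => F z 0 j) spsi0); rewrite psi00.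
have FZ j : \forall x \near p, Z j (row2 (F x 0 0) (x 0 0 - p 0 0)) = F x 0 j.
  by apply: filterS l0 => x lx; rewrite /Z -[row2 _ _](congr1 (fun f => f x) phi0E) lx.
pose T (x : 'rV[R]_2) := x 0 0 - p 0 0.
have sT : smooth_at p T by apply: smooth_atB; [exact: smooth_at_coord|exact: smooth_at_cst].
have T0 : 'D_(e_ 0) T p = 1.
  rewrite (derive_addf _ (smooth_at_coord p 0) (smooth_at_cst p (- p 0 0))) derive_coord derive_cst.
  by rewrite !mxE addr0.
pose X (x : 'rV[R]_2) := F x 0 0.
have q0 : row2 (X p) (T p) = 0.
  by rewrite /X /T Fp; apply: eq_row2; rewrite ?row2_0 ?row2_1 ?subrr !mxE.
have sZ' j : smooth_at (row2 (X p) (T p)) (Z j) by rewrite q0.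
have Z1 : 'D_(e_ 1) (Z 2) 0 = 0.
  have := source_kernel (sf 0) sT (sZ' 2) (F0 0).
  by rewrite (near_eq_derive _ (FZ 2)) F0 T0 mul1r -/(X p) q0 => <-.
have Z1' : 'D_(e_ 1) (Z 2) (row2 (X p) (T p)) = 0 by rewrite q0.
have Z11 : 'D_(e_ 1) ('D_(e_ 1) (Z 2)) 0 = 1.
  have [_ _] := source_second_jet (sf 0) sT (sZ' 2) (F0 0) Z1'.
  rewrite (near_eq_second_jet 2 (FZ 2)) !jet T0 expr1n mulr1 mulr0 addr0 -/(X p) q0.
  by move=> <-.
have [|h [eta [sh0 seta eta0 eta1 etaE]]] := parametric_morse (sZ 2) Z1.
  by rewrite Z11 ltr01.
have [k4 g4] := param_inverse_germ seta eta1.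
rewrite -phi0p in g4.
have := inverse_germ_comp g0 g4.
set phi := (fun x => row2 _ _); set psi := (fun y => psi0 _) => g5.
pose E x := eta (phi0 x).
have phiE : phi = (fun x => row2 (F x 0 0) (E x)).
  by apply/funext => x; rewrite /phi /E; congr row2; rewrite phi0E row2_0.
have Ep : E p = 0 by rewrite /E phi0p.
have phip : phi p = 0.
  by rewrite phiE Fp Ep; apply: eq_row2; rewrite ?row2_0 ?row2_1 !mxE.
have [_ spsi l5 _] := g5; rewrite phip in spsi.
have psip : psi 0 = p by rewrite -phip; exact: inverse_germ_value g5.
exists h, (fun y => F (psi y) 0 1), E, psi; split.
- by rewrite -phiE.
- by apply: (smooth_at_comp sphi0); rewrite phi0p.
- exact: Ep.
- exact: sh0.
split.
- have := nbhs_singleton etaE; rewrite eta0 expr0n addr0 /Z psi00 Fp !mxE.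
  by move=> <-.
- by apply: (smooth_at_comp (g := fun z => F z 0 1) spsi); rewrite psip.
- have n0 : \forall x \near p, Z 2 (phi0 x) = h (phi0 x 0 0) + eta (phi0 x) ^+ 2.
    apply: (near_comp (P := fun z : 'rV[R]_2 => Z 2 z = h (z 0 0) + eta z ^+ 2) (smooth_at_continuous sphi0)).
    by rewrite phi0p.
  apply: filterS2 n0 (FZ 2) => x E2 <-.
  by rewrite -[row2 _ _](congr1 (fun f => f x) phi0E) E2 {1}phi0E row2_0.
- by apply: filterS l5 => x lx; rewrite -[row2 _ _](congr1 (fun f => f x) phiE) lx.
Qed.

End NormalForm.

Section WhitneyCriterion.
Context {R : realType}.

Lemma row3K (x : 'rV[R]_3) : row3 (x 0 0) (x 0 1) (x 0 2) = x.
Proof.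
by apply/rowP => i; case: (ord3_cases i) => ->; rewrite !mxE.
Qed.

Lemma eq_row3 (x y : 'rV[R]_3) :
  x 0 0 = y 0 0 -> x 0 1 = y 0 1 -> x 0 2 = y 0 2 -> x = y.
Proof. by move=> h0 h1 h2; rewrite -(row3K x) -(row3K y) h0 h1 h2. Qed.

Lemma row2_00 : row2 0 0 = 0 :> 'rV[R]_2.
Proof. by apply: eq_row2; rewrite ?row2_0 ?row2_1 mxE. Qed.

Lemma coord_0 n (i : 'I_n) : (0 : 'rV[R]_n) 0 i = 0. Proof. by rewrite mxE. Qed.

(** On the axis y = 0 the odd part is seen by the derivative:
    Y_y (x, 0) = B (x, 0). *)
Lemma odd_part_jet (Y A B : 'rV[R]_2 -> R) :
  smooth_at 0 A -> smooth_at 0 B ->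
  (\forall x \near (0 : 'rV[R]_2), Y x = A (row2 ((x : 'rV[R]_2) 0 0) (x 0 1 ^+ 2)) +
       x 0 1 * B (row2 (x 0 0) (x 0 1 ^+ 2))) -> smooth_at 0 Y ->
  B 0 = 'D_(e_ 1) Y 0 /\ 'D_(e_ 0) B 0 = 'D_(e_ 0) ('D_(e_ 1) Y) 0.
Proof.
move=> sA sB YE sY.
pose s (x : 'rV[R]_2) := row2 (x 0 0) (x 0 1 ^+ 2).
have sc x : smooth_at x (fun y : 'rV[R]_2 => y 0 1 ^+ 2) by apply: smooth_atX; exact: smooth_at_coord.
have ss x : smooth_at x s by apply: smooth_at_row2; [exact: smooth_at_coord|exact: sc].
have s0 : s 0 = 0 by rewrite /s !coord_0 expr0n row2_00.
have [U [oU U0 UP]] : exists U : set 'rV[R]_2, [/\ open U, U 0 & forall x, U x ->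
    [/\ smooth_at (s x) A, smooth_at (s x) B & Y x = A (s x) + x 0 1 * B (s x)]].
  have nA : \forall x \near (0 : 'rV[R]_2), smooth_at (s x) A.
    apply: (near_comp (P := fun z => smooth_at z A) (smooth_at_continuous (ss 0))).
    by rewrite s0; exact: smooth_at_near.
  have nB : \forall x \near (0 : 'rV[R]_2), smooth_at (s x) B.
    apply: (near_comp (P := fun z => smooth_at z B) (smooth_at_continuous (ss 0))).
    by rewrite s0; exact: smooth_at_near.
  have [U [oU U0 UP]] := near_open (filterI YE (filterI nA nB)).
  by exists U; split=> // x /UP[YEx [nAx nBx]].
have DY x : U x -> x 0 1 = 0 -> 'D_(e_ 1) Y x = B x.
  move=> Ux x1; have [sAx sBx _] := UP x Ux.
  have sx : s x = x by apply: eq_row2; rewrite /s ?row2_0 ?row2_1 // x1 expr0n.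
  have nx : \forall y \near x, Y y = A (s y) + y 0 1 * B (s y).
    by apply: filterS (open_nbhs_nbhs (conj oU Ux)) => y /UP[].
  have sAs : smooth_at x (fun y => A (s y)) by exact: smooth_at_comp (ss x) sAx.
  have sBs : smooth_at x (fun y => B (s y)) by exact: smooth_at_comp (ss x) sBx.
  rewrite (near_eq_derive _ nx) (derive_addf _ sAs (smooth_atM (smooth_at_coord x 1) sBs)).
  rewrite (derive_mul_coord1 sBs) x1 sx.
  rewrite (chain_rule2 _ (smooth_at_coord x 0) (sc x) sAx) derive_coord derive_coord_sqr x1.
  rewrite !mxE /=; move: ('D_(e_ 0) A _) ('D_(e_ 1) A _) ('D_(e_ 1) _ x) (B x) => a b c d; ring.
split; first by rewrite DY ?coord_0.
have sDY := smooth_at_derive (e_ 1) sY.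
have sB' := sB; have sDY' := sDY; rewrite -row2_00 in sB' sDY' *.
have d1 := (is_derive_row0 _ _ _ _).1 (smooth_is_derive (e_ 0) sB').
have d2 := (is_derive_row0 _ _ _ _).1 (smooth_is_derive (e_ 0) sDY').
have na : \forall a \near (0 : R), B (row2 a 0) = 'D_(e_ 1) Y (row2 a 0).
  have srow : smooth_at (0 : R) (fun a : R => row2 a 0).
    by apply: smooth_at_row2; [exact: smooth_at_id|exact: smooth_at_cst].
  have nU : \forall x \near row2 (0 : R) 0, U x by rewrite row2_00; exact: open_nbhs_nbhs.
  apply: filterS (near_comp (smooth_at_continuous srow) nU) => a Ua.
  by rewrite DY// row2_1.
have d3 := near_eq_is_derive na d1.
by rewrite -(derive_val (is_derive := d3)) (derive_val (is_derive := d2)).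
Qed.

(** Both maps are inverted by solving B (x, c) = b for x, which is possible
    because B_x is nonzero. *)
Lemma umbrella_target (A B : 'rV[R]_2 -> R) (h : R -> R) :
  smooth_at 0 A -> smooth_at 0 B -> smooth_at 0 h ->
  A 0 = 0 -> B 0 = 0 -> h 0 = 0 -> 'D_(e_ 0) B 0 != 0 ->
  (exists psi, inverse_germ (fun z : 'rV[R]_3 =>
     row3 (B (row2 (z 0 0) (z 0 2 - h (z 0 0)))) (z 0 1 - A (row2 (z 0 0) (z 0 2 - h (z 0 0))))
       (z 0 2 - h (z 0 0))) psi 0) /\
  (exists psi, inverse_germ (fun z : 'rV[R]_2 =>
     row2 (B (row2 (z 0 0) (z 0 1 ^+ 2))) (z 0 1)) psi 0).
Proof.
move=> sA sB sh A0 B0 h0 B1.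
pose Bs (x : 'rV[R]_2) := B (swap2 x).
have sw0 : swap2 0 = 0 :> 'rV[R]_2 by rewrite /swap2 !coord_0 row2_00.
have sBs : smooth_at 0 Bs by apply: (smooth_at_comp (smooth_swap2 _)); rewrite sw0.
have Bs1 : 'D_(e_ 1) Bs 0 != 0.
  have sB' : smooth_at (row2 ((0 : 'rV[R]_2) 0 1) ((0 : 'rV[R]_2) 0 0)) B by rewrite !coord_0 row2_00.
  have -> // : 'D_(e_ 1) Bs 0 = 'D_(e_ 0) B 0.
  rewrite [LHS](chain_rule2 _ (smooth_at_coord 0 1) (smooth_at_coord 0 0) sB') !derive_coord !coord_0 row2_00.
  by rewrite !mxE /= mul1r mul0r addr0.
have [k [sk k0 kl kr]] := param_inverse sBs Bs1.
rewrite /Bs sw0 B0 !coord_0 row2_00 in sk k0 kr.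
have kl' : \forall x \near (0 : 'rV[R]_2), k (row2 ((x : 'rV[R]_2) 0 0) (B (row2 (x 0 1) (x 0 0)))) = x 0 1.
  exact: kl.
have kr' : \forall y \near (0 : 'rV[R]_2), B (row2 (k y) ((y : 'rV[R]_2) 0 0)) = y 0 1.
  by apply: filterS kr => y; rewrite /swap2 row2_0 row2_1.
split.
  pose c (z : 'rV[R]_3) := z 0 2 - h (z 0 0).
  have sc : smooth_at 0 c.
    apply: smooth_atB; first exact: smooth_at_coord.
    by apply: (smooth_at_comp1 (smooth_at_coord 0 0)); rewrite coord_0.
  have c0 : c 0 = 0 by rewrite /c !coord_0 h0 subr0.
  have szc : smooth_at 0 (fun z : 'rV[R]_3 => row2 (z 0 0) (c z)).
    by apply: smooth_at_row2 => //; exact: smooth_at_coord.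
  have zc0 : row2 ((0 : 'rV[R]_3) 0 0) (c 0) = 0 by rewrite coord_0 c0 row2_00.
  pose Xi (w : 'rV[R]_3) := k (row2 (w 0 2) (w 0 0)).
  have sww : smooth_at 0 (fun w : 'rV[R]_3 => row2 (w 0 2) (w 0 0)).
    by apply: smooth_at_row2; exact: smooth_at_coord.
  have ww0 : row2 ((0 : 'rV[R]_3) 0 2) ((0 : 'rV[R]_3) 0 0) = 0 by rewrite !coord_0 row2_00.
  have sXi : smooth_at 0 Xi by apply: (smooth_at_comp sww); rewrite ww0.
  have Xi0 : Xi 0 = 0 by rewrite /Xi ww0.
  have sXw : smooth_at 0 (fun w : 'rV[R]_3 => row2 (Xi w) (w 0 2)).
    by apply: smooth_at_row2 => //; exact: smooth_at_coord.
  exists (fun w => row3 (Xi w) (w 0 1 + A (row2 (Xi w) (w 0 2))) (w 0 2 + h (Xi w))).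
  have phi0 : row3 (B (row2 ((0 : 'rV[R]_3) 0 0) (c 0))) ((0 : 'rV[R]_3) 0 1 - A (row2 ((0 : 'rV[R]_3) 0 0) (c 0))) (c 0) = 0.
    by rewrite zc0 A0 B0 c0; apply: eq_row3; rewrite ?row3_0 ?row3_1 ?row3_2 !coord_0 ?subr0.
  split.
  - apply: smooth_at_row3 => //; first by apply: (smooth_at_comp szc); rewrite zc0.
    apply: smooth_atB; first exact: smooth_at_coord.
    by apply: (smooth_at_comp szc); rewrite zc0.
  - rewrite -/(c 0) phi0; apply: smooth_at_row3 => //.
      apply: smooth_atD; first exact: smooth_at_coord.
      by apply: (smooth_at_comp sXw); rewrite Xi0 coord_0 row2_00.
    apply: smooth_atD; first exact: smooth_at_coord.
    by apply: (smooth_at_comp1 sXi); rewrite Xi0.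
  - have scz : smooth_at 0 (fun z : 'rV[R]_3 => row2 (c z) (z 0 0)).
      by apply: smooth_at_row2 => //; exact: smooth_at_coord.
    have cz0 : row2 (c 0) ((0 : 'rV[R]_3) 0 0) = 0 by rewrite coord_0 c0 row2_00.
    have := near_comp (smooth_at_continuous scz) (_ : \forall x \near row2 (c 0) ((0 : 'rV[R]_3) 0 0), _).
    rewrite cz0 => /(_ _ kl'); apply: filterS => z; rewrite row2_0 row2_1 => E.
    rewrite -/(c z) /Xi !row3_0 !row3_1 !row3_2 E subrK subrK.
    by rewrite row3K.
  - rewrite -/(c 0) phi0.
    have := near_comp (smooth_at_continuous sww) (_ : \forall x \near row2 ((0 : 'rV[R]_3) 0 2) ((0 : 'rV[R]_3) 0 0), _).
    rewrite ww0 => /(_ _ kr'); apply: filterS => w; rewrite row2_0 row2_1 => E.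
    rewrite !row3_0 !row3_1 !row3_2 addrK /Xi E addrK.
    by rewrite row3K.
pose s (x : 'rV[R]_2) := row2 (x 0 0) (x 0 1 ^+ 2).
have sc x : smooth_at x (fun y : 'rV[R]_2 => y 0 1 ^+ 2) by apply: smooth_atX; exact: smooth_at_coord.
have ss x : smooth_at x s by apply: smooth_at_row2; [exact: smooth_at_coord|exact: sc].
have s0 : s 0 = 0 by rewrite /s !coord_0 expr0n row2_00.
pose s' (x : 'rV[R]_2) := row2 (x 0 1 ^+ 2) (x 0 0).
have ss' x : smooth_at x s' by apply: smooth_at_row2; [exact: sc|exact: smooth_at_coord].
have s'0 : s' 0 = 0 by rewrite /s' !coord_0 expr0n row2_00.
have phi0 : row2 (B (s 0)) ((0 : 'rV[R]_2) 0 1) = 0 by rewrite s0 B0 coord_0 row2_00.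
exists (fun y => row2 (k (s' y)) (y 0 1)); split.
- apply: smooth_at_row2; last exact: smooth_at_coord.
  by apply: (smooth_at_comp (ss 0)); rewrite s0.
- rewrite -/(s 0) phi0; apply: smooth_at_row2; last exact: smooth_at_coord.
  by apply: (smooth_at_comp (ss' 0)); rewrite s'0.
- have := near_comp (smooth_at_continuous (ss' 0)) (_ : \forall x \near s' 0, _).
  rewrite s'0 => /(_ _ kl'); apply: filterS => x; rewrite /s' !row2_0 !row2_1 => ->.
  by rewrite row2K.
- rewrite -/(s 0) phi0.
  have := near_comp (smooth_at_continuous (ss' 0)) (_ : \forall x \near s' 0, _).
  rewrite s'0 => /(_ _ kr'); apply: filterS => x; rewrite /s' !row2_0 !row2_1 => ->.
  by rewrite row2K.
Qed.

(** In Morse coordinates the map is (x, A (x, y^2) + y B (x, y^2), h (x) + y^2),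
    so that c = Z - h (X) is y^2, and the target coordinates of
    [umbrella_target] take the values B, y B and y^2. *)
Lemma normalized_umbrella (F : 'rV[R]_2 -> 'rV[R]_3) (p : 'rV[R]_2) :
  smooth_at p F -> normalized_jet F p ->
  exists phi psi Phi Psi, [/\ inverse_germ phi psi p, phi p = 0,
    inverse_germ Phi Psi 0, Phi 0 = 0 &
    \forall x \near p, Phi (F x) = whitney_umbrella (phi x)].
Proof.
move=> sF nF; have [h [Y [E [psi [ig sE Ep sh [h0 sY F2 F1]]]]]] := morse_coordinates sF nF.
have [Fp F0 FM] := nF.
have jet i j : second_jet (fun x => F x 0 j) p i = (i == j)%:R.
  by have := congr1 (fun M : 'M[R]_3 => M i j) FM; rewrite !mxE.
have sf j : smooth_at p (fun x => F x 0 j) by exact: smooth_at_coordf.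
pose X (x : 'rV[R]_2) := F x 0 0.
have q0 : row2 (X p) (E p) = 0 by rewrite /X Fp Ep coord_0 row2_00.
have X1 : 'D_(e_ 1) X p = 1 by have := jet 0 0.
have sG : smooth_at (row2 (X p) (E p)) (parabolic h).
  rewrite q0; apply: smooth_atD; last by apply: smooth_atX; exact: smooth_at_coord.
  by apply: smooth_fst; rewrite coord_0.
have nG1 : \forall x \near (0 : 'rV[R]_2), 'D_(e_ 1) (parabolic h) x = 2 * x 0 1.
  have nh : \forall x \near (0 : 'rV[R]_2), smooth_at ((x : 'rV[R]_2) 0 0) h.
    apply: (near_comp (P := fun t => smooth_at t h) (smooth_at_continuous (smooth_at_coord 0 0))).
    by rewrite coord_0; exact: smooth_at_near.
  apply: filterS nh => x shx.
  have s2 : smooth_at x (fun z : 'rV[R]_2 => z 0 1 ^+ 2) by apply: smooth_atX; exact: smooth_at_coord.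
  rewrite (derive_addf _ (smooth_fst shx) s2) derive_fst add0r derive_coord_sqr.
  by rewrite !mxE /= mulr1.
have G1 : 'D_(e_ 1) (parabolic h) (row2 (X p) (E p)) = 0.
  by rewrite q0 (nbhs_singleton nG1) coord_0 mulr0.
have F2' : \forall x \near p, parabolic h (row2 (X x) (E x)) = F x 0 2.
  by apply: filterS F2 => x ->; rewrite /parabolic row2_0 row2_1.
have [_ j1 j2] := source_second_jet (sf 0) sE sG (F0 0) G1.
rewrite !(near_eq_second_jet _ F2') !jet -/(X p) q0 !mulr0 !addr0 in j1 j2.
rewrite !(near_eq_derive _ nG1) !derive_coordZ !mxE /= mulr1 mulr0 mulr0 add0r in j1 j2.
have E0 : 'D_(e_ 0) E p != 0.
  by apply/eqP => E0; move: j2; rewrite E0 expr0n mulr0 => /eqP; rewrite oner_eq0.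
have E1 : 'D_(e_ 1) E p = 0.
  move: j1 => /esym/eqP; rewrite !mulf_eq0 (negbTE E0) orbF pnatr_eq0 orbF.
  by move/eqP.
have sY' : smooth_at (row2 (X p) (E p)) Y by rewrite q0.
have F1' : \forall x \near p, Y (row2 (X x) (E x)) = F x 0 1.
  by apply: filterS F1 => x ->.
have Y1 : 'D_(e_ 1) Y 0 = 0.
  have := source_kernel (sf 0) sE sY' (F0 0).
  rewrite (near_eq_derive _ F1') F0 -/(X p) q0 => /esym/eqP.
  by rewrite mulf_eq0 (negbTE E0) => /eqP.
have Y1' : 'D_(e_ 1) Y (row2 (X p) (E p)) = 0 by rewrite q0.
have Y01 : 'D_(e_ 0) ('D_(e_ 1) Y) 0 != 0.
  have [_ k1 _] := source_second_jet (sf 0) sE sY' (F0 0) Y1'.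
  rewrite (near_eq_second_jet _ F1') !jet -/(X p) q0 mulr0 addr0 E1 mul0r addr0 in k1.
  by apply/eqP => Y01; move: k1; rewrite Y01 mulr0 mul0r => /eqP; rewrite oner_eq0.
have [A [B [sA sB YE]]] := whitney_decomposition sY.
have [B0 B1] := odd_part_jet sA sB YE sY.
rewrite Y1 in B0; have B1' : 'D_(e_ 0) B 0 != 0 by rewrite B1.
have A0 : A 0 = 0.
  have := nbhs_singleton F1; rewrite -/(X p) q0 Fp coord_0 (nbhs_singleton YE).
  by rewrite !coord_0 mul0r addr0 expr0n row2_00.
have [[Psi gPhi] [psi3 g3]] := umbrella_target sA sB sh A0 B0 h0 B1'.
pose xi (x : 'rV[R]_2) := row2 (F x 0 0) (E x).
have xip : xi p = 0 by exact: q0.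
rewrite -xip in g3; have := inverse_germ_comp ig g3.
set phi := (fun x => row2 (B _) _); set psi' := (fun y => psi _) => g.
exists phi, psi'; eexists; exists Psi; split.
- exact: g.
- by rewrite /phi -/(xi p) xip !coord_0 expr0n row2_00 B0 row2_00.
- exact: gPhi.
- rewrite /= !coord_0 h0 subr0 row2_00 A0 B0 subr0.
  by apply: eq_row3; rewrite ?row3_0 ?row3_1 ?row3_2 coord_0.
- have nY : \forall x \near p, Y (xi x) = A (row2 (xi x 0 0) (xi x 0 1 ^+ 2)) +
      xi x 0 1 * B (row2 (xi x 0 0) (xi x 0 1 ^+ 2)).
    have cxi : {for p, continuous xi}.
      by apply: smooth_at_continuous; apply: smooth_at_row2.
    apply: (near_comp (P := fun z : 'rV[R]_2 => Y z = A (row2 (z 0 0) (z 0 1 ^+ 2)) + z 0 1 * B (row2 (z 0 0) (z 0 1 ^+ 2))) cxi).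
    by rewrite xip.
  apply: filterS3 F1 F2 nY => x F1x F2x nYx.
  have -> : F x 0 2 - h (F x 0 0) = E x ^+ 2 by rewrite F2x addrAC subrr add0r.
  rewrite F1x -/(xi x) nYx /phi /xi !row2_0 !row2_1 addrAC subrr add0r.
  rewrite /whitney_umbrella row2_0 row2_1.
  by rewrite mulrC.
Qed.

Lemma smooth_at_sum (V : normedModType R) n (x : V) (f : 'I_n -> V -> R) :
  (forall i, smooth_at x (f i)) -> smooth_at x (fun y => \sum_i f i y).
Proof.
elim: n f => [|n IH] f sf.
  apply: smooth_at_eq (smooth_at_cst x 0).
  by apply: filterE => y; rewrite big_ord0.
apply: smooth_at_eq (smooth_atD (sf ord0) (IH (fun i => f (lift ord0 i)) _)) => //.
by apply: filterE => y; rewrite big_ord_recl.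
Qed.

Definition affine_map n (c : 'rV[R]_n) (L : 'M[R]_n) (d : 'rV[R]_n) (y : 'rV[R]_n) := (y - c) *m L + d.

Lemma affine_mapE n (c : 'rV[R]_n) L d j :
  (fun y => affine_map c L d y 0 j) = (fun y : 'rV[R]_n => \sum_i (y 0 i + - c 0 i) * L i j + d 0 j).
Proof.
by apply/funext => y; rewrite /affine_map !mxE; congr (_ + _); apply: eq_bigr => i _; rewrite !mxE.
Qed.

Lemma smooth_affine n (c : 'rV[R]_n) L d x : smooth_at x (affine_map c L d).
Proof.
apply: smooth_at_rV => j; rewrite affine_mapE.
apply: smooth_atD; last exact: smooth_at_cst.
apply: smooth_at_sum => i; apply: smooth_atM; last exact: smooth_at_cst.
by apply: smooth_atD; [exact: smooth_at_coord|exact: smooth_at_cst].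
Qed.

Lemma derive_affine n (c : 'rV[R]_n) L d x i j :
  'D_(delta_mx 0 i) (fun y => affine_map c L d y 0 j) x = L i j.
Proof.
have s1 k : smooth_at x (fun y : 'rV[R]_n => y 0 k + - c 0 k).
  by apply: smooth_atD; [exact: smooth_at_coord|exact: smooth_at_cst].
have s2 k : smooth_at x (fun y : 'rV[R]_n => (y 0 k + - c 0 k) * L k j).
  by apply: smooth_atM => //; exact: smooth_at_cst.
rewrite affine_mapE (derive_addf _ (smooth_at_sum s2) (smooth_at_cst x _)) derive_cst addr0.
rewrite (derive_sumf _ s2) (bigD1 i)//= big1 => [|k ki].
  rewrite addr0 (derive_mulf _ (s1 i) (smooth_at_cst x _)) derive_cst mulr0 add0r.
  by rewrite (derive_addf _ (smooth_at_coord x i) (smooth_at_cst x _)) derive_coord derive_cst addr0 mxE !eqxx mulr1.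
rewrite (derive_mulf _ (s1 k) (smooth_at_cst x _)) derive_cst mulr0 add0r.
rewrite (derive_addf _ (smooth_at_coord x k) (smooth_at_cst x _)) derive_coord derive_cst addr0 mxE.
by rewrite eqxx (negbTE ki) mulr0.
Qed.

Lemma inverse_germ_affine n (c d : 'rV[R]_n) (L : 'M[R]_n) p : L \in unitmx ->
  inverse_germ (affine_map c L d) (affine_map d (invmx L) c) p.
Proof.
move=> uL; split; try exact: smooth_affine.
- by apply: filterE => x; rewrite /affine_map addrK mulmxK// subrK.
- by apply: filterE => x; rewrite /affine_map addrK mulmxKV// subrK.
Qed.

(** For sufficiency, the linear map of the target inverse to the matrix
    normalises the jet. *)
Theorem whitney_criterion (F : 'rV[R]_2 -> 'rV[R]_3) (p : 'rV[R]_2) : smooth_at p F ->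
  (forall j, 'D_(e_ 0) (fun x => F x 0 j) p = 0) ->
  A_equivalent F p whitney_umbrella 0 <-> \det (cross_cap_mx F p) != 0.
Proof.
move=> sF F0; split; first exact: A_equivalent_umbrella_det.
rewrite -unitfE -[_ \is a GRing.unit]/(cross_cap_mx F p \in unitmx) => uM.
set M := cross_cap_mx F p in uM.
have uL : invmx M \in unitmx by rewrite unitmx_inv.
have ga := @inverse_germ_affine _ (F p) 0 (invmx M) (F p) uL.
set Phi0 := affine_map (F p) (invmx M) 0 in ga.
have Phi0p : Phi0 (F p) = 0 by rewrite /Phi0 /affine_map subrr mul0mx addr0.
have sPj j : smooth_at (F p) (fun z => Phi0 z 0 j) by apply: smooth_at_coordf; exact: smooth_affine.
pose G x := Phi0 (F x).
have sG : smooth_at p G by apply: smooth_at_comprV => //; exact: smooth_affine.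
have nG : normalized_jet G p.
  split=> [//|j|]; first exact: (target_kernel (Phi := fun z => Phi0 z 0 j) sF (sPj j) F0).
  apply/matrixP => i j; rewrite -(mulmxV uM) !mxE.
  rewrite (target_second_jet (Phi := fun z => Phi0 z 0 j) sF (sPj j) F0).
  by apply: eq_bigr => k _; rewrite derive_affine mxE.
have [phi [psi [Phi [Psi [g1 phip g2 Phi0' E]]]]] := normalized_umbrella sG nG.
rewrite -Phi0p in g2.
have g3 := inverse_germ_comp ga g2.
exists phi, (fun z => Phi (Phi0 z)); split.
- by split=> //; exact: inverse_diffeo_germ g1.
- split; first exact: inverse_diffeo_germ g3.
  rewrite Phi0p Phi0'; apply: eq_row3; rewrite ?row3_0 ?row3_1 ?row3_2 !coord_0 ?mul0r ?expr0n//.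
- exact: E.
Qed.

End WhitneyCriterion.

(** * Orthonormal frames *)

Section Frames.
Context {R : realType}.
Implicit Types (f g : R -> 'rV[R]_3) (x y v w : 'rV[R]_3).

Lemma dotE x y : dot x y = x 0 0 * y 0 0 + x 0 1 * y 0 1 + x 0 2 * y 0 2.
Proof.
rewrite /dot !big_ord_recl big_ord0 addr0 addrA.
by congr (_ + _ + _); congr (_ * _); congr (_ _ _); exact/val_inj.
Qed.

Lemma dotC x y : dot x y = dot y x.
Proof. by apply: eq_bigr => i _; rewrite mulrC. Qed.

Lemma dotDl x y z : dot (x + y) z = dot x z + dot y z.
Proof. by rewrite -big_split; apply: eq_bigr => i _; rewrite mxE mulrDl. Qed.

Lemma dotZl a x y : dot (a *: x) y = a * dot x y.
Proof. by rewrite /dot mulr_sumr; apply: eq_bigr => i _; rewrite mxE mulrA. Qed.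

Lemma dotNl x y : dot (- x) y = - dot x y.
Proof. by rewrite -scaleN1r dotZl mulN1r. Qed.

Lemma dot0l x : dot 0 x = 0.
Proof. by rewrite -(scale0r 0) dotZl mul0r. Qed.

Lemma dotDr x y z : dot z (x + y) = dot z x + dot z y.
Proof. by rewrite dotC dotDl !(dotC z). Qed.

Lemma dotZr a x y : dot y (a *: x) = a * dot y x.
Proof. by rewrite dotC dotZl dotC. Qed.

Lemma dotNr x y : dot y (- x) = - dot y x.
Proof. by rewrite dotC dotNl dotC. Qed.

Definition frame_mx v w : 'M[R]_3 := \matrix_(i, j) [:: v; w; cross v w]`_i 0 j.

Definition orthonormal2 v w : Prop := [/\ dot v v = 1, dot w w = 1 & dot v w = 0].

Lemma dot_cross_self v w : dot (cross v w) (cross v w) = dot v v * dot w w - dot v w ^+ 2.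
Proof. by rewrite !dotE !row3_0 !row3_1 !row3_2; ring. Qed.

Lemma dot_crossl v w : dot v (cross v w) = 0.
Proof. by rewrite !dotE !row3_0 !row3_1 !row3_2; ring. Qed.

(** The determinant is the triple product, that is, the squared length of
    the cross product. *)
Lemma det_frame_mx v w : orthonormal2 v w -> \det (frame_mx v w) = 1.
Proof.
move=> [vv ww vw]; transitivity (dot (cross v w) (cross v w)).
  by rewrite det3 !mxE /= dotE !row3_0 !row3_1 !row3_2; ring.
by rewrite dot_cross_self vv ww vw expr0n subr0 mulr1.
Qed.

Lemma frame_coordinates v w (M : 'M[R]_3) i j :
  (M *m (frame_mx v w)^T) i j = dot (row i M) ([:: v; w; cross v w]`_j).
Proof. by rewrite mxE; apply: eq_bigr => k _; rewrite !mxE. Qed.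

Lemma orthonormal_eq0 v w x : orthonormal2 v w ->
  dot x v = 0 -> dot x w = 0 -> dot x (cross v w) = 0 -> x = 0.
Proof.
move=> on xv xw xm; have u : (frame_mx v w)^T \in unitmx.
  by rewrite unitmx_tr unitmxE det_frame_mx// unitr1.
rewrite -(mulmxK u x); suff -> : x *m (frame_mx v w)^T = 0 by rewrite mul0mx.
apply/rowP => j; rewrite [RHS]mxE; transitivity (dot x ([:: v; w; cross v w]`_j)).
  by rewrite mxE; apply: eq_bigr => k _; rewrite !mxE.
by case: (ord3_cases j) => ->.
Qed.

Lemma derive1_coord f t j : smooth_at t f ->
  (derive1 f t) 0 j = derive1 (fun s => f s 0 j) t.
Proof.
move=> sf; rewrite !derive1E derive_mx; last exact: smooth_at_derivable.
by rewrite mxE.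
Qed.

Lemma smooth_derive1 (W : normedModType R) (f : R -> W) t : smooth_at t f -> smooth_at t (derive1 f).
Proof.
move=> sf; have -> : derive1 f = 'D_1 f by apply/funext => s; rewrite derive1E.
exact: smooth_at_derive.
Qed.

Lemma smooth_cross f g t : smooth_at t f -> smooth_at t g -> smooth_at t (fun s => cross (f s) (g s)).
Proof.
move=> sf sg; have sfi i := smooth_at_coordf i sf; have sgi i := smooth_at_coordf i sg.
by apply: smooth_at_row3; apply: smooth_atB; apply: smooth_atM.
Qed.

Lemma derive1_dot f g t : smooth_at t f -> smooth_at t g ->
  derive1 (fun s => dot (f s) (g s)) t = dot (derive1 f t) (g t) + dot (f t) (derive1 g t).
Proof.
move=> sf sg; have sfi i := smooth_at_coordf i sf; have sgi i := smooth_at_coordf i sg.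
rewrite derive1E derive_sumf => [|i]; last exact: smooth_atM.
rewrite -big_split; apply: eq_bigr => i _; rewrite (derive_mulf _ (sfi i) (sgi i)).
by rewrite !derive1_coord// !derive1E addrC mulrC.
Qed.

End Frames.

(** * Singular points of normal surfaces *)

Section NormalSurface.
Context {R : realType}.
Variables (gamma v w : R -> 'rV[R]_3) (t0 lambda0 : R).

Hypotheses (sg : smooth_at t0 gamma) (sv : smooth_at t0 v) (sw : smooth_at t0 w).
Hypothesis on : \forall t \near t0, orthonormal2 (v t) (w t).
Hypothesis gv : \forall t \near t0, dot (derive1 gamma t) (v t) = 0.
Hypothesis gw : \forall t \near t0, dot (derive1 gamma t) (w t) = 0.

Let p := row2 t0 lambda0.
Let l := curv_l v w.
Let m := curv_m v w.
Let alpha := curv_alpha gamma v w.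
Let mu := unit_tangent v w.

Let velocity := derive1 gamma t0 + lambda0 *: derive1 v t0.

Lemma smooth_NS (x : 'rV[R]_2) : smooth_at (x 0 0) gamma -> smooth_at (x 0 0) v ->
  smooth_at x (NS gamma v).
Proof.
move=> sgx svx.
have sgc : smooth_at x (fun y : 'rV[R]_2 => gamma (y 0 0)).
  exact: smooth_at_comp1rV (smooth_at_coord x 0) sgx.
have svc : smooth_at x (fun y : 'rV[R]_2 => v (y 0 0)).
  exact: smooth_at_comp1rV (smooth_at_coord x 0) svx.
apply: smooth_atD => //; apply: smooth_at_rV => j.
apply: smooth_at_eq (smooth_atM (smooth_at_coord x 1) (smooth_at_coordf j svc)).
by apply: filterE => y; rewrite [RHS]mxE.
Qed.

Lemma NS_coordE (x : 'rV[R]_2) j : NS gamma v x 0 j = gamma (x 0 0) 0 j + x 0 1 * v (x 0 0) 0 j.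
Proof. by rewrite /NS !mxE. Qed.

Lemma derive_NS0 j (x : 'rV[R]_2) : smooth_at (x 0 0) gamma -> smooth_at (x 0 0) v ->
  'D_(e_ 0) (fun y => NS gamma v y 0 j) x = derive1 gamma (x 0 0) 0 j + x 0 1 * derive1 v (x 0 0) 0 j.
Proof.
move=> sgx svx; set a := x 0 0 in sgx svx *; set b := x 0 1.
have d1 := smooth_is_derive (1 : R) (smooth_at_coordf j sgx).
have d2 := is_deriveZ b (smooth_is_derive (1 : R) (smooth_at_coordf j svx)).
have d3 := is_deriveD d1 d2.
have H : is_derive (row2 a b) (e_ 0) (fun y => NS gamma v y 0 j)
    (derive1 gamma a 0 j + b * derive1 v a 0 j).
  apply/is_derive_row0; rewrite !derive1_coord// !derive1E.
  apply: near_eq_is_derive d3; apply: filterE => t.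
  by rewrite NS_coordE row2_0 row2_1.
by rewrite row2K in H; exact: (derive_val (is_derive := H)).
Qed.

Lemma derive_NS1 j (x : 'rV[R]_2) : 'D_(e_ 1) (fun y => NS gamma v y 0 j) x = v (x 0 0) 0 j.
Proof.
set a := x 0 0; set b := x 0 1.
have d1 := is_derive_cst (gamma a 0 j) b (1 : R).
have d2 := is_deriveZ (v a 0 j) (is_derive_id b (1 : R)).
have d3 := is_deriveD d1 d2.
have H : is_derive (row2 a b) (e_ 1) (fun y => NS gamma v y 0 j) (v a 0 j).
  apply/is_derive_row1; apply: near_eq_is_derive (is_derive_eq d3 _).
    by apply: filterE => t; rewrite NS_coordE row2_0 row2_1 mulrC.
  by rewrite add0r [LHS]mulr1.
by rewrite row2K in H; exact: (derive_val (is_derive := H)).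
Qed.

Let sNS : smooth_at p (NS gamma v).
Proof. by apply: smooth_NS; rewrite row2_0. Qed.

Let near_p (P : R -> Prop) : (\forall t \near t0, P t) -> \forall x \near p, P ((x : 'rV[R]_2) 0 0).
Proof.
move=> nP; apply: (near_comp (P := P) (smooth_at_continuous (smooth_at_coord p 0))).
by rewrite row2_0.
Qed.

Lemma NS_second_jet j :
  [/\ second_jet (fun x => NS gamma v x 0 j) p 0 = v t0 0 j,
      second_jet (fun x => NS gamma v x 0 j) p 1 = derive1 v t0 0 j &
      second_jet (fun x => NS gamma v x 0 j) p 2 =
        (derive1 (derive1 gamma) t0 + lambda0 *: derive1 (derive1 v) t0) 0 j].
Proof.
have D0 : \forall x \near p, 'D_(e_ 0) (fun y => NS gamma v y 0 j) x =
    NS (derive1 gamma) (derive1 v) x 0 j.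
  apply: filterS2 (near_p (smooth_at_near sg)) (near_p (smooth_at_near sv)) => x sgx svx.
  by rewrite derive_NS0// /NS !mxE.
split; rewrite /second_jet /=.
- by rewrite derive_NS1 row2_0.
- have d1 := is_derive_cst (derive1 gamma t0 0 j) lambda0 (1 : R).
  have d2 := is_deriveZ (derive1 v t0 0 j) (is_derive_id lambda0 (1 : R)).
  have d3 := is_deriveD d1 d2.
  have H : is_derive p (e_ 1) (fun y => NS (derive1 gamma) (derive1 v) y 0 j) (derive1 v t0 0 j).
    apply/is_derive_row1; apply: near_eq_is_derive (is_derive_eq d3 _).
      by apply: filterE => t; rewrite /NS !mxE /= mulrC.
    by rewrite add0r [LHS]mulr1.
  by rewrite (near_eq_derive _ D0); exact: (derive_val (is_derive := H)).
- have sg' := smooth_derive1 sg; have sv' := smooth_derive1 sv.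
  have d1 := smooth_is_derive (1 : R) (smooth_at_coordf j sg').
  have d2 := is_deriveZ lambda0 (smooth_is_derive (1 : R) (smooth_at_coordf j sv')).
  have d3 := is_deriveD d1 d2.
  have H : is_derive p (e_ 0) (fun y => NS (derive1 gamma) (derive1 v) y 0 j)
      ((derive1 (derive1 gamma) t0 + lambda0 *: derive1 (derive1 v) t0) 0 j).
    have E : (derive1 (derive1 gamma) t0 + lambda0 *: derive1 (derive1 v) t0) 0 j =
        'D_1 (fun s => derive1 gamma s 0 j) t0 + lambda0 *: 'D_1 (fun s => derive1 v s 0 j) t0.
      rewrite -(derive1E (fun s => derive1 gamma s 0 j)) -(derive1E (fun s => derive1 v s 0 j)).
      rewrite -(derive1_coord j sg') -(derive1_coord j sv').
      by move: (derive1 (derive1 gamma) t0) (derive1 (derive1 v) t0) => A B; rewrite !mxE.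
    rewrite E; apply/(is_derive_row0 (fun y => NS (derive1 gamma) (derive1 v) y 0 j) t0 lambda0).
    apply: near_eq_is_derive d3; apply: filterE => t.
    by rewrite /NS; move: (derive1 gamma) (derive1 v) => A B; rewrite !mxE.
  by rewrite (near_eq_derive _ D0); exact: (derive_val (is_derive := H)).
Qed.

Let on0 : orthonormal2 (v t0) (w t0). Proof. exact: nbhs_singleton on. Qed.

Let derive1_near_cst (f : R -> R) c : (\forall t \near t0, f t = c) -> derive1 f t0 = 0.
Proof.
move=> fc; rewrite derive1E.
have := near_eq_derive (1 : R) fc => ->; exact: derive_cst.
Qed.

Let vv' : dot (derive1 v t0) (v t0) = 0.
Proof.
have E : \forall t \near t0, dot (v t) (v t) = 1 by apply: filterS on => t [].
have := derive1_near_cst E; rewrite (derive1_dot sv sv) [X in _ + X]dotC => /eqP.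
by rewrite -mulr2n mulrn_eq0 /= => /eqP.
Qed.

Lemma velocity_coordinates :
  [/\ dot velocity (v t0) = 0, dot velocity (w t0) = lambda0 * l t0 & dot velocity (mu t0) = alpha t0 + lambda0 * m t0].
Proof.
rewrite /velocity !dotDl !dotZl vv' mulr0 (nbhs_singleton gv) (nbhs_singleton gw) addr0 add0r.
by [].
Qed.

(** The velocity has no component along v, as v is a unit vector field. *)
Lemma velocity_eq0 : velocity = 0 <-> lambda0 * l t0 = 0 /\ alpha t0 + lambda0 * m t0 = 0.
Proof.
have [uv uw um] := velocity_coordinates; split=> [u0|[h1 h2]].
  by rewrite -uw -um u0 !dot0l.
apply: (orthonormal_eq0 on0) => //; first by rewrite uw.
by rewrite -/(mu t0) um.
Qed.

Lemma derive_NS_vec h : 'D_h (NS gamma v) p = h 0 0 *: velocity + h 0 1 *: v t0.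
Proof.
have dNS := smooth_at_differentiable sNS.
rewrite derive_grad//; congr (_ *: _ + _ *: _); apply/rowP => j.
- rewrite derive_mx; last exact: smooth_at_derivable.
  rewrite [LHS]mxE derive_NS0 ?row2_0// row2_1 /velocity.
  by move: (derive1 gamma t0) (derive1 v t0) => A B; rewrite !mxE.
- rewrite derive_mx; last exact: smooth_at_derivable.
  by rewrite [LHS]mxE derive_NS1 row2_0.
Qed.

(** The differential sends (h0, h1) to h0 F_t + h1 v, and v is orthogonal
    to F_t; a nonzero kernel vector must have h1 = 0. *)
Lemma singular_velocity : singular_point (NS gamma v) p <-> velocity = 0.
Proof.
have dNS := smooth_at_differentiable sNS; have [vv _ _] := on0.
have [uv _ _] := velocity_coordinates.
rewrite /singular_point; split=> [rk|u0].
- have : kermx ('J (NS gamma v) p) != 0.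
    by rewrite kermx_eq0 /row_free; apply/eqP => rk2; rewrite rk2 in rk.
  case/rowV0Pn => h /sub_kermxP; rewrite -deriveEjacobian// derive_NS_vec => E h0.
  have h1 : h 0 1 = 0.
    have : dot (h 0 0 *: velocity + h 0 1 *: v t0) (v t0) = 0 by rewrite E dot0l.
    by rewrite dotDl !dotZl uv vv mulr0 add0r mulr1.
  move: E; rewrite h1 scale0r addr0 => /eqP; rewrite scaler_eq0 => /orP[/eqP h00|/eqP//].
  by case/eqP: h0; apply: eq_row2; rewrite mxE.
- suff -> : 'J (NS gamma v) p = (delta_mx 1 0 : 'M[R]_(2, 1)) *m v t0.
    by rewrite (leq_ltn_trans (mxrankM_maxl _ _))// ltnS rank_leq_col.
  apply/row_matrixP => i; rewrite rowE -deriveEjacobian// derive_NS_vec u0 scaler0 add0r.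
  apply/rowP => j; rewrite !mxE big_ord1 !mxE !eqxx andbT /=.
  by case: (ord2_cases i) => ->.
Qed.

(** The determinant is computed from the components of the rows in the
    frame (v, w, mu). The component of the last row along v is multiplied by
    a minor that vanishes. *)
Lemma det_cross_cap_NS : velocity = 0 ->
  \det (cross_cap_mx (NS gamma v) p) = alpha t0 * derive1 l t0 + derive1 alpha t0 * l t0.
Proof.
move=> u0; have [/esym uv /esym uw /esym um] := velocity_coordinates.
move: uw um; rewrite u0 !dot0l => lam_l lam_m.
have smu : smooth_at t0 mu by exact: smooth_cross.
have sg' := smooth_derive1 sg; have sv' := smooth_derive1 sv.
set n := derive1 (derive1 gamma) t0 + lambda0 *: derive1 (derive1 v) t0.
have l' : derive1 l t0 = dot (derive1 (derive1 v) t0) (w t0) + dot (derive1 v t0) (derive1 w t0).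
  exact: derive1_dot.
have m' : derive1 m t0 = dot (derive1 (derive1 v) t0) (mu t0) + dot (derive1 v t0) (derive1 mu t0).
  exact: derive1_dot.
have a' : derive1 alpha t0 = dot (derive1 (derive1 gamma) t0) (mu t0) + dot (derive1 gamma t0) (derive1 mu t0).
  exact: derive1_dot.
have g' : dot (derive1 (derive1 gamma) t0) (w t0) + dot (derive1 gamma t0) (derive1 w t0) = 0.
  by rewrite -(derive1_dot sg' sw); exact: derive1_near_cst gw.
have uz z : dot (derive1 gamma t0) z + lambda0 * dot (derive1 v t0) z = 0.
  by rewrite -dotZl -dotDl -/velocity u0 dot0l.
have nw : dot n (w t0) = lambda0 * derive1 l t0.
  rewrite /n dotDl dotZl l'.
  have alg (a b c d k : R) : a + d = 0 -> d + k * c = 0 -> a + k * b = k * (b + c).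
    by move=> /eqP; rewrite addr_eq0 => /eqP -> /eqP; rewrite addr_eq0 => /eqP ->; ring.
  exact: alg g' (uz (derive1 w t0)).
have nmu : dot n (mu t0) = derive1 alpha t0 + lambda0 * derive1 m t0.
  rewrite /n dotDl dotZl m' a'.
  have alg (a b c d k : R) : d + k * c = 0 -> a + k * b = a + d + k * (b + c).
    by move=> /eqP; rewrite addr_eq0 => /eqP ->; ring.
  exact: alg (uz (derive1 mu t0)).
have rowE0 : row 0 (cross_cap_mx (NS gamma v) p) = v t0.
  by apply/rowP => j; rewrite !mxE; have [] := NS_second_jet j.
have rowE1 : row 1 (cross_cap_mx (NS gamma v) p) = derive1 v t0.
  by apply/rowP => j; rewrite !mxE; have [] := NS_second_jet j.
have rowE2 : row 2 (cross_cap_mx (NS gamma v) p) = n.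
  by apply/rowP => j; rewrite 2!mxE; have [_ _ ->] := NS_second_jet j.
have [vv ww vw] := on0.
have dF := det_frame_mx on0.
have -> : \det (cross_cap_mx (NS gamma v) p) =
    \det (cross_cap_mx (NS gamma v) p *m (frame_mx (v t0) (w t0))^T).
  by rewrite det_mulmx det_tr dF mulr1.
rewrite det3 !frame_coordinates rowE0 rowE1 rowE2 /=.
rewrite vv vw dot_crossl vv' nw nmu.
have alg (x y z x' y' z' k e : R) : k * x = 0 -> z + k * y = 0 ->
    1 * (x * (z' + k * y') - y * (k * x')) - 0 * (0 * (z' + k * y') - y * e) +
    0 * (0 * (k * x') - x * e) = z * x' + z' * x.
  move=> kx /eqP; rewrite addr_eq0 => /eqP ->.
  by transitivity (k * x * y' - k * y * x' + z' * x); [ring|rewrite kx; ring].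
exact: alg lam_l lam_m.
Qed.

End NormalSurface.

(** * Rotated frames and the cross cap condition *)

Section RotatedFrame.
Context {R : realType}.
Variables (nu1 nu2 : R -> 'rV[R]_3) (theta : R -> R).

Lemma smooth_rotated t : smooth_at t nu1 -> smooth_at t nu2 -> smooth_at t theta ->
  smooth_at t (rot_v theta nu1 nu2) /\ smooth_at t (rot_w theta nu1 nu2).
Proof.
move=> s1 s2 sth; have [ssin scos] := @smooth_sin_cos R.
have ss : smooth_at t (fun s => sin (theta s)).
  exact: smooth_at_comp1 sth (smooth_smooth_at openT I ssin).
have sc : smooth_at t (fun s => cos (theta s)).
  exact: smooth_at_comp1 sth (smooth_smooth_at openT I scos).
have s1j j := smooth_at_coordf j s1; have s2j j := smooth_at_coordf j s2.
split; apply: smooth_at_rV => j.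
- apply: smooth_at_eq (smooth_atB (smooth_atM sc (s1j j)) (smooth_atM ss (s2j j))).
  by apply: filterE => s; rewrite /rot_v !mxE.
- apply: smooth_at_eq (smooth_atD (smooth_atM ss (s1j j)) (smooth_atM sc (s2j j))).
  by apply: filterE => s; rewrite /rot_w !mxE.
Qed.

Lemma orthonormal_rotated t : Delta (nu1 t, nu2 t) ->
  orthonormal2 (rot_v theta nu1 nu2 t) (rot_w theta nu1 nu2 t).
Proof.
case; rewrite /S2 /= => n11 n22 n12.
have n21 : dot (nu2 t) (nu1 t) = 0 by rewrite dotC.
have cs : cos (theta t) ^+ 2 + sin (theta t) ^+ 2 = 1 by exact: cos2Dsin2.
rewrite /rot_v /rot_w; split;
  rewrite !(dotDl, dotDr, dotNl, dotNr, dotZl, dotZr) n11 n22 n12 n21.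
- by rewrite -[RHS]cs; ring.
- by rewrite -[RHS]cs; ring.
- by ring.
Qed.

Lemma dot_rotated t x : dot x (nu1 t) = 0 -> dot x (nu2 t) = 0 ->
  dot x (rot_v theta nu1 nu2 t) = 0 /\ dot x (rot_w theta nu1 nu2 t) = 0.
Proof.
move=> x1 x2; rewrite /rot_v /rot_w !(dotDr, dotNr, dotZr) x1 x2 !mulr0.
by rewrite subr0 addr0.
Qed.

End RotatedFrame.

Theorem proposition3p5 (R : realType) (I : set R)
    (gamma nu1 nu2 : R -> 'rV[R]_3) (theta : R -> R) (t0 lambda0 : R) :
  open_interval I -> framed_curve I gamma nu1 nu2 -> smooth I theta -> I t0 ->
  let v := rot_v theta nu1 nu2 in
  let w := rot_w theta nu1 nu2 in
  let l := curv_l v w in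
  let m := curv_m v w in
  let alpha := curv_alpha gamma v w in
  let p := row2 t0 lambda0 in
  (singular_point (NS gamma v) p <->
     lambda0 * l t0 = 0 /\ alpha t0 + lambda0 * m t0 = 0) /\
  (singular_point (NS gamma v) p ->
     (cross_cap (NS gamma v) p <->
        alpha t0 * derive1 l t0 + derive1 alpha t0 * l t0 != 0)).
Proof.
move=> [oI _] [[sgI s1I s2I] frame gnu] sthI It0 v w l m alpha p.
have sg := smooth_smooth_at oI It0 sgI.
have [sv sw] := smooth_rotated (smooth_smooth_at oI It0 s1I)
  (smooth_smooth_at oI It0 s2I) (smooth_smooth_at oI It0 sthI).
have nI : \forall t \near t0, I t by exact: open_nbhs_nbhs.
have on : \forall t \near t0, orthonormal2 (v t) (w t).
  by apply: filterS nI => t It; apply: orthonormal_rotated; exact: frame.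
have gvw t : I t -> dot (derive1 gamma t) (v t) = 0 /\ dot (derive1 gamma t) (w t) = 0.
  by move=> /gnu[g1 g2]; exact: dot_rotated.
have gv : \forall t \near t0, dot (derive1 gamma t) (v t) = 0.
  by apply: filterS nI => t /gvw[].
have gw : \forall t \near t0, dot (derive1 gamma t) (w t) = 0.
  by apply: filterS nI => t /gvw[].
have singE := singular_velocity lambda0 sg sv on gv gw.
split; first exact: iff_trans singE (velocity_eq0 lambda0 sv on gv gw).
move=> sing; have /singE u0 := sing.
have sNS : smooth_at p (NS gamma v) by apply: smooth_NS; rewrite row2_0.
have NS0 j : 'D_(e_ 0) (fun x => NS gamma v x 0 j) p = 0.
  rewrite derive_NS0 ?row2_0// row2_1.
  have := congr1 (fun z : 'rV[R]_3 => z 0 j) u0.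
  by move: (derive1 gamma t0) (derive1 v t0) => A B; rewrite !mxE.
rewrite -(det_cross_cap_NS sg sv sw on gv gw u0) -(whitney_criterion sNS NS0).
by split=> [[]|].
Qed.
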